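(* Let $E\to M$ be a nonzero vector bundle over a smooth manifold $M$, let $\mathcal{E}=\mathfrak{D}E\oplus\mathfrak{J}E$ be its omni-Lie algebroid and $\mathcal{T}=TM\oplus E$. There is a one-to-one correspondence between reducible Dirac structures $L\subset\mathcal{E}$ and projective Lie algebroids $A=\mathbf{b}(L)\subset\mathcal{T}$ such that $A$ is the quotient Lie algebroid of $L$. That is: for every reducible Dirac structure $L$, the subbundle $\mathbf{b}(L)\subset\mathcal{T}$ has a (unique) projective Lie algebroid structure for which $\mathbf{b}:\Gamma(L)\to\Gamma(\mathbf{b}(L))$ preserves brackets; and for every projective Lie algebroid $(A,[\cdot,\cdot]_A,\rho_A)$ in $\mathcal{T}$ there is exactly one reducible Dirac structure $L\subset\mathcal{E}$ with $\mathbf{b}(L)=A$ and $\mathbf{b}\{X,Y\}=[\mathbf{b}X,\mathbf{b}Y]_A$ for all $X,Y\in\Gamma(L)$.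
   Context: Omni-Lie algebroid. $\mathfrak{D}E$ is the gauge Lie algebroid of $E$: its sections are the $\mathbb{R}$-linear operators $\mathfrak{d}:\Gamma(E)\to\Gamma(E)$ for which there is a vector field $\alpha(\mathfrak{d})$ with $\mathfrak{d}(fu)=f\mathfrak{d}u+\alpha(\mathfrak{d})(f)u$; the bracket $[\cdot,\cdot]_{\mathfrak{D}}$ is the commutator, the anchor is $\alpha:\mathfrak{D}E\to TM$, and $\ker\alpha=\mathfrak{gl}(E)$. $\mathfrak{J}E$ is the first jet bundle of $E$ with projection $\mathbf{p}:\mathfrak{J}E\to E$ and $\ker\mathbf{p}=\mathrm{Hom}(TM,E)$. For $u\in\Gamma(E)$, $\mathbf{d}u\in\Gamma(\mathfrak{J}E)$ denotes its first jet; $\mathrm{Hom}(TM,E)$ is embedded so that $\mathbf{d}(fu)=f\,\mathbf{d}u+df\otimes u$. There is a nondegenerate $C^\infty(M)$-bilinear $E$-valued pairing with $\langle\mathbf{d}u,\mathfrak{d}\rangle_E=\langle\mathfrak{d},\mathbf{d}u\rangle_E=\mathfrak{d}u$. For $\mathfrak{d}\in\Gamma(\mathfrak{D}E)$ and $\mu\in\Gamma(\mathfrak{J}E)$, the Lie derivative $\mathfrak{L}_{\mathfrak{d}}\mu\in\Gamma(\mathfrak{J}E)$ is defined by $\langle\mathfrak{L}_{\mathfrak{d}}\mu,\mathfrak{d}'\rangle_E=\mathfrak{d}\langle\mu,\mathfrak{d}'\rangle_E-\langle\mu,[\mathfrak{d},\mathfrak{d}']_{\mathfrak{D}}\rangle_E$.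 On $\mathcal{E}=\mathfrak{D}E\oplus\mathfrak{J}E$ let $\rho:\mathcal{E}\to\mathfrak{D}E$ be the projection, $$\{\mathfrak{d}+\mu,\mathfrak{r}+\nu\}=[\mathfrak{d},\mathfrak{r}]_{\mathfrak{D}}+\mathfrak{L}_{\mathfrak{d}}\nu-\mathfrak{L}_{\mathfrak{r}}\mu+\mathbf{d}\langle\mu,\mathfrak{r}\rangle_E,\qquad (\mathfrak{d}+\mu,\mathfrak{r}+\nu)_E=\tfrac12(\langle\mathfrak{d},\nu\rangle_E+\langle\mathfrak{r},\mu\rangle_E).$$ The bundle map $\mathbf{b}:\mathcal{E}\to\mathcal{T}=TM\oplus E$ is $\mathbf{b}(\mathfrak{d}+\mu)=\alpha(\mathfrak{d})+\mathbf{p}(\mu)$. Dirac structures. For a subbundle $S\subset\mathcal{E}$, $S^\perp=\{X\in\mathcal{E}: (X,s)_E=0\ \forall s\in S\}$; $S$ is isotropic if $S\subset S^\perp$, and maximal isotropic means equivalently $S=S^\perp$. A Dirac structure is a maximal isotropic subbundle $L$ with $\{\Gamma(L),\Gamma(L)\}\subset\Gamma(L)$; it is a Lie algebroid with the restricted bracket and anchor $\alpha\circ\rho$. A Dirac structure $L$ is reducible if $\mathbf{b}(L)$ is a regular (constant rank) subbundle of $\mathcal{T}$. Projective Lie algebroid. A projective Lie algebroid is a subbundle $A\subset TM\oplus E$ equipped with a Lie algebroid structure $(A,[\cdot,\cdot]_A,\rho_A)$ whose anchor is $\rho_A=pr_{TM}|_A$. *)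

(* Defs.v *)
From HB Require Import structures.
From mathcomp Require Import all_boot all_order all_algebra.
From mathcomp Require Import all_classical all_reals.
From mathcomp Require Import topology normedtype landau derive.
From mathcomp Require Import ring.

Set Implicit Arguments.
Unset Strict Implicit.
Unset Printing Implicit Defensive.

Import Order.TTheory GRing.Theory Num.Theory.
Import numFieldNormedType.Exports.

Local Open Scope classical_set_scope.
Local Open Scope ring_scope.

Section smooth_functions.
Variables (R : realType) (n : nat).
Implicit Types (U W : set 'rV[R]_n) (f g : 'rV[R]_n -> R).

(* For open U: f is k times differentiable on U, with continuous derivatives of
   order k. *)
Fixpoint class_C U (k : nat) f : Prop :=
  match k with
  | 0 => forall y, U y -> {for y, continuous f}
  | k'.+1 => (forall y, U y -> differentiable f y) /\
             (forall v, class_C U k' (fun y => 'D_v f y))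
  end.

Definition smooth_on U f := forall k, class_C U k f.

Lemma near_eq_differentiable f g y :
  (\forall z \near y, f z = g z) -> differentiable f y -> differentiable g y.
Proof.
move=> fg df; rewrite -[g](subrK f) addrC; apply: differentiableD => //.
set h := g - f.
have h0 : \forall z \near y, h z = 0.
  by near=> z; rewrite /h !fctE (near fg z) ?subrr.
have hy : h y = 0 by exact: nbhs_singleton h0.
have c0 : continuous (\0 : 'rV[R]_n -> R) by exact: cst_continuous.
have ho : h \o shift y = cst (h y) + \0 +o_ 0 id.
  apply/eqaddoP => e e0.
  have := h0; rewrite (near_shift 0) subr0 => h1.
  near=> z; rewrite hy !fctE /= addr0 subr0.
  by rewrite [h _](near h1 z) ?normr0 ?mulr_ge0 ?(ltW e0).
have dh : 'd h y = \0 :> (_ -> _) by apply: (@diff_unique _ _ _ h \0 y).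
by apply/diff_locallyP; rewrite dh; split.
Unshelve. all: by end_near. Qed.

Lemma class_C_eq U k f g : open U -> (forall y, U y -> f y = g y) ->
  class_C U k f -> class_C U k g.
Proof.
move=> oU; elim: k f g => [|k ih] f g fg /=.
  move=> cf y Uy; have : \forall z \near y, f z = g z.
    by near=> z; apply: fg; near: z; exact: open_nbhs_nbhs.
  move=> nfg; rewrite /prop_for /continuous_at -fg//.
  exact: (cvg_trans (near_eq_cvg nfg)) (cf y Uy).
have nfg y : U y -> \forall z \near y, f z = g z.
  by move=> Uy; near=> z; apply: fg; near: z; exact: open_nbhs_nbhs.
move=> [df Df]; split=> [y Uy|v].
  exact: near_eq_differentiable (nfg _ Uy) (df _ Uy).
apply: ih (Df v) => y Uy; exact/near_eq_derive/nfg.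
Unshelve. all: by end_near. Qed.

Lemma class_C_sub U W k f : U `<=` W -> class_C W k f -> class_C U k f.
Proof.
move=> UW; elim: k f => [|k ih] f /= => [cf y /UW|[df Df]]; first exact: cf.
by split=> [y /UW|v]; [exact: df|exact: (ih _ (Df v))].
Qed.

Lemma class_CW U k f : class_C U k.+1 f -> class_C U k f.
Proof.
elim: k f => [|k ih] f; first by move=> [df _] y /df/differentiable_continuous.
by move=> [df Df]; split=> // v; exact: (ih _ (Df v)).
Qed.

Lemma class_C_cst U k (c : R) : class_C U k (fun=> c).
Proof.
elim: k c => [|k ih] c /=; first by move=> y _; exact: cst_continuous.
split=> [y _|v]; first exact: differentiable_cst.
suff -> : (fun y => 'D_v (fun=> c) y) = (fun=> 0 : R) by exact: ih.
by apply/funext => y; exact: derive_cst.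
Qed.

Lemma class_CD U k f g : open U ->
  class_C U k f -> class_C U k g -> class_C U k (fun y => f y + g y).
Proof.
move=> oU; elim: k f g => [|k ih] f g /=.
  by move=> cf cg y Uy; apply: continuousD; [exact: cf|exact: cg].
move=> [df Df] [dg Dg]; split=> [y Uy|v].
  by apply: differentiableD; [exact: df|exact: dg].
apply: (class_C_eq oU) (ih _ _ (Df v) (Dg v)) => y Uy.
by rewrite -deriveD//; apply: diff_derivable; [exact: df|exact: dg].
Qed.

Lemma class_CM U k f g : open U ->
  class_C U k f -> class_C U k g -> class_C U k (fun y => f y * g y).
Proof.
move=> oU; elim: k f g => [|k ih] f g.
  by move=> cf cg y Uy; apply: continuousM; [exact: cf|exact: cg].
move=> Cf Cg; have [df Df] := Cf; have [dg Dg] := Cg; split=> [y Uy|v].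
  by apply: differentiableM; [exact: df|exact: dg].
have := class_CD oU (ih _ _ (class_CW Cf) (Dg v)) (ih _ _ (class_CW Cg) (Df v)).
apply: (class_C_eq oU) => y Uy.
by rewrite -deriveM//; apply: diff_derivable; [exact: df|exact: dg].
Qed.

End smooth_functions.

Section manifolds.
Variables (R : realType) (n : nat).

(* [cmap] and [cinv] are total, but only their restrictions to [cdom] and
   [ccod] matter. *)
Record chart (M : topologicalType) := Chart {
  cdom : set M;
  ccod : set 'rV[R]_n;
  cmap : M -> 'rV[R]_n;
  cinv : 'rV[R]_n -> M;
  cdom_open : open cdom;
  ccod_open : open ccod;
  cmap_cod : forall x, cdom x -> ccod (cmap x);
  cinv_dom : forall y, ccod y -> cdom (cinv y);
  cmapK : forall x, cdom x -> cinv (cmap x) = x;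
  cinvK : forall y, ccod y -> cmap (cinv y) = y;
  cmap_continuous : forall x, cdom x -> {for x, continuous cmap};
  cinv_continuous : forall y, ccod y -> {for y, continuous cinv}
}.

Definition chart_compatible (M : topologicalType) (c c' : chart M) : Prop :=
  forall k : 'I_n, smooth_on (ccod c `&` cinv c @^-1` cdom c')
                             (fun y => cmap c' (cinv c y) 0 k).

Record manifold := Manifold {
  mspace :> topologicalType;
  mspace_hausdorff : hausdorff_space mspace;
  mspace_second_countable : @second_countable mspace;
  atlas : set (chart mspace);
  atlas_cover : forall x, exists2 c, atlas c & cdom c x;
  atlas_compatible :
    forall c c', atlas c -> atlas c' -> chart_compatible c c'
}.

Variable M : manifold.
Implicit Types (W : set M) (f g : M -> R).

(* For open W: the restriction of f to W is smooth. *)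
Definition msmooth W f : Prop :=
  forall c, atlas c -> smooth_on (ccod c `&` cinv c @^-1` W) (f \o cinv c).

Lemma chart_preimage_open (c : chart M) W :
  open W -> open (ccod c `&` cinv c @^-1` W).
Proof.
move=> oW; rewrite openE => y [cy Wy]; rewrite /interior; apply: filterI.
  by apply: open_nbhs_nbhs; split=> //; exact: ccod_open.
by apply: (cinv_continuous cy); apply: open_nbhs_nbhs; split.
Qed.

Lemma msmooth_sub W W' f : W `<=` W' -> msmooth W' f -> msmooth W f.
Proof.
move=> sW sf c ac k; apply: class_C_sub (sf c ac k) => y [? ?]; split=> //.
exact: sW.
Qed.

Lemma msmooth_cst W (a : R) : msmooth W (fun=> a).
Proof. by move=> c ac k; exact: class_C_cst. Qed.

Lemma msmoothD W f g : open W ->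
  msmooth W f -> msmooth W g -> msmooth W (fun x => f x + g x).
Proof.
move=> oW sf sg c ac k.
exact: (@class_CD _ _ _ k (f \o _) (g \o _) (chart_preimage_open oW)
  (sf c ac k) (sg c ac k)).
Qed.

Lemma msmoothM W f g : open W ->
  msmooth W f -> msmooth W g -> msmooth W (fun x => f x * g x).
Proof.
move=> oW sf sg c ac k.
exact: (@class_CM _ _ _ k (f \o _) (g \o _) (chart_preimage_open oW)
  (sf c ac k) (sg c ac k)).
Qed.

Definition msmooth_pred : {pred (M -> R)} := fun f => `[< msmooth setT f >].

Lemma msmooth_predP f : reflect (msmooth setT f) (f \in msmooth_pred).
Proof. exact: asboolP. Qed.

Lemma msmooth_subring : subring_closed msmooth_pred.
Proof.
have oT : open [set: M] by exact: openT.
split=> [|f g /msmooth_predP sf /msmooth_predP sg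
  |f g /msmooth_predP sf /msmooth_predP sg];
  apply/msmooth_predP.
- exact: (@msmooth_cst setT 1).
- rewrite (_ : f - g = fun x => f x + -1 * g x).
    exact: msmoothD oT sf (msmoothM oT (@msmooth_cst setT (-1)) sg).
  by apply/funext => x; rewrite mulN1r.
- exact: msmoothM.
Qed.

Record cinf := Cinf { cinf_fun :> M -> R; cinf_smooth : cinf_fun \in msmooth_pred }.

HB.instance Definition _ := [isSub for cinf_fun].
HB.instance Definition _ := [Choice of cinf by <:].
HB.instance Definition _ :=
  GRing.SubChoice_isSubComPzRing.Build (M -> R) msmooth_pred cinf
    msmooth_subring.

Lemma cinf_cst_subproof (a : R) : (fun=> a) \in msmooth_pred.
Proof. by apply/msmooth_predP; exact: msmooth_cst. Qed.

Definition cinf_cst (a : R) : cinf := Cinf (cinf_cst_subproof a).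

End manifolds.

Section families.
Variables (R : realType) (n : nat) (M : manifold R n).

(* A family of vector spaces over M with, for each open W, the C^oo(W)-module of
   its smooth sections over W.  A section is a function on M of which only the
   restriction to W matters.  Local triviality is not part of this structure: it
   is required of E by [vbundle], and of subbundles by [is_subbundle]. *)
Record vfamily := VFamily {
  vfib :> M -> lmodType R;
  vsmooth : set M -> (forall x, vfib x) -> Prop;
  vsmooth0 : forall W, vsmooth W (fun x => 0);
  vsmooth_lin : forall (W : set M) (f : M -> R) (s t : forall x, vfib x),
    open W -> msmooth W f -> vsmooth W s -> vsmooth W t ->
    vsmooth W (fun x => f x *: s x + t x)
}.

(* Gamma(V) *)
Record gsect (V : vfamily) := Gam {
  gsect_fun :> forall x, V x;
  gsect_smooth : vsmooth setT gsect_fun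
}.

Lemma gsect_ext (V : vfamily) (s t : gsect V) : (forall x, s x = t x) -> s = t.
Proof.
case: s t => [s ss] [t st] /= st_eq.
have e : s = t by apply: functional_extensionality_dep.
by subst t; congr Gam; exact: Prop_irrelevance.
Qed.

HB.instance Definition _ (V : vfamily) := gen_eqMixin (gsect V).
HB.instance Definition _ (V : vfamily) := gen_choiceMixin (gsect V).

Section gsect_module.
Variable V : vfamily.
Implicit Types (s t : gsect V) (f : cinf M).

Let oT : open [set: M]. Proof. exact: openT. Qed.

Let smf f : msmooth setT f. Proof. by have /msmooth_predP := cinf_smooth f. Qed.

Let zeroS : vsmooth setT (fun x => 0 : V x).
Proof. exact: vsmooth0. Qed.

Let addS s t : vsmooth setT (fun x => s x + t x).
Proof.
have := vsmooth_lin oT (@msmooth_cst _ _ M setT 1) (gsect_smooth s) (gsect_smooth t).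
by congr vsmooth; apply: functional_extensionality_dep => x; rewrite scale1r.
Qed.

Let scaleS f s : vsmooth setT (fun x => f x *: s x).
Proof.
have := vsmooth_lin oT (smf f) (gsect_smooth s) zeroS.
by congr vsmooth; apply: functional_extensionality_dep => x; rewrite addr0.
Qed.

Let oppS s : vsmooth setT (fun x => - s x).
Proof.
have := vsmooth_lin oT (@msmooth_cst _ _ M setT (-1)) (gsect_smooth s) zeroS.
by congr vsmooth; apply: functional_extensionality_dep => x;
  rewrite addr0 scaleN1r.
Qed.

Let zeroG := Gam zeroS.
Let addG s t := Gam (addS s t).
Let oppG s := Gam (oppS s).
Let scaleG f s := Gam (scaleS f s).

Let addA : associative addG.
Proof. by move=> s t u; apply: gsect_ext => x; rewrite /= addrA. Qed.
Let addC : commutative addG.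
Proof. by move=> s t; apply: gsect_ext => x; rewrite /= addrC. Qed.
Let add0 : left_id zeroG addG.
Proof. by move=> s; apply: gsect_ext => x; rewrite /= add0r. Qed.
Let addN : left_inverse zeroG oppG addG.
Proof. by move=> s; apply: gsect_ext => x; rewrite /= addNr. Qed.

HB.instance Definition _ := GRing.isZmodule.Build (gsect V) addA addC add0 addN.

Let scA f g s : scaleG f (scaleG g s) = scaleG (f * g) s.
Proof. by apply: gsect_ext => x; rewrite /= scalerA. Qed.
Let sc1 : left_id 1 scaleG.
Proof. by move=> s; apply: gsect_ext => x; rewrite /= scale1r. Qed.
Let scDr : right_distributive scaleG +%R.
Proof. by move=> f s t; apply: gsect_ext => x; rewrite /= scalerDr. Qed.
Let scDl s : {morph scaleG^~ s : f g / f + g}.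
Proof. by move=> f g; apply: gsect_ext => x; rewrite /= scalerDl. Qed.

HB.instance Definition _ :=
  GRing.Zmodule_isLmodule.Build (cinf M) (gsect V) scA sc1 scDr scDl.

Lemma gsect_addE s t x : (s + t) x = s x + t x. Proof. by []. Qed.
Lemma gsect_oppE s x : (- s) x = - s x. Proof. by []. Qed.
Lemma gsect_0E x : (0 : gsect V) x = 0. Proof. by []. Qed.
Lemma gsect_scaleE f s x : (f *: s) x = f x *: s x. Proof. by []. Qed.

End gsect_module.

Lemma vsum_lin_subproof (V V' : vfamily) (W : set M) (f : M -> R)
    (s t : forall x, (V x * V' x)%type) :
  open W -> msmooth W f ->
  vsmooth W (fun x => (s x).1) /\ vsmooth W (fun x => (s x).2) ->
  vsmooth W (fun x => (t x).1) /\ vsmooth W (fun x => (t x).2) ->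
  vsmooth W (fun x => (f x *: s x + t x).1) /\
  vsmooth W (fun x => (f x *: s x + t x).2).
Proof. by move=> oW sf [s1 s2] [t1 t2]; split; exact: vsmooth_lin. Qed.

Definition vsum (V V' : vfamily) : vfamily :=
  @VFamily (fun x => (V x * V' x)%type : lmodType R)
    (fun W s => vsmooth W (fun x => (s x).1) /\ vsmooth W (fun x => (s x).2))
    (fun W => conj (vsmooth0 V W) (vsmooth0 V' W))
    (@vsum_lin_subproof V V').

Definition gfst (V V' : vfamily) (s : gsect (vsum V V')) : gsect V :=
  Gam (proj1 (gsect_smooth s)).
Definition gsnd (V V' : vfamily) (s : gsect (vsum V V')) : gsect V' :=
  Gam (proj2 (gsect_smooth s)).

Lemma gpair_subproof (V V' : vfamily) (s : gsect V) (t : gsect V') :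
  @vsmooth (vsum V V') setT (fun x => (s x, t x)).
Proof. by split; [exact: gsect_smooth s|exact: gsect_smooth t]. Qed.

Definition gpair (V V' : vfamily) (s : gsect V) (t : gsect V') : gsect (vsum V V') :=
  Gam (gpair_subproof s t).

Definition is_basis (V : lmodType R) (k : nat) (S : set V) (e : 'I_k -> V) :=
  (forall v, S v <-> exists c : 'I_k -> R, v = \sum_i c i *: e i) /\
  (forall c : 'I_k -> R, \sum_i c i *: e i = 0 -> forall i, c i = 0).

(* S is spanned, near each point, by a frame of smooth local sections; the rank
   k is the same over all of M. *)
Definition is_subbundle (V : vfamily) (S : forall x, set (V x)) : Prop :=
  exists k : nat, forall x0 : M, exists (U : set M)
      (e : 'I_k -> forall x, V x),
    [/\ open U, U x0, forall i, vsmooth U (e i)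
      & forall x, U x -> is_basis (S x) (e^~ x)].

Definition gsect_in (V : vfamily) (S : forall x, set (V x)) (s : gsect V) : Prop :=
  forall x, S x (s x).

(* The total space is not recorded: its smooth structure is determined by the
   fibrewise linear local trivializations, whose transition functions g are
   smooth.  [btriv j x] only matters for x in [btriv_dom j]. *)
Record vbundle (r : nat) := VBundle {
  bfib : M -> lmodType R;
  btriv_idx : Type;
  btriv_dom : btriv_idx -> set M;
  btriv : forall (j : btriv_idx) (x : M), {linear bfib x -> 'rV[R]_r};
  btriv_open : forall j, open (btriv_dom j);
  btriv_cover : forall x, exists j, btriv_dom j x;
  btriv_bij : forall j x, btriv_dom j x -> bijective (btriv j x);
  btriv_change : forall i j, exists g : M -> 'M[R]_r,
    (forall k l, msmooth (btriv_dom i `&` btriv_dom j) (fun x => g x k l)) /\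
    (forall x v, btriv_dom i x -> btriv_dom j x ->
       btriv j x v = btriv i x v *m g x)
}.

Section vbundle_family.
Variables (r : nat) (E : vbundle r).

Definition bsmooth (W : set M) (s : forall x, bfib E x) : Prop :=
  forall (j : btriv_idx E) (k : 'I_r),
    msmooth (btriv_dom j `&` W) (fun x => btriv j x (s x) 0 k).

Lemma bsmooth0 W : bsmooth W (fun x => 0).
Proof.
move=> j k; have := @msmooth_cst _ _ M (btriv_dom j `&` W) 0.
by congr msmooth; apply/funext => x; rewrite linear0 mxE.
Qed.

Lemma bsmooth_lin (W : set M) (f : M -> R) (s t : forall x, bfib E x) :
    open W -> msmooth W f -> bsmooth W s -> bsmooth W t ->
    bsmooth W (fun x => f x *: s x + t x).
Proof.
move=> oW sf ss st j k.
have oJ : open (btriv_dom j `&` W) by apply: openI => //; exact: btriv_open.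
have sf' : msmooth (btriv_dom j `&` W) f by apply: msmooth_sub sf => x [].
have := msmoothD oJ (msmoothM oJ sf' (ss j k)) (st j k).
by congr msmooth; apply/funext => x; rewrite linearP !mxE.
Qed.

Definition bundle_family : vfamily := VFamily bsmooth0 bsmooth_lin.

End vbundle_family.

End families.

Coercion bundle_family : vbundle >-> vfamily.

Section tangent_bundle.
Variables (R : realType) (n : nat) (M : manifold R n).
Implicit Types f g : cinf M.

(* T_xM: derivations of C^oo(M) at x *)
Definition derivation_at (x : M) : {pred (cinf M -> R^o)} := fun v =>
  `[< (forall (a : R) f g, v (cinf_cst M a * f + g) = a * v f + v g) /\
      (forall f g, v (f * g) = f x * v g + g x * v f) >].

Lemma derivation_submod x : subsemimod_closed (derivation_at x).
Proof.
apply: GRing.submod_closed_semi; split=> [|a v w /asboolP[vl vL] /asboolP[wl wL]].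
  apply/asboolP; split=> [a f g|f g]; rewrite [LHS]/(0 : R).
    by rewrite [X in a * X]/(0 : R) [X in _ + X]/(0 : R) mulr0 addr0.
  by rewrite ![X in _ * X]/(0 : R) !mulr0 addr0.
have E h : (a *: v + w) h = a * v h + w h by [].
by apply/asboolP; split=> [b f g|f g]; rewrite !E ?vl ?wl ?vL ?wL; ring.
Qed.

Record tangent (x : M) := Tangent {
  tangent_fun :> cinf M -> R^o;
  tangentP : tangent_fun \in derivation_at x
}.

HB.instance Definition _ x := [isSub for @tangent_fun x].
HB.instance Definition _ x := [Choice of tangent x by <:].
HB.instance Definition _ x :=
  GRing.SubChoice_isSubLmodule.Build R (cinf M -> R^o) (derivation_at x)
    (tangent x) (derivation_submod x).

Lemma tangent_0E x f : (0 : tangent x) f = 0. Proof. by []. Qed.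
Lemma tangent_addE x (v w : tangent x) f : (v + w) f = v f + w f.
Proof. by []. Qed.
Lemma tangent_scaleE x (a : R) (v : tangent x) f : (a *: v) f = a * v f.
Proof. by []. Qed.

(* X is smooth on W iff X(f) is, for all f in C^oo(M). *)
Definition tsmooth (W : set M) (X : forall x, tangent x) : Prop :=
  forall f, msmooth W (fun x => X x f).

Lemma tsmooth0 W : tsmooth W (fun x => 0).
Proof. by move=> f; exact: msmooth_cst. Qed.

Lemma tsmooth_lin (W : set M) (h : M -> R) (X Y : forall x, tangent x) :
  open W -> msmooth W h -> tsmooth W X -> tsmooth W Y ->
  tsmooth W (fun x => h x *: X x + Y x).
Proof.
move=> oW sh sX sY f.
exact: (msmoothD oW (msmoothM oW sh (sX f)) (sY f)).
Qed.

Definition TM : vfamily M := VFamily tsmooth0 tsmooth_lin.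

Lemma vapp_subproof (X : gsect TM) f : (fun x => X x f : R) \in @msmooth_pred _ _ M.
Proof. by apply/msmooth_predP; exact: (gsect_smooth X f). Qed.

Definition vapp (X : gsect TM) f : cinf M := Cinf (vapp_subproof X f).

Lemma vbr_at_subproof (X Y : gsect TM) x :
  (fun f => X x (vapp Y f) - Y x (vapp X f) : R^o) \in derivation_at x.
Proof.
have lin Z (a : R) f g :
    vapp Z (cinf_cst M a * f + g) = cinf_cst M a * vapp Z f + vapp Z g.
  apply/val_inj/funext => y /=.
  by have /asboolP[+ _] := tangentP (Z y); apply.
have lei Z f g : vapp Z (f * g) = f * vapp Z g + g * vapp Z f.
  apply/val_inj/funext => y /=.
  by have /asboolP[_ +] := tangentP (Z y); apply.
have lz (Z : gsect TM) (a : R) f g : Z x (cinf_cst M a * f + g) = a * Z x f + Z x g.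
  by have /asboolP[+ _] := tangentP (Z x : tangent x); apply.
have dz (Z : gsect TM) f g : Z x (f + g) = Z x f + Z x g.
  have := lz Z 1 f g; rewrite mul1r => <-; congr (Z x (_ + _)).
  by apply/val_inj/funext => y /=; rewrite [RHS]mul1r.
have ez (Z : gsect TM) f g : Z x (f * g) = f x * Z x g + g x * Z x f.
  by have /asboolP[_ +] := tangentP (Z x : tangent x); apply.
apply/asboolP; split=> [a f g|f g].
  by rewrite !lin !lz; ring.
by rewrite !lei !dz !ez /=; ring.
Qed.

Definition vbr_at (X Y : gsect TM) (x : M) : tangent x :=
  Tangent (vbr_at_subproof X Y x).

Lemma vbr_subproof (X Y : gsect TM) : tsmooth setT (vbr_at X Y).
Proof.
move=> f; have oT : open [set: M] by exact: openT.
have sX := gsect_smooth X (vapp Y f); have sY := gsect_smooth Y (vapp X f).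
have := msmoothD oT sX (msmoothM oT (@msmooth_cst _ _ M setT (-1)) sY).
by congr msmooth; apply/funext => x; rewrite mulN1r.
Qed.

Definition vbr (X Y : gsect TM) : gsect TM := @Gam _ _ _ TM _ (vbr_subproof X Y).

End tangent_bundle.

Section omni_lie.
Variables (R : realType) (n r : nat) (M : manifold R n) (E : vbundle M r).
Implicit Types (f : cinf M) (u w : gsect E).

(* The fibre of DE at x: pairs (d, v) of an R-linear map d : Gamma(E) -> E_x
   and its symbol v in T_xM.  When 0 < r the symbol is determined by d. *)
Definition gauge_at (x : M) : {pred ((gsect E -> E x) * tangent x)%type} :=
  fun d =>
  `[< (forall (a : R) u w, d.1 (cinf_cst M a *: u + w) = a *: d.1 u + d.1 w) /\
      (forall f u, d.1 (f *: u) = f x *: d.1 u + d.2 f *: u x) >].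

Lemma gauge_submod x : subsemimod_closed (@gauge_at x).
Proof.
apply: GRing.submod_closed_semi; split=> [|a d e /asboolP[dl dL] /asboolP[el eL]].
  apply/asboolP; split=> [a u w|f u]; rewrite [LHS]/(0 : E x).
    by rewrite [X in a *: X]/(0 : E x) [X in _ + X]/(0 : E x) scaler0 addr0.
  by rewrite [X in _ *: X]/(0 : E x) tangent_0E scaler0 scale0r addr0.
have L u : (a *: d + e).1 u = a *: d.1 u + e.1 u by [].
have S f : (a *: d + e).2 f = a * d.2 f + e.2 f.
  by rewrite -tangent_scaleE -tangent_addE.
apply/asboolP; split=> [b u w|f u]; rewrite !L ?S.
  rewrite dl el !scalerDr !scalerA addrACA; congr (_ + _ + _).
  by rewrite mulrC.
rewrite dL eL !scalerDr !scalerDl !scalerA addrACA; congr (_ + _ + _).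
by rewrite mulrC.
Qed.

Record gauge (x : M) := Gauge {
  gauge_val : ((gsect E -> E x) * tangent x)%type;
  gaugeP : gauge_val \in @gauge_at x
}.

HB.instance Definition _ x := [isSub for @gauge_val x].
HB.instance Definition _ x := [Choice of gauge x by <:].
HB.instance Definition _ x :=
  GRing.SubChoice_isSubLmodule.Build R ((gsect E -> E x) * tangent x)%type
    (@gauge_at x) (gauge x) (gauge_submod x).

Definition gauge_op x (d : gauge x) : gsect E -> E x := (gauge_val d).1.
Definition symbol x (d : gauge x) : tangent x := (gauge_val d).2.

Definition dsmooth (W : set M) (d : forall x, gauge x) : Prop :=
  (forall u, vsmooth W (fun x => gauge_op (d x) u)) /\
  tsmooth W (fun x => symbol (d x)).

Lemma dsmooth0 W : dsmooth W (fun x => 0).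
Proof. by split=> [u|]; [exact: vsmooth0|exact: tsmooth0]. Qed.

Lemma dsmooth_lin (W : set M) (h : M -> R) (d e : forall x, gauge x) :
  open W -> msmooth W h -> dsmooth W d -> dsmooth W e ->
  dsmooth W (fun x => h x *: d x + e x).
Proof.
move=> oW sh [sd sd'] [se se']; split=> [u|].
  exact: (vsmooth_lin oW sh (sd u) (se u)).
exact: (tsmooth_lin oW sh sd' se').
Qed.

Definition DE : vfamily M := VFamily dsmooth0 dsmooth_lin.

Definition dapp (d : gsect DE) u : gsect E := Gam (proj1 (gsect_smooth d) u).

Definition anchor (d : gsect DE) : gsect (TM M) :=
  @Gam _ _ _ (TM M) _ (proj2 (gsect_smooth d)).

Lemma gauge_lin_op x (d : gauge x) (a : R) u w :
  gauge_op d (cinf_cst M a *: u + w) = a *: gauge_op d u + gauge_op d w.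
Proof. by have /asboolP[+ _] := gaugeP d; apply. Qed.

Lemma gauge_leibniz x (d : gauge x) f u :
  gauge_op d (f *: u) = f x *: gauge_op d u + symbol d f *: u x.
Proof. by have /asboolP[_ +] := gaugeP d; apply. Qed.

Lemma gauge_opD x (d : gauge x) u w :
  gauge_op d (u + w) = gauge_op d u + gauge_op d w.
Proof.
have := gauge_lin_op d 1 u w; rewrite scale1r => <-; congr (gauge_op d (_ + _)).
by apply: gsect_ext => y; rewrite gsect_scaleE /= scale1r.
Qed.

Lemma sub_cross (V : zmodType) (a b c d a' d' : V) :
  a + b + (c + d) - (a' + c + (b + d')) = a - a' + (d - d').
Proof.
have -> : a + b + (c + d) = a + d + (c + b).
  by rewrite [c + d]addrC addrACA [b + c]addrC.
have -> : a' + c + (b + d') = a' + d' + (c + b).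
  by rewrite [b + d']addrC addrACA.
by rewrite opprD addrACA subrr addr0 opprD addrACA.
Qed.

Lemma gbr_at_subproof (d e : gsect DE) x :
  ((fun u => gauge_op (d x) (dapp e u) - gauge_op (e x) (dapp d u)),
   vbr (anchor d) (anchor e) x) \in @gauge_at x.
Proof.
have lin (c : gsect DE) (a : R) u w :
    dapp c (cinf_cst M a *: u + w) = cinf_cst M a *: dapp c u + dapp c w.
  by apply: gsect_ext => y; exact: gauge_lin_op.
have lei (c : gsect DE) f u :
    dapp c (f *: u) = f *: dapp c u + vapp (anchor c) f *: u.
  by apply: gsect_ext => y; exact: gauge_leibniz.
apply/asboolP; split=> [a u w|f u] /=.
  by rewrite !lin !gauge_lin_op scalerBr opprD addrACA.
rewrite !lei !gauge_opD !gauge_leibniz /=.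
rewrite scalerBr scalerBl; exact: sub_cross.
Qed.

Definition gbr_at (d e : gsect DE) (x : M) : gauge x :=
  Gauge (gbr_at_subproof d e x).

Lemma gbr_subproof (d e : gsect DE) : dsmooth setT (gbr_at d e).
Proof.
split=> [u|]; last exact: (gsect_smooth (vbr (anchor d) (anchor e))).
exact: (gsect_smooth (dapp d (dapp e u) - dapp e (dapp d u))).
Qed.

Definition gbr (d e : gsect DE) : gsect DE := @Gam _ _ _ DE _ (gbr_subproof d e).

Lemma gauge_id_subproof x : ((fun u => u x), 0 : tangent x) \in @gauge_at x.
Proof.
apply/asboolP; split=> [a u w|f u]; first by [].
by rewrite tangent_0E scale0r addr0.
Qed.

Definition gauge_id x : gauge x := Gauge (gauge_id_subproof x).

(* The fibre of JE at x: two sections have the same first jet at x iff all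
   elements of (DE)_x take the same value on them (vertical ones detect the
   value at x, the others the first derivatives at x), so the first jet of u
   at x is encoded as the functional d |-> d u = <du, d>. *)
Definition jet_at (x : M) : {pred (gauge x -> E x)} := fun mu =>
  `[< exists u, mu = fun d => gauge_op d u >].

Lemma jet_submod x : subsemimod_closed (@jet_at x).
Proof.
apply: GRing.submod_closed_semi; split=> [|a m p /asboolP[u ->] /asboolP[w ->]].
  apply/asboolP; exists 0; apply/funext => d.
  have := gauge_leibniz d 0 0.
  by rewrite scale0r scale0r gsect_0E scaler0 addr0.
apply/asboolP; exists (cinf_cst M a *: u + w); apply/funext => d.
by rewrite gauge_lin_op.
Qed.

Record jet (x : M) := Jet {
  jet_fun :> gauge x -> E x;
  jetP : jet_fun \in @jet_at x
}.

HB.instance Definition _ x := [isSub for @jet_fun x].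
HB.instance Definition _ x := [Choice of jet x by <:].
HB.instance Definition _ x :=
  GRing.SubChoice_isSubLmodule.Build R (gauge x -> E x)
    (@jet_at x) (jet x) (jet_submod x).

(* mu is smooth on W iff <mu, d> is, for all d in Gamma(DE). *)
Definition jsmooth (W : set M) (mu : forall x, jet x) : Prop :=
  forall d : gsect DE, vsmooth W (fun x => mu x (d x)).

Lemma jsmooth0 W : jsmooth W (fun x => 0).
Proof. by move=> d; exact: vsmooth0. Qed.

Lemma jsmooth_lin (W : set M) (h : M -> R) (mu nu : forall x, jet x) :
  open W -> msmooth W h -> jsmooth W mu -> jsmooth W nu ->
  jsmooth W (fun x => h x *: mu x + nu x).
Proof.
by move=> oW sh sm sn d; exact: (vsmooth_lin oW sh (sm d) (sn d)).
Qed.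

Definition JE : vfamily M := VFamily jsmooth0 jsmooth_lin.

(* <mu, d>_E *)
Definition jpair (mu : gsect JE) (d : gsect DE) : gsect E := Gam (gsect_smooth mu d).

Lemma jet_of_subproof x u : (fun d : gauge x => gauge_op d u) \in @jet_at x.
Proof. by apply/asboolP; exists u. Qed.

Definition jet_of x u : jet x := Jet (jet_of_subproof x u).

Lemma jet_sec_subproof u : jsmooth setT (fun x => jet_of x u).
Proof. by move=> d; exact: (proj1 (gsect_smooth d) u). Qed.

(* du *)
Definition jet_sec u : gsect JE := @Gam _ _ _ JE _ (jet_sec_subproof u).

(* p : JE -> E, as p(du) = u = <du, id_E> *)
Definition jproj x (mu : jet x) : E x := mu (gauge_id x).

(* The section of JE characterized by its pairings with Gamma(DE); the default
   value 0 of [xget] is never reached. *)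
Definition lie_der (d : gsect DE) (mu : gsect JE) : gsect JE :=
  xget 0 [set nu | forall e : gsect DE,
    jpair nu e = dapp d (jpair mu e) - jpair mu (gbr d e)].

Definition omni : vfamily M := vsum DE JE.

Definition Tfam : vfamily M := vsum (TM M) E.

Definition omni_br (X Y : gsect omni) : gsect omni :=
  gpair (gbr (gfst X) (gfst Y))
        (lie_der (gfst X) (gsnd Y) - lie_der (gfst Y) (gsnd X)
         + jet_sec (jpair (gsnd X) (gfst Y))).

Definition omni_form x (X Y : omni x) : E x :=
  2^-1 *: ((Y.2 : jet x) X.1 + (X.2 : jet x) Y.1).

Definition bmap x (X : omni x) : Tfam x := (symbol X.1, jproj X.2).

Lemma gauge_id_smooth : dsmooth setT gauge_id.
Proof. by split=> [u|]; [exact: (gsect_smooth u)|exact: tsmooth0]. Qed.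

Lemma bsec_subproof (X : gsect omni) : @vsmooth _ _ _ Tfam setT (fun x => bmap (X x)).
Proof.
split; first exact: (gsect_smooth (anchor (gfst X))).
exact: (gsect_smooth (gsnd X) (@Gam _ _ _ DE _ gauge_id_smooth)).
Qed.

Definition bsec (X : gsect omni) : gsect Tfam := Gam (bsec_subproof X).

(* S^perp *)
Definition orth (S : forall x, set (omni x)) (x : M) : set (omni x) :=
  [set X | forall Y, S x Y -> omni_form X Y = 0].

Definition dirac (L : forall x, set (omni x)) : Prop :=
  [/\ is_subbundle L,
      L = orth L
    & forall X Y : gsect omni, gsect_in L X -> gsect_in L Y -> gsect_in L (omni_br X Y)].

Definition bimage (L : forall x, set (omni x)) (x : M) : set (Tfam x) :=
  @bmap x @` L x.

Definition reducible (L : forall x, set (omni x)) : Prop :=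
  is_subbundle (bimage L).

(* [br] stands for a bracket Gamma(A) x Gamma(A) -> Gamma(A): its values outside
   Gamma(A) are irrelevant.  The anchor is the projection [gfst] to TM. *)
Record proj_lie_algebroid (A : forall x, set (Tfam x))
    (br : gsect Tfam -> gsect Tfam -> gsect Tfam) : Prop := ProjLieAlgebroid {
  pla_subbundle : is_subbundle A;
  pla_closed : forall a b, gsect_in A a -> gsect_in A b -> gsect_in A (br a b);
  pla_linl : forall (k : R) a a' b,
    gsect_in A a -> gsect_in A a' -> gsect_in A b ->
    br (cinf_cst M k *: a + a') b = cinf_cst M k *: br a b + br a' b;
  pla_linr : forall (k : R) a b b',
    gsect_in A a -> gsect_in A b -> gsect_in A b' ->
    br a (cinf_cst M k *: b + b') = cinf_cst M k *: br a b + br a b';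
  pla_alt : forall a, gsect_in A a -> br a a = 0;
  pla_jacobi : forall a b c, gsect_in A a -> gsect_in A b -> gsect_in A c ->
    br a (br b c) + br b (br c a) + br c (br a b) = 0;
  pla_anchor : forall a b, gsect_in A a -> gsect_in A b ->
    gfst (br a b) = vbr (gfst a) (gfst b);
  pla_leibniz : forall a b f, gsect_in A a -> gsect_in A b ->
    br a (f *: b) = f *: br a b + vapp (gfst a) f *: b
}.

Definition b_preserves (L : forall x, set (omni x))
    (br : gsect Tfam -> gsect Tfam -> gsect Tfam) : Prop :=
  forall X Y : gsect omni, gsect_in L X -> gsect_in L Y ->
    bsec (omni_br X Y) = br (bsec X) (bsec Y).

End omni_lie.

(* Main.v *)
(* Write T = TM + E. Locally a connection identifies the omni-Lie algebroid with
   T + Hom(T, E), the pairing of (a, S) and (b, S') being S'(a) + S(b). For X and Y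
   in a Dirac structure L, the E-component of b{X, Y} is d v - e u + <mu, e>, where
   X = d + mu, Y = e + nu, u = p(mu), v = p(nu). If b(X) = 0 near a point this
   vanishes there by isotropy, so the bracket descends to b(L), and its Jacobi
   identity follows from ({X, Y}, Z) = 0.

   Conversely, given A, the same formula forces L to consist of the X = d + mu with
   b(X) = a in A and [a, b] = d v + <mu, e> - e u for all sections b of A and all e
   with the symbol of b. This condition is tensorial in a and b and reads
   S = (torsion of the connection) on A, where S is the Hom-component of X; so L is
   an extension of A by Hom(T/A, E), hence a subbundle of the right rank. It is
   isotropic because the bracket of A is skew and closed under the bracket by the
   Jacobi identity of A.

   Tangent vectors being derivations of the algebra of smooth functions, finite
   dimensionality of the tangent spaces rests on Hadamard's lemma, which is proved
   by differentiating under the integral sign, and on bump functions. *)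
From mathcomp Require Import all_boot all_order all_algebra.
From mathcomp Require Import all_classical all_reals.
From mathcomp Require Import topology normedtype landau derive realfun.
From mathcomp Require Import sequences exp measure lebesgue_measure.
From mathcomp Require Import lebesgue_integral ftc ring lra.
(* Defs comes last because measure also exports a [dirac]. *)
Require Import Defs.

Set Implicit Arguments.
Unset Strict Implicit.
Unset Printing Implicit Defensive.

Import Order.TTheory GRing.Theory Num.Theory.
Import numFieldNormedType.Exports.

Local Open Scope classical_set_scope.
Local Open Scope ring_scope.

(** * Functions of class C^k *)

Section class_C_theory.
Variables (R : realType) (n : nat).
Implicit Types (U W : set 'rV[R]_n) (f g : 'rV[R]_n -> R).

(** Brackets, gauge elements and tangent vectors act on global sections or functions, whereas frames
    exist only locally. Local objects are therefore cut off by bump functions to global ones that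
    keep the wanted property over an open set only, and one has to check each time that the
    operators see nothing but germs. The same obstacle shapes the bracket of b(L): a section a of
    b(L) lifts to L only near a given point, so [a, b] is computed point by point from local lifts;
    its independence of the lifts also gives its smoothness.

    As a jet is encoded by a functional on gauge elements, the existence of the Lie derivative has
    to be proved: a section of JE is locally a sum of terms h du, and L_d(h du) = alpha(d)(h) du + h
    d(d u), with d(d u) the first jet of d u, is again a section of JE.

    Fibres of E are abstract vector spaces, so identities in them are tested on scalar functionals
    before being left to [ring] or [lra]. *)

Lemma class_C_local U k f :
  (forall y, U y -> exists2 W, W y & class_C W k f) -> class_C U k f.
Proof.
elim: k f => [|k ih] f fl /=.
  by move=> y /fl[W Wy] /= cf; apply: (cf _ Wy).
split=> [y /fl[W Wy [df _]]|v]; first exact: df.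
by apply: ih => y /fl[W oW [_ Df]]; exists W => //; exact: Df.
Qed.

Lemma class_C_sum U k (I : Type) (s : seq I) (P : pred I) (F : I -> 'rV[R]_n -> R) :
  open U -> (forall i, P i -> class_C U k (F i)) ->
  class_C U k (fun y => \sum_(i <- s | P i) F i y).
Proof.
move=> oU FP; elim: s => [|i s ih].
  by apply: class_C_eq oU _ (class_C_cst U k 0) => y _; rewrite big_nil.
have [Pi|nPi] := boolP (P i); last first.
  by apply: class_C_eq oU _ ih => y _; rewrite big_cons (negPf nPi).
apply: class_C_eq oU _ (class_CD oU (FP _ Pi) ih) => y _.
by rewrite big_cons Pi.
Qed.

Lemma derivE_sum f (y v : 'rV[R]_n) : differentiable f y ->
  'D_v f y = \sum_i v 0 i * 'D_(delta_mx 0 i) f y.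
Proof.
move=> df; rewrite deriveE// [in LHS](row_sum_delta v) linear_sum.
by apply: eq_bigr => i _; rewrite linearZ deriveE.
Qed.

Lemma derive_coord i (y v : 'rV[R]_n) : 'D_v (fun z : 'rV[R]_n => z 0 i) y = v 0 i.
Proof.
have := @derive_mx _ _ _ _ id y v (@derivable_id _ _ y v); rewrite derive_id.
by move=> /matrixP/(_ 0 i); rewrite mxE.
Qed.

Lemma class_C_coord U k i : open U -> class_C U k (fun y : 'rV[R]_n => y 0 i).
Proof.
move=> oU; case: k => [|k] /=; first by move=> y _; exact: coord_continuous.
split=> [y _|v]; first exact: differentiable_coord.
apply: class_C_eq oU _ (class_C_cst U k (v 0 i)) => y _.
by rewrite derive_coord.
Qed.

Lemma class_C_inv U k f : open U -> (forall y, U y -> f y != 0) ->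
  class_C U k f -> class_C U k (fun y => (f y)^-1).
Proof.
move=> oU f0; elim: k => [|k ih] Cf.
  by move=> y Uy; apply: continuousV; [exact: f0|exact: Cf].
have [df Df] := Cf; split=> [y Uy|v].
  by apply: differentiableV; [exact: df|exact: f0].
have fi := ih (class_CW Cf).
have := class_CM oU (class_C_cst U k (-1)) (class_CM oU (class_CM oU fi fi) (Df v)).
apply: class_C_eq => // y Uy.
rewrite [RHS]deriveV; [|exact: f0|exact/diff_derivable/df].
by rewrite mulN1r expr2 invfM scaleNr.
Qed.

Lemma differentiable_row (m : nat) (phi : 'rV[R]_n -> 'rV[R]_m) y :
  (forall i, differentiable (fun z => phi z 0 i) y) -> differentiable phi y.
Proof.
move=> dphi.
have -> : phi = \sum_i (fun z => phi z 0 i *: (delta_mx 0 i : 'rV[R]_m)).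
  by apply/funext => z; rewrite fct_sumE -row_sum_delta.
by apply: differentiable_sum => i; exact: differentiableZl.
Qed.

End class_C_theory.

(** Induction on k through the chain rule: the derivative along v is the sum of the D_v phi_i times
    (D_i f) o phi, and the induction hypothesis applies to each D_i f. *)
Lemma class_C_comp (R : realType) (n m : nat) (U : set 'rV[R]_n) (V : set 'rV[R]_m)
    k (f : 'rV[R]_m -> R) (phi : 'rV[R]_n -> 'rV[R]_m) :
  open U -> open V -> (forall y, U y -> V (phi y)) ->
  (forall i, smooth_on U (fun y => phi y 0 i)) ->
  class_C V k f -> class_C U k (fun y => f (phi y)).
Proof.
move=> oU oV UV sphi.
have dphi y : U y -> differentiable phi y.
  by move=> Uy; apply: differentiable_row => i; exact: (sphi i 1%N).1.
elim: k f => [|k ih] f.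
  move=> cf y Uy; apply: (@continuous_comp _ _ _ phi f).
    exact/differentiable_continuous/dphi.
  exact/cf/UV.
move=> [df Df]; split=> [y Uy|v].
  by apply: (@differentiable_comp _ _ _ _ phi f); [exact: dphi|exact/df/UV].
have H : class_C U k (fun y => \sum_i 'D_v (fun z => phi z 0 i) y *
    'D_(delta_mx 0 i) f (phi y)).
  apply: class_C_sum => // i _; apply: class_CM => //.
    exact: ((sphi i k.+1).2 v).
  exact: ih (Df _).
apply: class_C_eq oU _ H => y Uy.
have dfy := df _ (UV _ Uy).
rewrite [RHS](@deriveE _ _ _ (f \o phi)); last first.
  by apply: differentiable_comp; [exact: dphi|].
rewrite diff_comp//; last exact: dphi.
rewrite [RHS]/comp /=; have <- := @deriveE _ _ _ f (phi y) ('d phi y v) dfy.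
have <- := @deriveE _ _ _ phi y v (dphi _ Uy).
rewrite [RHS]derivE_sum//; apply: eq_bigr => i _; congr (_ * _).
by rewrite derive_mx ?mxE//; apply: diff_derivable; exact: dphi.
Qed.

(** A quadratic remainder is o(h). This serves twice: for flat functions at 0 and, through
    [quadratic_derive], for integrals depending on a parameter. *)
Lemma quadratic_differentiable (R : realType) (V : normedModType R) (g : V -> R) y C :
  (forall h, `|h| <= 1 -> `|g (h + y) - g y| <= C * `|h| ^+ 2) ->
  differentiable g y /\ 'd g y = \0 :> (V -> R).
Proof.
move=> gC.
have c0 : continuous (\0 : V -> R) by exact: cst_continuous.
have ho : g \o shift y = cst (g y) + \0 +o_ 0 id.
  apply/eqaddoP => e e0.
  have C1 : 0 < `|C| + 1 by rewrite ltr_wpDl.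
  near=> z; rewrite !fctE /= addr0.
  have z1 : `|z| <= 1.
    near: z; apply: (@nbhs0_le _ V); exact: ltr01.
  (* C may be zero or negative, hence the denominator. *)
  have ze : `|z| <= e / (`|C| + 1).
    near: z; apply: (@nbhs0_le _ V); exact: divr_gt0.
  apply: (le_trans (gC _ z1)); rewrite expr2 mulrA ler_wpM2r//.
  have := ler_wpM2l (ltW C1) ze; rewrite mulrCA divff ?gt_eqF// mulr1.
  apply: le_trans; rewrite ler_wpM2r// (le_trans (ler_norm C))// lerDl//.
have dh : 'd g y = \0 :> (_ -> _) by apply: (@diff_unique _ _ _ g \0 y).
by split=> //; apply/diff_locallyP; rewrite dh; split.
Unshelve. all: by end_near. Qed.

Lemma quadratic_derive (R : realType) n (g : 'rV[R]_n -> R) y (c : 'I_n -> R) C :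
  (forall h, `|h| <= 1 ->
     `|g (h + y) - g y - \sum_i h 0 i * c i| <= C * `|h| ^+ 2) ->
  differentiable g y /\ forall v, 'D_v g y = \sum_i v 0 i * c i.
Proof.
move=> gC; pose l (z : 'rV[R]_n) : R := \sum_i c i * z 0 i.
have dl : differentiable l y.
  rewrite (_ : l = \sum_i (fun z : 'rV[R]_n => c i *: (z 0 i : R^o))); last first.
    by apply/funext => z; rewrite fct_sumE.
  by apply: differentiable_sum => i; apply: differentiableZ; exact: differentiable_coord.
have gE : g = (g - l) + l by rewrite subrK.
have [|dg d0] := @quadratic_differentiable R _ (g - l) y C.
  move=> h /gC; congr (`|_| <= _); rewrite !fctE /l.
  have -> : \sum_i c i * (h + y) 0 i = \sum_i h 0 i * c i + \sum_i c i * y 0 i.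
    by rewrite -big_split; apply: eq_bigr => i _; rewrite mxE mulrDr [c i * h _ _]mulrC.
  ring.
have Dg : differentiable g y by rewrite gE; exact: differentiableD.
split=> // v; rewrite deriveE//.
have -> : 'd g y = 'd (g - l) y \+ 'd l y :> ('rV[R]_n -> R).
  by rewrite {1}gE; exact: diffD.
rewrite /= d0 /= add0r.
rewrite -deriveE// derivE_sum//; apply: eq_bigr => i _; congr (_ * _).
rewrite (_ : l = \sum_j (fun z : 'rV[R]_n => c j *: (z 0 j : R^o))); last first.
  by apply/funext => z; rewrite fct_sumE.
rewrite derive_sum; last first.
  by move=> j; apply: derivableZ; apply: diff_derivable; exact: differentiable_coord.
rewrite (bigD1 i)//= big1 ?addr0 => [|j ji].
  rewrite deriveZ; last by apply: diff_derivable; exact: differentiable_coord.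
  by rewrite derive_coord mxE !eqxx /= [_ *: _]mulr1.
rewrite deriveZ; last by apply: diff_derivable; exact: differentiable_coord.
by rewrite derive_coord mxE (negPf ji) andbF [_ *: _]mulr0.
Qed.

(** * Flat functions of one variable and bump functions on R^n *)

Section smooth_real.
Variable R : realType.

(** The whole sequence of successive derivatives is the witness, so that the induction in
    [class_C_smooth1] can run over all of them at once. *)
Definition smooth1 (g : R -> R) := exists2 G : nat -> R -> R, G 0%N = g &
  forall (k : nat) (t : R), is_derive t 1 (G k) (G k.+1 t).

Lemma class_C_smooth1 n (U : set 'rV[R]_n) k (g : R -> R) (f : 'rV[R]_n -> R) :
  open U -> smooth1 g -> class_C U k f -> class_C U k (fun y => g (f y)).
Proof.
move=> oU [G <- dG]; suff H j : class_C U k f -> class_C U k (fun y => G j (f y)).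
  exact: H.
elim: k j => [|k ih] j Cf.
  move=> y Uy; apply: (@continuous_comp _ _ _ f (G j)); first exact: Cf.
  have [dd _] := dG j (f y).
  exact/differentiable_continuous/derivable1_diffP.
have dd t : differentiable (G j) t.
  by apply/derivable1_diffP; have [] := dG j t.
have [df Df] := Cf; split=> [y Uy|v].
  by apply: (@differentiable_comp _ _ _ _ f (G j)); [exact: df|exact: dd].
apply: class_C_eq oU _ (class_CM oU (ih j.+1 (class_CW Cf)) (Df v)) => y Uy.
rewrite [RHS](@deriveE _ _ _ (G j \o f)); last first.
  by apply: differentiable_comp; [exact: df|exact: dd].
rewrite diff_comp//; last exact: df.
rewrite [RHS]/comp/=; have <- := @deriveE _ _ _ f y v (df _ Uy).
rewrite -[in RHS](mulr1 ('D_v f y)) [RHS]linearZ /=.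
have <- := @deriveE _ _ _ (G j) (f y) 1 (dd _).
by have [_ ->] := dG j (f y); rewrite [RHS]mulrC.
Qed.

(** The polynomial factor makes this family closed under differentiation: for s = 1/t, the
    derivative of p(s) exp(-s) in t is s^2 (p - p')(s) exp(-s). *)
Definition flat (p : {poly R}) (t : R) : R :=
  if 0 < t then p.[t^-1] * expR (- t^-1) else 0.

(** With s = 1/t, the exponential series gives s^(i+2) <= (i+2)! exp(s). The two spare powers of s
    leave the factor t^2, which yields differentiability at 0. *)
Lemma flat_bound p : exists C, forall t, `|flat p t| <= C * `|t| ^+ 2.
Proof.
exists (\sum_(i < size p) `|p`_i| * (i.+2)`!%:R) => t.
rewrite /flat; case: ifPn => [t0|_]; last first.
  rewrite normr0 mulr_ge0 ?exprn_ge0//.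
  by apply: sumr_ge0 => i _; rewrite mulr_ge0.
set s := t^-1; have s0 : 0 < s by rewrite invr_gt0.
rewrite normrM horner_coef (gtr0_norm (expR_gt0 _)).
apply: (@le_trans _ _ ((\sum_(i < size p) `|p`_i| * s ^+ i) * expR (- s))).
  rewrite ler_wpM2r ?expR_ge0// (le_trans (ler_norm_sum _ _ _))//.
  by apply: ler_sum => i _; rewrite normrM normrX (gtr0_norm s0).
rewrite !mulr_suml; apply: ler_sum => i _; rewrite -!mulrA ler_wpM2l//.
have := @expR_ge1Dxn R s i.+1 (ltW s0) => H.
have {}H : s ^+ i.+2 / (i.+2)`!%:R <= expR s by apply: le_trans H; rewrite lerDr.
rewrite expRN ler_pdivrMr ?expR_gt0//.
have -> : `|t| = s^-1 by rewrite gtr0_norm// invrK.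
have f0 : 0 < (i.+2)`!%:R :> R by rewrite ltr0n fact_gt0.
rewrite ler_pdivrMr// in H.
have s2 : 0 < s ^+ 2 by rewrite exprn_gt0.
have -> : (i.+2)`!%:R * s^-1 ^+ 2 * expR s = expR s * (i.+2)`!%:R / s ^+ 2.
  by rewrite exprVn; ring.
by rewrite ler_pdivlMr// -exprD addn2.
Qed.

Lemma flat_derive (p : {poly R}) (t : R) :
  is_derive t 1 (flat p) (flat ('X^2 * (p - p^`())) t).
Proof.
have [t0|t0|->] := ltgtP t 0.
- rewrite {2}/flat ltNge (ltW t0)/=.
  apply: (near_eq_is_derive _ (is_derive_cst 0 t 1)).
  near=> z; rewrite /flat/= ifN// -leNgt ltW//.
  by near: z; exact: lt_nbhsl.
- have tn0 : t != 0 by rewrite gt_eqF.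
  have H : is_derive t 1 (fun z => p.[z^-1] * expR (- z^-1))
      (flat ('X^2 * (p - p^`())) t).
    pose F s : R := p.[s] * expR (- s).
    have dF : is_derive t^-1 1 F ((p^`() - p).[t^-1] * expR (- t^-1)).
      have dN : is_derive t^-1 1 (fun s : R => expR (- s)) (expR (- t^-1) * -1).
        exact: (@is_derive1_comp _ expR -%R).
      have dM : is_derive t^-1 1 F _ := is_deriveM (is_derive_poly p t^-1) dN.
      apply: (is_derive_eq dM); rewrite /= hornerD hornerN /GRing.scale/=; ring.
    have dV : is_derive t 1 (fun z : R => z^-1) (- t ^- 2).
      split; first by apply: (@derivableV _ _ id); [|exact: derivable_id].
      by rewrite (@deriveV _ _ id)//= ?derive_id ?/GRing.scale/= ?mulr1.
    apply: (is_derive_eq (is_derive1_comp dF dV)); rewrite /flat t0 !(hornerM, hornerX) !(hornerD, hornerN).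
    by rewrite -exprVn; ring.
  apply: near_eq_is_derive H.
  near=> z; rewrite /flat ifT//.
  by near: z; exact: lt_nbhsr.
- have [C HC] := flat_bound p.
  have f0 q : flat q 0 = 0 by rewrite /flat ltxx.
  have [|df d0] := @quadratic_differentiable R R^o (flat p) 0 C.
    by move=> h _; rewrite f0 subr0 addr0.
  rewrite f0; split; first exact/derivable1_diffP.
  by rewrite deriveE// d0.
Unshelve. all: by end_near. Qed.

Definition flat_step : R -> R := flat 1.

Lemma smooth1_flat : smooth1 flat_step.
Proof.
exists (fun k => flat (iter k (fun p => 'X^2 * (p - p^`())) 1)) => // k t.
exact: flat_derive.
Qed.

Lemma flat_step_gt0 t : 0 < t -> 0 < flat_step t.
Proof. by move=> t0; rewrite /flat_step /flat t0 hornerC mul1r expR_gt0. Qed.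

Lemma flat_step_eq0 t : t <= 0 -> flat_step t = 0.
Proof. by rewrite /flat_step /flat leNgt => /negPf ->. Qed.

Lemma flat_step_ge0 t : 0 <= flat_step t.
Proof.
have [t0|/flat_step_gt0/ltW//] := leP t 0.
by rewrite flat_step_eq0.
Qed.

Variable n : nat.
Implicit Types (U : set 'rV[R]_n) (f : 'rV[R]_n -> R).

Lemma class_C_prod U k (I : Type) (s : seq I) (P : pred I) (F : I -> 'rV[R]_n -> R) :
  open U -> (forall i, P i -> class_C U k (F i)) ->
  class_C U k (fun y => \prod_(i <- s | P i) F i y).
Proof.
move=> oU FP; elim: s => [|i s ih].
  by apply: class_C_eq oU _ (class_C_cst U k 1) => y _; rewrite big_nil.
have [Pi|nPi] := boolP (P i); last first.
  by apply: class_C_eq oU _ ih => y _; rewrite big_cons (negPf nPi).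
apply: class_C_eq oU _ (class_CM oU (FP _ Pi) ih) => y _.
by rewrite big_cons Pi.
Qed.

(* Equals 0 for t <= 0 and 1 for 1 <= t. *)
Let step t := flat_step t / (flat_step t + flat_step (1 - t)).

Let step_den t : 0 < flat_step t + flat_step (1 - t).
Proof.
have [t0|t0] := leP t 0.
  by rewrite ltr_wpDl ?flat_step_ge0// flat_step_gt0//; lra.
by rewrite ltr_wpDr ?flat_step_ge0// flat_step_gt0.
Qed.

Let class_C_step U k f : open U -> class_C U k f ->
  class_C U k (fun y => step (f y)).
Proof.
move=> oU Cf; have Cl : class_C U k (fun y => 1 - f y).
  apply: class_C_eq oU _ (class_CD oU (class_C_cst U k 1)
    (class_CM oU (class_C_cst U k (-1)) Cf)) => y _.
  by rewrite mulN1r.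
have C1 := class_C_smooth1 oU smooth1_flat Cf.
have C2 := class_C_smooth1 oU smooth1_flat Cl.
apply: (class_CM oU C1); apply: (class_C_inv oU) (class_CD oU C1 C2) => y _.
by rewrite gt_eqF.
Qed.

Lemma smooth_bump (p : 'rV[R]_n) (e : R) : 0 < e ->
  exists beta : 'rV[R]_n -> R, [/\ smooth_on setT beta,
    forall y : 'rV[R]_n, (forall i, `|y 0 i - p 0 i| <= e / 2) -> beta y = 1
    & forall y : 'rV[R]_n, (exists i, e <= `|y 0 i - p 0 i|) -> beta y = 0].
Proof.
(* The factor 2 / e makes both steps equal to 1 for |t| <= e / 2, while one of them is 0 as soon as
   |t| >= e. *)
move=> e0; pose b t := step ((e - t) * (2 / e)) * step ((e + t) * (2 / e)).
exists (fun y : 'rV[R]_n => \prod_i b (y 0 i - p 0 i)); split.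
- move=> k; apply: class_C_prod; first exact: openT.
  move=> i _; have oT : open [set: 'rV[R]_n] by exact: openT.
  have Cc := class_C_coord k i oT.
  have Caff a c d : class_C setT k (fun y : 'rV[R]_n => (a + c * (y 0 i - p 0 i)) * d).
    apply: class_CM => //; last exact: class_C_cst.
    apply: class_CD => //; first exact: class_C_cst.
    apply: class_CM => //; first exact: class_C_cst.
    by apply: class_CD => //; exact: class_C_cst.
  rewrite /b; apply: class_CM => //; apply: class_C_step => //.
    apply: class_C_eq oT _ (Caff e (-1) (2 / e)) => y _; ring.
  apply: class_C_eq oT _ (Caff e 1 (2 / e)) => y _; ring.
- move=> y yp; rewrite big1// => i _.
  have s1 t : 1 <= t -> step t = 1.
    move=> t1; rewrite /step (@flat_step_eq0 (1 - t)) ?addr0 ?subr_le0//.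
    by rewrite divff// gt_eqF// flat_step_gt0// (lt_le_trans ltr01).
  have := yp i; rewrite ler_norml => /andP[y1 y2].
  rewrite /b !s1 ?mulr1// mulrA ler_pdivlMr// mul1r; lra.
- move=> y [i yi]; rewrite (bigD1 i)//= /b.
  have s0 t : t <= 0 -> step t = 0.
    by move=> t0; rewrite /step flat_step_eq0 ?mul0r.
  have e2 : 0 < 2 / e by rewrite divr_gt0.
  move: yi; rewrite ler_normr => /orP[yi|yi].
    by rewrite (@s0 ((e - _) * _)) ?mul0r// pmulr_lle0// subr_le0.
  rewrite (@s0 ((e + (y 0 i - p 0 i)) * _)) ?mulr0 ?mul0r// pmulr_lle0//; lra.
Qed.

End smooth_real.

(** * Hadamard's lemma *)

Section unit_integral.
Variable R : realType.
Implicit Types phi psi : R -> R.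

Definition unit_int phi : R := \int[@lebesgue_measure R]_(t in `[0, 1]) phi t.

Let integ phi : continuous phi ->
  (@lebesgue_measure R).-integrable `[0, 1] (EFin \o phi).
Proof.
move=> cphi; apply: continuous_compact_integrable; first exact: segment_compact.
exact: continuous_subspaceT.
Qed.

Lemma continuous_lin (a : R) phi psi : continuous phi -> continuous psi ->
  continuous (fun t => a * phi t + psi t).
Proof.
move=> cphi cpsi t; apply: (@continuousD R R R (fun t => a * phi t) psi).
  by apply: (@continuousM R R (fun=> a) phi); [exact: cst_continuous|exact: cphi].
exact: cpsi.
Qed.

Lemma continuous_sum_lin n (c : 'I_n -> R) (phi : 'I_n -> R -> R) (s : seq 'I_n) :
  (forall i, continuous (phi i)) -> continuous (fun t => \sum_(i <- s) c i * phi i t).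
Proof.
move=> cphi; elim: s => [|i s ih].
  rewrite (_ : (fun t => _) = fun=> 0); first exact: cst_continuous.
  by apply/funext => t; rewrite big_nil.
rewrite (_ : (fun t => _) = fun t => c i * phi i t + \sum_(j <- s) c j * phi j t).
  exact: continuous_lin.
by apply/funext => t; rewrite big_cons.
Qed.

Lemma unit_int_lin (a : R) phi psi : continuous phi -> continuous psi ->
  unit_int (fun t => a * phi t + psi t) = a * unit_int phi + unit_int psi.
Proof.
move=> cphi cpsi; rewrite /unit_int RintegralD//=; last 2 first.
  apply: (@integ (fun t => a * phi t)) => t.
  by apply: (@continuousM R R (fun=> a) phi); [exact: cst_continuous|exact: cphi].
  exact: integ.
by rewrite RintegralZl//; exact: integ.
Qed.

Lemma unit_int_cst (c : R) : unit_int (fun=> c) = c.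
Proof.
rewrite /unit_int Rintegral_cst//= lebesgue_measure_itv/= lte_fin ltr01.
by rewrite -EFinB subr0 mulr1.
Qed.

Lemma unit_int_bound phi (c : R) : continuous phi ->
  (forall t, 0 <= t <= 1 -> `|phi t| <= c) -> `|unit_int phi| <= c.
Proof.
move=> cphi phic; rewrite ler_norml; apply/andP; split.
  rewrite -(unit_int_cst (- c)); apply: le_Rintegral => //.
  - by apply: (@integ (fun=> - c)); exact: cst_continuous.
  - exact: integ.
  - move=> t /=; rewrite in_itv/= => /phic.
    by rewrite ler_norml => /andP[].
rewrite -(unit_int_cst c); apply: le_Rintegral => //.
- exact: integ.
- by apply: (@integ (fun=> c)); exact: cst_continuous.
- move=> t /=; rewrite in_itv/= => /phic.
  by rewrite ler_norml => /andP[].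
Qed.

Lemma unit_int_derive phi (dphi : R -> R) : continuous dphi ->
  (forall t : R, is_derive t 1 phi (dphi t)) -> unit_int dphi = phi 1 - phi 0.
Proof.
move=> cd dphiE; rewrite /unit_int /Rintegral.
have cphi : continuous phi.
  move=> t; apply/differentiable_continuous/derivable1_diffP.
  by have [] := dphiE t.
rewrite (@continuous_FTC2 _ dphi phi) ?ltr01//.
- exact: continuous_subspaceT.
- split; first by move=> t _; have [] := dphiE t.
    exact/cvg_at_right_filter/cphi.
  exact/cvg_at_left_filter/cphi.
- by move=> t _; rewrite derive1E; have [_] := dphiE t.
Qed.

End unit_integral.

Section hadamard.
Variables (R : realType) (n : nat).
Implicit Types (F : 'rV[R]_n -> R) (p y z h v : 'rV[R]_n).

Lemma is_derive_line F p v (t : R) : (forall y, differentiable F y) ->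
  is_derive t 1 (fun s : R => F (p + s *: v)) ('D_v F (p + t *: v)).
Proof.
move=> dF.
have E : (fun h : R => h^-1 *: (((fun s : R => F (p + s *: v)) \o shift t) (h *: (1 : R)) -
     F (p + t *: v))) = (fun h : R => h^-1 *: ((F \o shift (p + t *: v)) (h *: v) - F (p + t *: v))).
  apply/funext => h /=; congr (_ *: (F _ - _)).
  by rewrite [h%:A]mulr1 scalerDl addrCA.
have H : derivable F (p + t *: v) v by exact/diff_derivable/dF.
by split; rewrite /derivable /derive ?E.
Qed.

Lemma smooth_derive F v : smooth_on setT F -> smooth_on setT ('D_v F).
Proof. by move=> sF k; exact: ((sF k.+1).2 v). Qed.

Lemma smooth_differentiable F y : smooth_on setT F -> differentiable F y.
Proof. by move=> sF; exact: ((sF 1%N).1 y I). Qed.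

Lemma smooth_continuous F : smooth_on setT F -> continuous F.
Proof. by move=> sF y; exact: (sF 0%N y I). Qed.

Lemma continuous_bounded_ball F (r : R) : 0 <= r -> continuous F ->
  exists C, forall y, `|y| <= r -> `|F y| <= C.
Proof.
move=> r0 cF; set A := [set y : 'rV[R]_n | `|y| <= r].
have cA : compact A.
  apply: bounded_closed_compact.
    exists r; split; first by rewrite num_real.
    by move=> M rM y /= /le_trans; apply; exact: ltW.
  have := @preimage_closed _ _ (fun y : 'rV[R]_n => `|y|) [set x : R | x <= r].
  apply => [y _|]; [exact: norm_continuous|exact: closed_le].
have A0 : A !=set0 by exists 0; rewrite /A /= normr0.
have [|c _ cmax] := @compact_EVT_max _ R (fun y => `|F y|) A A0 cA.
  apply: continuous_subspaceT => y.
  by apply: (@continuous_comp _ _ _ F (fun x => `|x|)); [exact: cF|exact: norm_continuous].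
by exists `|F c| => y yr; apply: cmax; rewrite inE.
Qed.

Lemma norm_coord (h : 'rV[R]_n) i : `|h 0 i| <= `|h|.
Proof. by rewrite [leRHS]/Num.Def.normr/= mx_normrE; exact: (le_bigmax _ _ (0, i)). Qed.

(** The mean value theorem is used twice on the segment from z to z + h, which stays in the compact
    ball of radius r + 1, where second derivatives are bounded. Uniformity in z allows the estimate
    to be integrated along a segment. *)
Lemma taylor_bound F (r : R) : smooth_on setT F -> 0 <= r ->
  exists C, forall z h, `|z| <= r -> `|h| <= 1 ->
    `|F (z + h) - F z - 'D_h F z| <= C * `|h| ^+ 2.
Proof.
move=> sF r0.
pose d i j := 'D_(delta_mx 0 j) ('D_(delta_mx 0 i) F).
have sdi i : smooth_on setT ('D_(delta_mx 0 i) F) by exact: smooth_derive.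
have sd i j : smooth_on setT (d i j) by exact: smooth_derive.
have r1 : 0 <= r + 1 by rewrite addr_ge0.
pose C i j := sval (cid (continuous_bounded_ball r1 (smooth_continuous (sd i j)))).
have HC i j z : `|z| <= r + 1 -> `|d i j z| <= C i j.
  exact: (svalP (cid (continuous_bounded_ball r1 (smooth_continuous (sd i j))))).
exists (\sum_i \sum_j C i j) => z h zr h1.
have dF y : differentiable F y by exact: smooth_differentiable.
have cl (G : 'rV[R]_n -> R) : smooth_on setT G ->
    {within `[0, 1], continuous (fun s : R => G (z + s *: h))}.
  move=> sG; apply: continuous_subspaceT => s.
  apply/differentiable_continuous/derivable1_diffP.
  by have [] := is_derive_line z h s (fun y => smooth_differentiable y sG).
have [|s sI] := @MVT_segment R (fun s => F (z + s *: h))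
    (fun s => 'D_h F (z + s *: h)) 0 1 ler01 _ (cl _ sF).
  by move=> s _; exact: is_derive_line.
rewrite subr0 mulr1 scale1r scale0r addr0 => ->.
move: sI; rewrite in_itv/= => /andP[s0 s1].
have sDh : smooth_on setT ('D_h F) by exact: smooth_derive.
have [||s' s'I] := @MVT_segment R (fun s => 'D_h F (z + s *: h))
    (fun s => 'D_h ('D_h F) (z + s *: h)) 0 s s0.
- by move=> x _; apply: is_derive_line => y; exact: smooth_differentiable.
- apply: continuous_subspaceT => x.
  apply/differentiable_continuous/derivable1_diffP.
  by have [] := is_derive_line z h x (fun y => smooth_differentiable y sDh).
rewrite subr0 scale0r addr0 => ->.
move: s'I; rewrite in_itv/= => /andP[s'0 s'1].
have D2 y : 'D_h ('D_h F) y = \sum_i \sum_j h 0 i * (h 0 j * d i j y).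
  have -> : 'D_h F = \sum_i (fun y => h 0 i *: ('D_(delta_mx 0 i) F y : R^o)).
    by apply/funext => x; rewrite fct_sumE derivE_sum.
  rewrite derive_sum; last first.
    by move=> i; apply/derivableZ/diff_derivable/smooth_differentiable.
  apply: eq_bigr => i _; rewrite deriveZ; last first.
    exact/diff_derivable/smooth_differentiable.
  by rewrite derivE_sum ?scaler_sumr//; exact: smooth_differentiable.
have zb : `|z + s' *: h| <= r + 1.
  apply: (le_trans (ler_normD _ _)); apply: lerD => //.
  rewrite normrZ ger0_norm// -[leRHS]mulr1; apply: ler_pM => //.
  exact: le_trans s1.
rewrite D2 normrM -[leRHS]mulr1; apply: ler_pM => //; last by rewrite ger0_norm.
apply: (le_trans (ler_norm_sum _ _ _)); rewrite mulr_suml.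
apply: ler_sum => i _; apply: (le_trans (ler_norm_sum _ _ _)); rewrite mulr_suml.
apply: ler_sum => j _; rewrite mulrA normrM mulrC; apply: ler_pM => //; first exact: HC.
by rewrite normrM expr2; apply: ler_pM => //; exact: norm_coord.
Qed.

Variable p : 'rV[R]_n.

(** Differentiation in y brings out one factor t; the power t^j closes the family, D_v (G j F) being
    the sum of the v_i G j.+1 (D_i F). *)
Let G j F y := unit_int (fun t => t ^+ j * F (p + t *: (y - p))).

Let cG j F y : smooth_on setT F -> continuous (fun t : R => t ^+ j * F (p + t *: (y - p))).
Proof.
move=> sF t.
apply: (@continuousM R R (fun s : R => s ^+ j) (fun s : R => F (p + s *: (y - p)))).
  exact: exprn_continuous.
apply/differentiable_continuous/derivable1_diffP.
by have [] := is_derive_line p (y - p) t (fun y => smooth_differentiable y sF).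
Qed.

Let unit_int_sum (c : 'I_n -> R) (phi : 'I_n -> R -> R) : (forall i, continuous (phi i)) ->
  unit_int (fun t => \sum_i c i * phi i t) = \sum_i c i * unit_int (phi i).
Proof.
move=> cphi.
elim: (index_enum _) => [|i s ih].
  rewrite big_nil -[RHS](unit_int_cst 0); congr unit_int.
  by apply/funext => t; rewrite big_nil.
rewrite big_cons -ih -unit_int_lin//; last exact: continuous_sum_lin.
by congr unit_int; apply/funext => t; rewrite big_cons.
Qed.

Let dG j F y : smooth_on setT F -> differentiable (G j F) y /\
  forall v, 'D_v (G j F) y = \sum_i v 0 i * G j.+1 ('D_(delta_mx 0 i) F) y.
Proof.
move=> sF.
(* This radius bounds all the points p + t (y - p) with t in [0, 1]. *)
have [|C HC] := @taylor_bound F (`|p| + `|y - p|) sF; first by rewrite addr_ge0.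
apply: (@quadratic_derive R n (G j F) y
  (fun i => G j.+1 ('D_(delta_mx 0 i) F) y) `|C|) => h h1.
rewrite -[X in _ - X](@unit_int_sum _ (fun i t => t ^+ j.+1 *
  'D_(delta_mx 0 i) F (p + t *: (y - p)))); last first.
  by move=> i; exact: (@cG j.+1 _ y (smooth_derive _ sF)).
have cS : continuous (fun t : R => \sum_i h 0 i * (t ^+ j.+1 *
    'D_(delta_mx 0 i) F (p + t *: (y - p)))).
  apply: continuous_sum_lin => i; exact: (@cG j.+1 _ y (smooth_derive _ sF)).
(* The shape that [unit_int_lin] expects: the three integrals merge into one, whose integrand is t^j
   times a Taylor remainder. *)
have -> : forall a b c : R, a - b - c = -1 * c + (-1 * b + a) by move=> *; ring.
rewrite /G -unit_int_lin//; [|exact: cG|exact: cG].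
have cD : continuous (fun t : R => -1 * (t ^+ j * F (p + t *: (y - p))) +
    t ^+ j * F (p + t *: (h + y - p))).
  by apply: continuous_lin; exact: cG.
rewrite -unit_int_lin//; apply: unit_int_bound.
  exact: continuous_lin.
move=> t /andP[t0 t1]; set z := p + t *: (y - p).
have -> : p + t *: (h + y - p) = z + t *: h.
  by rewrite /z -[RHS]addrA -scalerDr [y - p + h]addrC addrA.
have -> : \sum_i h 0 i * (t ^+ j.+1 * 'D_(delta_mx 0 i) F z) = t ^+ j * 'D_(t *: h) F z.
  rewrite derivE_sum; last exact: smooth_differentiable.
  rewrite mulr_sumr; apply: eq_bigr => i _; rewrite mxE exprSr; ring.
have -> : -1 * (t ^+ j * 'D_(t *: h) F z) + (-1 * (t ^+ j * F z) + t ^+ j * F (z + t *: h)) =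
    t ^+ j * (F (z + t *: h) - F z - 'D_(t *: h) F z) by ring.
have th : `|t *: h| <= `|h|.
  by rewrite normrZ ger0_norm// ler_piMl.
rewrite normrM -[leRHS]mul1r; apply: ler_pM => //.
  by rewrite ger0_norm ?exprn_ge0// exprn_ile1.
have zr : `|z| <= `|p| + `|y - p|.
  apply: (le_trans (ler_normD _ _)); rewrite lerD2l normrZ ger0_norm//.
  by rewrite ler_piMl.
apply: (le_trans (HC _ _ zr (le_trans th h1))).
apply: (@le_trans _ _ (`|C| * `|t *: h| ^+ 2)).
  by rewrite ler_wpM2r ?exprn_ge0// ler_norm.
by rewrite ler_wpM2l// lerXn2r ?nnegrE.
Qed.

Let sG j F : smooth_on setT F -> smooth_on setT (G j F).
Proof.
move=> sF k; elim: k j F sF => [|k ih] j F sF.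
  by move=> y _; apply/differentiable_continuous; have [] := dG j y sF.
split=> [y _|v]; first by have [] := dG j y sF.
have oT : open [set: 'rV[R]_n] by exact: openT.
have H : class_C setT k (fun y => \sum_i v 0 i * G j.+1 ('D_(delta_mx 0 i) F) y).
  apply: class_C_sum => // i _; apply: class_CM => //; first exact: class_C_cst.
  by apply: ih; exact: smooth_derive.
by apply: class_C_eq oT _ H => y _; have [_ ->] := dG j y sF.
Qed.

(** F y - F p is the integral of the derivative of F along the segment from p to y; the coefficient
    of y_i - p_i there is the integral of D_i F. *)
Lemma hadamard F : smooth_on setT F ->
  exists2 g : 'I_n -> 'rV[R]_n -> R, forall i, smooth_on setT (g i) &
    (forall y, F y = F p + \sum_i (y 0 i - p 0 i) * g i y) /\
    (forall i, g i p = 'D_(delta_mx 0 i) F p).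
Proof.
move=> sF; exists (fun i => G 0 ('D_(delta_mx 0 i) F)).
  by move=> i; apply: sG; exact: smooth_derive.
split=> [y|i]; last first.
  rewrite /G subrr.
  under [X in unit_int X]eq_fun do rewrite scaler0 addr0 expr0 mul1r.
  exact: unit_int_cst.
rewrite -unit_int_sum; last by move=> i; exact: (@cG 0%N _ y (smooth_derive _ sF)).
set S := (X in unit_int X).
have cS : continuous S.
  by apply: continuous_sum_lin => i; exact: (@cG 0%N _ y (smooth_derive _ sF)).
have dS (t : R) : is_derive t 1 (fun s : R => F (p + s *: (y - p))) (S t).
  have dF z : differentiable F z by exact: smooth_differentiable.
  apply: (is_derive_eq (is_derive_line _ _ _ dF)).
  by rewrite derivE_sum//; apply: eq_bigr => i _; rewrite !mxE expr0 mul1r.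
rewrite (unit_int_derive cS dS) scale1r scale0r addr0.
by rewrite [p + (y - p)]addrC subrK addrC subrK.
Qed.

End hadamard.

(** * Manifolds and tangent vectors *)

Section smooth_on_manifold.
Variables (R : realType) (n : nat) (M : manifold R n).
Implicit Types (W U V : set M) (f g : M -> R).

Lemma msmooth_local W f :
  (forall x, W x -> exists W' g,
     [/\ open W', W' x, msmooth W' g & forall y, W' y -> g y = f y]) ->
  msmooth W f.
Proof.
move=> loc c ac k; apply: class_C_local => y [cy Wy].
have [W' [g [oW' W'x sg gf]]] := loc _ Wy.
exists (ccod c `&` cinv c @^-1` W'); first by split.
apply: (@class_C_eq _ _ _ k (g \o cinv c) (f \o cinv c) (chart_preimage_open oW')).
  by move=> z [_ zW'] /=; exact: gf.
exact: sg.
Qed.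

Lemma msmooth_eq W f g : open W -> (forall x, W x -> f x = g x) ->
  msmooth W f -> msmooth W g.
Proof. by move=> oW fg sf; apply: msmooth_local => x Wx; exists W, f. Qed.

Lemma msmooth_inv W f : open W -> (forall x, W x -> f x != 0) ->
  msmooth W f -> msmooth W (fun x => (f x)^-1).
Proof.
move=> oW f0 sf c ac k; apply: (@class_C_inv _ _ _ k (f \o cinv c)).
- exact: chart_preimage_open.
- by move=> y [_ ?]; exact: f0.
- exact: sf.
Qed.

Lemma msmooth_sum W (I : Type) (s : seq I) (P : pred I) (F : I -> M -> R) :
  open W -> (forall i, P i -> msmooth W (F i)) ->
  msmooth W (fun x => \sum_(i <- s | P i) F i x).
Proof.
move=> oW FP; elim: s => [|i s ih].
  by apply: msmooth_eq oW _ (@msmooth_cst _ _ M W 0) => x _; rewrite big_nil.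
have [Pi|nPi] := boolP (P i); last first.
  by apply: msmooth_eq oW _ ih => x _; rewrite big_cons (negPf nPi).
apply: msmooth_eq oW _ (msmoothD oW (FP _ Pi) ih) => x _.
by rewrite big_cons Pi.
Qed.

Lemma msmooth_prod W (I : Type) (s : seq I) (P : pred I) (F : I -> M -> R) :
  open W -> (forall i, P i -> msmooth W (F i)) ->
  msmooth W (fun x => \prod_(i <- s | P i) F i x).
Proof.
move=> oW FP; elim: s => [|i s ih].
  by apply: msmooth_eq oW _ (@msmooth_cst _ _ M W 1) => x _; rewrite big_nil.
have [Pi|nPi] := boolP (P i); last first.
  by apply: msmooth_eq oW _ ih => x _; rewrite big_cons (negPf nPi).
apply: msmooth_eq oW _ (msmoothM oW (FP _ Pi) ih) => x _.
by rewrite big_cons Pi.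
Qed.

Lemma cinf_msmooth (f : cinf M) W : msmooth W f.
Proof.
have /msmooth_predP := cinf_smooth f; exact: msmooth_sub.
Qed.

(** One chart decides: any other differs from it by a smooth transition map, to which [class_C_comp]
    applies. *)
Lemma msmooth_chart (c : chart R n M) W f : atlas c -> open W -> W `<=` cdom c ->
  smooth_on (ccod c `&` cinv c @^-1` W) (f \o cinv c) -> msmooth W f.
Proof.
move=> ac oW Wc sf c' ac' k.
set U := ccod c' `&` cinv c' @^-1` W; set V := ccod c `&` cinv c @^-1` W.
have oU : open U by exact: chart_preimage_open.
have oV : open V by exact: chart_preimage_open.
have UV y : U y -> V (cmap c (cinv c' y)).
  move=> [cy Wy]; split; first exact/cmap_cod/Wc.
  by rewrite /preimage/= cmapK//; exact: Wc.
have sphi i : smooth_on U (fun y => cmap c (cinv c' y) 0 i).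
  move=> j; apply: class_C_sub (atlas_compatible ac' ac i j) => y [? Wy]; split=> //.
  exact: Wc.
apply: class_C_eq oU _ (class_C_comp oU oV UV sphi (sf k)) => y [_ Wy] /=.
by rewrite cmapK//; exact: Wc.
Qed.

Lemma msmooth_coord (c : chart R n M) i : atlas c ->
  msmooth (cdom c) (fun x => cmap c x 0 i).
Proof. by move=> ac c' ac' k; exact: atlas_compatible. Qed.

Lemma msmooth_glue0 W K f : open W -> closed K -> K `<=` W -> msmooth W f ->
  (forall y, ~ K y -> f y = 0) -> msmooth setT f.
Proof.
move=> oW cK KW sf f0; apply: msmooth_local => x _.
have [Kx|nKx] := pselect (K x); first by exists W, f; split => //; exact: KW.
exists (~` K), (fun=> 0); split => //; first by rewrite openC.
  exact: msmooth_cst.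
by move=> y /f0.
Qed.

Lemma ball_coord (p y : 'rV[R]_n) (e : R) : 0 < e ->
  (forall i, `|y 0 i - p 0 i| < e) -> ball p e y.
Proof.
move=> e0 yp; rewrite -ball_normE/= /Num.Def.normr/= mx_normrE.
apply: bigmax_lt => // -[i j] _ /=; rewrite ord1 !mxE distrC; exact: yp.
Qed.

Lemma box_compact (p : 'rV[R]_n) (e : R) :
  compact [set y : 'rV[R]_n | forall i, `|y 0 i - p 0 i| <= e].
Proof.
have -> : [set y : 'rV[R]_n | forall i, `|y 0 i - p 0 i| <= e] =
    [set y : 'rV[R]_n | forall i, y 0 i \in `[p 0 i - e, p 0 i + e]].
  apply/seteqP; split=> y /= h i; have := h i.
    by rewrite in_itv/= ler_distl.
  by rewrite in_itv/= ler_distl.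
have := @rV_compact R n (fun i => `[p 0 i - e, p 0 i + e]%classic).
by apply => i; exact: segment_compact.
Qed.

(** The closed set K, which contains the support, is what allows products of beta with objects over
    W to be extended by zero to M. *)
Lemma bump (x : M) W : open W -> W x ->
  exists (beta : cinf M) (V K : set M),
    [/\ open V, V x, V `<=` W & forall y, V y -> beta y = 1] /\
    [/\ closed K, K `<=` W & forall y, ~ K y -> beta y = 0].
Proof.
move=> oW Wx; have [c ac cx] := atlas_cover x.
set p := cmap c x.
have oU := @chart_preimage_open _ _ M c _ (openI oW (cdom_open c)).
set U := ccod c `&` _ in oU.
have Up : U p.
  by split; [exact: cmap_cod|rewrite /preimage/= cmapK].
have /nbhs_ballP[e /= e0 eU] : nbhs p U by exact: open_nbhs_nbhs.
have e2 : 0 < e / 2 by rewrite divr_gt0.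
have [beta [sb b1 b0]] := smooth_bump p e2.
set K0 := [set y : 'rV[R]_n | forall i, `|y 0 i - p 0 i| <= e / 2].
have K0U : K0 `<=` U.
  move=> y Ky; apply: eU; apply: ball_coord => // i.
  apply: le_lt_trans (Ky i) _; rewrite ltr_pdivrMr// ltr_pMr// ltr1n//.
set K := cinv c @` K0.
(* The image of a compact box is compact, hence closed because M is Hausdorff. *)
have cK : closed K.
  apply: (compact_closed (@mspace_hausdorff _ _ M)).
  apply: continuous_compact; last exact: box_compact.
  apply: continuous_in_subspaceT => y; rewrite inE => /K0U[cy _].
  exact: cinv_continuous.
have KW : K `<=` W `&` cdom c by move=> _ [y /K0U[_ ?] <-].
pose b y : R := if `[< K y >] then beta (cmap c y) else 0.
have bc y : cdom c y -> b y = beta (cmap c y).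
  move=> cy; rewrite /b; case: asboolP => // nK.
  rewrite b0//; apply: contrapT => h; apply: nK.
  exists (cmap c y); last by rewrite cmapK.
  move=> i; rewrite leNgt; apply/negP => hi; apply: h; exists i.
  exact: ltW.
have b0' y : ~ K y -> b y = 0 by move=> nK; rewrite /b; case: asboolP.
have sbM : msmooth setT b.
  apply: (msmooth_glue0 (cdom_open c) cK _ _ b0'); first by move=> y /KW[].
  apply: (msmooth_chart ac) => //; first exact: cdom_open.
  move=> k; have sbk := class_C_sub (@subsetT _ (ccod c `&` cinv c @^-1` cdom c)) (sb k).
  apply: (@class_C_eq _ _ _ k beta (b \o cinv c) (chart_preimage_open (cdom_open c))) => //.
  by move=> y [cy dy] /=; rewrite bc// cinvK.
have bP : b \in @msmooth_pred _ _ M by exact/msmooth_predP.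
(* The bump was taken with parameter e / 2, so it is 1 within e / 4 of p. *)
pose B := ball p (e / 4).
have oB : open B by exact: ball_open.
have e4 : 0 < e / 4 by rewrite divr_gt0.
pose V := [set y | W y /\ (cdom c y /\ B (cmap c y))].
have oV : open V.
  rewrite openE => y [Wy [cy By]]; apply: filterI; first exact: open_nbhs_nbhs.
  apply: filterI; first by apply: open_nbhs_nbhs; split => //; exact: cdom_open.
  by apply: (cmap_continuous cy); exact: open_nbhs_nbhs.
exists (Cinf bP), V, K; split.
- split => //; first by split => //; split => //; exact: ballxx.
    by move=> y [].
  move=> y [_ [cy By]] /=; rewrite bc// b1// => i.
  move: By; rewrite /B -ball_normE/= => By.
  have := norm_coord (p - cmap c y) i; rewrite !mxE distrC => /le_trans; apply.
  apply: ltW; apply: lt_le_trans By _.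
  by rewrite -mulrA -invfM -natrM.
- by split => // y /KW[].
Qed.

Lemma msmooth_cutoff (beta : cinf M) W K f : open W -> closed K -> K `<=` W ->
  (forall y, ~ K y -> beta y = 0) -> msmooth W f ->
  msmooth setT (fun x => beta x * f x).
Proof.
move=> oW cK KW b0 sf; apply: (msmooth_glue0 oW cK KW).
  apply: msmoothM => //; exact: cinf_msmooth.
by move=> y /b0 ->; rewrite mul0r.
Qed.

Lemma msmooth_extend x W f : open W -> W x -> msmooth W f ->
  exists (g : cinf M) V, [/\ open V, V x, V `<=` W & forall y, V y -> g y = f y].
Proof.
move=> oW Wx sf; have [beta [V [K [[oV Vx VW b1] [cK KW b0]]]]] := bump oW Wx.
have sbf := msmooth_cutoff oW cK KW b0 sf.
have sP : (fun x => beta x * f x) \in @msmooth_pred _ _ M by exact/msmooth_predP.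
by exists (Cinf sP), V; split => // y /b1 /= ->; rewrite mul1r.
Qed.

End smooth_on_manifold.

(** * Locality of smooth sections *)

Section locality.
Variables (R : realType) (n : nat) (M : manifold R n).
Implicit Types (W U V : set M).

(** The sheaf property, restriction and gluing together, which the axioms of [vfamily] do not
    contain. It is proved for each family at hand. *)
Definition vlocal (V : vfamily M) := forall W (s : forall x, V x),
  (forall x, W x -> exists W' (t : forall x, V x),
     [/\ open W', W' x, vsmooth W' t & forall y, W' y -> t y = s y]) ->
  vsmooth W s.

Lemma vlocal_sub (V : vfamily M) W W' (s : forall x, V x) : vlocal V ->
  open W -> W' `<=` W -> vsmooth W s -> vsmooth W' s.
Proof. by move=> lV oW W'W ss; apply: lV => x /W'W Wx; exists W, s. Qed.

Lemma vlocal_eq (V : vfamily M) W (s t : forall x, V x) : vlocal V ->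
  open W -> (forall x, W x -> s x = t x) -> vsmooth W s -> vsmooth W t.
Proof. by move=> lV oW st ss; apply: lV => x Wx; exists W, s. Qed.

Lemma vlocal_sect (V : vfamily M) (s : gsect V) W : vlocal V -> vsmooth W s.
Proof.
move=> lV; apply: (vlocal_sub lV openT (@subsetT _ W)); exact: gsect_smooth.
Qed.

Lemma vlocal_sum (V : vfamily M) W (I : Type) (r : seq I) (P : pred I)
    (c : I -> M -> R) (s : I -> forall x, V x) : vlocal V -> open W ->
  (forall i, P i -> msmooth W (c i) /\ vsmooth W (s i)) ->
  vsmooth W (fun x => \sum_(i <- r | P i) c i x *: s i x).
Proof.
move=> lV oW cs; elim: r => [|i r ih].
  by apply: vlocal_eq lV oW _ (vsmooth0 V W) => x _; rewrite big_nil.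
have [Pi|nPi] := boolP (P i); last first.
  by apply: vlocal_eq lV oW _ ih => x _; rewrite big_cons (negPf nPi).
have [sc ss] := cs _ Pi.
apply: vlocal_eq lV oW _ (vsmooth_lin oW sc ss ih) => x _.
by rewrite big_cons Pi.
Qed.

Lemma vlocal_cutoff (V : vfamily M) (beta : cinf M) W K (s : forall x, V x) :
  vlocal V -> open W -> closed K -> K `<=` W ->
  (forall y, ~ K y -> beta y = 0) -> vsmooth W s ->
  vsmooth setT (fun x => beta x *: s x).
Proof.
move=> lV oW cK KW b0 ss; apply: lV => x _.
have [Kx|nKx] := pselect (K x).
  exists W, (fun x => beta x *: s x + 0); split; [by []|exact: KW| |].
    by apply: vsmooth_lin => //; [exact: cinf_msmooth|exact: vsmooth0].
  by move=> y _; rewrite addr0.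
exists (~` K), (fun=> 0); split; [by rewrite openC|by []|exact: vsmooth0|].
by move=> y /b0 ->; rewrite scale0r.
Qed.

Lemma vlocal_bundle r (E : vbundle M r) : vlocal E.
Proof.
move=> W s loc j k; apply: msmooth_local => x [jx Wx].
have [W' [t [oW' W'x st ts]]] := loc _ Wx.
exists (btriv_dom j `&` W'), (fun x => btriv j x (t x) 0 k); split => //.
- by apply: openI => //; exact: btriv_open.
- by move=> y [_ /ts ->].
Qed.

Lemma vlocal_TM : vlocal (TM M).
Proof.
move=> W X loc f; apply: msmooth_local => x Wx.
have [W' [Y [oW' W'x sY YX]]] := loc _ Wx.
by exists W', (fun x => Y x f); split => // y /YX ->.
Qed.

Lemma vlocal_sum2 (V V' : vfamily M) : vlocal V -> vlocal V' -> vlocal (vsum V V').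
Proof.
move=> lV lV' W s loc; split; [apply: lV|apply: lV'] => x Wx;
  have [W' [t [oW' W'x [st1 st2] ts]]] := loc _ Wx.
- by exists W', (fun x => (t x).1); split => // y /ts ->.
- by exists W', (fun x => (t x).2); split => // y /ts ->.
Qed.

Variables (r : nat) (E : vbundle M r).

Lemma vlocal_DE : vlocal (DE E).
Proof.
move=> W d loc; split=> [u|].
  apply: (@vlocal_bundle r E) => x Wx.
  have [W' [e [oW' W'x [se _] ed]]] := loc _ Wx.
  by exists W', (fun x => gauge_op (e x) u); split => // y /ed ->.
apply: vlocal_TM => x Wx.
have [W' [e [oW' W'x [_ se] ed]]] := loc _ Wx.
by exists W', (fun x => symbol (e x)); split => // y /ed ->.
Qed.

Lemma vlocal_JE : vlocal (JE E).
Proof.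
move=> W mu loc d; apply: (@vlocal_bundle r E) => x Wx.
have [W' [nu [oW' W'x snu numu]]] := loc _ Wx.
by exists W', (fun x => nu x (d x)); split => // y /numu ->.
Qed.

Lemma vlocal_omni : vlocal (omni E).
Proof. exact: vlocal_sum2 vlocal_DE vlocal_JE. Qed.

Lemma vlocal_Tfam : vlocal (Tfam E).
Proof. exact: vlocal_sum2 vlocal_TM (@vlocal_bundle r E). Qed.

End locality.

(** * Tangent vectors in coordinates *)

Section tangent_theory.
Variables (R : realType) (n : nat) (M : manifold R n).
Implicit Types (f g : cinf M) (x : M).

Lemma cinf_addE f g x : (f + g) x = f x + g x. Proof. by []. Qed.
Lemma cinf_mulE f g x : (f * g) x = f x * g x. Proof. by []. Qed.
Lemma cinf_oppE f x : (- f) x = - f x. Proof. by []. Qed.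
Lemma cinf_1E x : (1 : cinf M) x = 1. Proof. by []. Qed.
Lemma cinf_cstE (a : R) x : cinf_cst M a x = a. Proof. by []. Qed.
Lemma cinf_ext f g : (forall x, f x = g x) -> f = g.
Proof. by move=> fg; apply/val_inj/funext. Qed.
Lemma cinf_sumE (I : Type) (s : seq I) (P : pred I) (F : I -> cinf M) x :
  (\sum_(i <- s | P i) F i) x = \sum_(i <- s | P i) F i x.
Proof. by elim/big_rec2: _ => // i a b _ <-. Qed.

Lemma tangent_ext x (v w : tangent x) : (forall f, v f = w f) -> v = w.
Proof. by move=> vw; apply/val_inj/funext. Qed.

Lemma tangent_lin x (v : tangent x) (a : R) f g :
  v (cinf_cst M a * f + g) = a * v f + v g.
Proof. by have /asboolP[+ _] := tangentP v; apply. Qed.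

Lemma tangent_leibniz x (v : tangent x) f g : v (f * g) = f x * v g + g x * v f.
Proof. by have /asboolP[_ +] := tangentP v; apply. Qed.

Lemma tangentD x (v : tangent x) f g : v (f + g) = v f + v g.
Proof.
have := tangent_lin v 1 f g; rewrite mul1r => <-; congr (v (_ + _)).
by apply: cinf_ext => y; rewrite cinf_mulE mul1r.
Qed.

Lemma tangent0 x (v : tangent x) : v 0 = 0 :> R.
Proof. by have := tangentD v 0 0; rewrite addr0 => /eqP; rewrite -subr_eq subrr => /eqP. Qed.

Lemma tangentN x (v : tangent x) f : v (- f) = - v f :> R.
Proof. by apply/eqP; rewrite -addr_eq0 -tangentD addNr tangent0. Qed.

Lemma tangentB x (v : tangent x) f g : v (f - g) = v f - v g :> R.
Proof. by rewrite tangentD tangentN. Qed.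

Lemma tangent1 x (v : tangent x) : v 1 = 0 :> R.
Proof.
have := tangent_leibniz v 1 1; rewrite mulr1 cinf_1E mul1r => /eqP.
by rewrite -subr_eq subrr => /eqP.
Qed.

Lemma tangent_cst x (v : tangent x) (a : R) : v (cinf_cst M a) = 0 :> R.
Proof.
have := tangent_lin v a 1 0; rewrite addr0 mulr1 => ->.
by rewrite tangent1 tangent0 mulr0 addr0.
Qed.

Lemma tangent_sum x (v : tangent x) (I : Type) (s : seq I) (P : pred I) (F : I -> cinf M) :
  v (\sum_(i <- s | P i) F i) = \sum_(i <- s | P i) (v (F i) : R).
Proof.
elim/big_rec2: _ => [|i a b _ <-]; first exact: tangent0.
exact: tangentD.
Qed.

(** For a bump beta supported in V and equal to 1 near x, beta (f - g) = 0; the Leibniz rule at x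
    then leaves v (f - g) = 0. *)
Lemma tangent_local x (v : tangent x) (V : set M) f g : open V -> V x ->
  (forall y, V y -> f y = g y) -> v f = v g.
Proof.
move=> oV Vx fg; apply/eqP; rewrite -subr_eq0 -tangentB; apply/eqP.
have [beta [U [K [[oU Ux UV b1] [cK KV b0]]]]] := bump oV Vx.
have h0 : beta * (f - g) = 0.
  apply: cinf_ext => y; rewrite cinf_mulE cinf_addE cinf_oppE.
  have [/KV/fg ->|/b0 ->] := pselect (K y); last by rewrite mul0r.
  by rewrite subrr mulr0.
have := tangent_leibniz v beta (f - g).
rewrite h0 tangent0 (b1 _ Ux) mul1r cinf_addE cinf_oppE (fg _ Vx) subrr mul0r addr0.
by move=> <-.
Qed.

(* A smooth function near x, in the chart c, is a + sum_i (y_i - x_i) g_i, so a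
   derivation at x only depends on its values on the coordinates. *)
Lemma tangent_coord (c : chart R n M) x (Y : 'I_n -> cinf M) (V : set M) (v : tangent x) f :
  atlas c -> open V -> V x -> V `<=` cdom c ->
  (forall i y, V y -> Y i y = cmap c y 0 i) ->
  v f = \sum_i v (Y i) * 'D_(delta_mx 0 i) (f \o cinv c) (cmap c x) :> R.
Proof.
move=> ac oV Vx Vc YV; set p := cmap c x.
have cx : cdom c x by exact: Vc.
have cp : ccod c p by exact: cmap_cod.
have oc : open (ccod c) by exact: ccod_open.
have /nbhs_ballP[e /= e0 eU] : nbhs p (ccod c) by exact: open_nbhs_nbhs.
have e2 : 0 < e / 2 by rewrite divr_gt0.
have [gam [sg g1 g0]] := smooth_bump p e2.
have e4 : 0 < e / 2 / 2 by rewrite divr_gt0.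
(* Hadamard's lemma is stated for functions on all of R^n. The values of [cinv c] outside [ccod c]
   are arbitrary, but gam vanishes there. *)
pose F y := gam y * f (cinv c y).
pose K0 := [set y : 'rV[R]_n | forall i, `|y 0 i - p 0 i| <= e / 2].
have K0c : K0 `<=` ccod c.
  move=> y Ky; apply: eU; apply: ball_coord => // i.
  by apply: le_lt_trans (Ky i) _; rewrite ltr_pdivrMr// ltr_pMr// ltr1n.
have cK0 : closed K0 := compact_closed (@norm_hausdorff _ _) (@box_compact _ _ _ _).
have sF : smooth_on setT F.
  move=> k; apply: class_C_local => y _; have [Ky|nKy] := pselect (K0 y).
    exists (ccod c); first exact: K0c.
    apply: class_CM => //; first exact: class_C_sub (sg k).
    have := cinf_msmooth f setT ac k; apply: class_C_sub => z cz; by split.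
  exists (~` K0) => //.
  apply: (@class_C_eq _ _ _ k (fun=> 0)); last exact: class_C_cst.
    by rewrite openC.
  move=> z nKz; rewrite /F g0 ?mul0r//; apply: contrapT => h; apply: nKz => i.
  rewrite leNgt; apply/negP => hi; apply: h; exists i; exact: ltW.
have nearF : \forall y \near p, F y = f (cinv c y).
  near=> y; rewrite /F g1 ?mul1r// => i; apply: ltW.
  have : ball p (e / 2 / 2) y by near: y; exact: nbhsx_ballx.
  rewrite -ball_normE/=; apply: le_lt_trans.
  by have := norm_coord (p - y) i; rewrite !mxE distrC.
have [g sgi [Fg gp]] := hadamard p sF.
(* A tangent vector acts on global functions only, so the coefficients from Hadamard's lemma are
   replaced by global functions with the same germs at x. *)
have gext i : exists G : cinf M, exists2 U, open U /\ U x & forall y, U y -> G y = g i (cmap c y).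
  have [|G [U [oU Ux _ UG]]] := @msmooth_extend _ _ M x (cdom c) (fun y => g i (cmap c y)) (cdom_open c) cx.
    apply: (msmooth_chart ac (cdom_open c)) => // k.
    have oU := @chart_preimage_open _ _ M c _ (cdom_open c).
    have /(class_C_sub (@subsetT _ _)) sgk := sgi i k.
    apply: (class_C_eq oU _ (sgk _)) => y [cy _] /=.
    by rewrite cinvK.
  by exists G, U.
pose G i := sval (cid (gext i)).
pose U i := s2val (cid2 (svalP (cid (gext i)))).
have oU i : open (U i) /\ U i x by exact: (s2valP (cid2 (svalP (cid (gext i))))).
have GU i : forall y, U i y -> G i y = g i (cmap c y).
  exact: (s2valP' (cid2 (svalP (cid (gext i))))).
have cpc : {for x, continuous (cmap c)} by exact: cmap_continuous.
have nearf : \forall y \near x, f y = (cinf_cst M (f x) +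
    \sum_i (Y i - cinf_cst M (p 0 i)) * G i) y.
  have nV : \forall y \near x, V y by exact: open_nbhs_nbhs.
  have nF : \forall y \near x, F (cmap c y) = f (cinv c (cmap c y)).
    exact: (cpc _ nearF).
  have nU : \forall y \near x, forall i, U i y.
    apply: filter_forall => i; apply: open_nbhs_nbhs; exact: oU.
  near=> y; have Vy : V y by near: y.
  have := near nF y => /(_ _); rewrite cmapK; last exact: Vc.
  move=> <- //; rewrite Fg cinf_addE cinf_sumE cinf_cstE.
  rewrite (nbhs_singleton nearF) /p cmapK//; congr (_ + _).
  apply: eq_bigr => i _; rewrite cinf_mulE cinf_addE cinf_oppE YV// GU//.
  by have := near nU y => /(_ _)/(_ i); apply.
move: nearf; rewrite /prop_near1 nbhsE => -[B [oB Bx] BE].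
rewrite (tangent_local v oB Bx BE) tangentD tangent_cst add0r tangent_sum.
apply: eq_bigr => i _; rewrite tangent_leibniz tangentB tangent_cst subr0.
rewrite cinf_addE cinf_oppE YV// cinf_cstE subrr mul0r add0r mulrC; congr (_ * _).
rewrite GU; last by have [] := oU i.
by rewrite gp; apply: near_eq_derive.
Unshelve. all: by end_near. Qed.

End tangent_theory.

Section coordinate_fields.
Variables (R : realType) (n : nat) (M : manifold R n).
Variables (c : chart R n M) (ac : atlas c) (beta : cinf M) (K : set M).
Hypotheses (cK : closed K) (Kc : K `<=` cdom c) (b0 : forall y, ~ K y -> beta y = 0).
Implicit Types f g : cinf M.

Let der i f x : R := beta x * 'D_(delta_mx 0 i) (f \o cinv c) (cmap c x).

Lemma chart_differentiable f y : ccod c y -> differentiable (f \o cinv c) y.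
Proof.
move=> cy; have [df _] := cinf_msmooth f setT ac 1%N.
by apply: df; split.
Qed.

Let der_subproof i x : (fun f => der i f x : R^o) \in derivation_at x.
Proof.
have [Kx|/b0 bx] := pselect (K x); last first.
  by apply/asboolP; split=> *; rewrite /der bx !mul0r ?mulr0 addr0.
have cp : ccod c (cmap c x) by exact/cmap_cod/Kc.
have dd f : derivable (f \o cinv c) (cmap c x) (delta_mx 0 i).
  by apply: diff_derivable; exact: chart_differentiable.
apply/asboolP; split=> [a f g|f g]; rewrite /der.
  rewrite (_ : _ \o cinv c = (a \*: ((f \o cinv c) : _ -> R^o)) + (g \o cinv c))//.
  rewrite deriveD; [|exact: derivableZ|exact: dd].
  rewrite deriveZ; last exact: dd.
  by rewrite mulrDr mulrCA.
rewrite (_ : _ \o cinv c = (f \o cinv c) * (g \o cinv c))//.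
rewrite deriveM; [|exact: dd|exact: dd].
rewrite /= cmapK; last exact: Kc.
by rewrite mulrDr /GRing.scale/= !(mulrCA (beta x)).
Qed.

Let field_at i x : tangent x := Tangent (der_subproof i x).

Lemma field_subproof i : tsmooth setT (field_at i).
Proof.
move=> f; have oc := @cdom_open _ _ _ c.
apply: (msmooth_cutoff oc cK Kc b0) => //.
apply: (msmooth_chart ac oc) => // k.
have : class_C (ccod c `&` cinv c @^-1` cdom c) k ('D_(delta_mx 0 i) (f \o cinv c)).
  apply: (class_C_sub _ ((cinf_msmooth f setT ac k.+1).2 (delta_mx 0 i))).
  by move=> y [].
apply: class_C_eq; first exact: chart_preimage_open.
by move=> y [cy _] /=; rewrite cinvK.
Qed.

Definition coord_field i : gsect (TM M) := @Gam _ _ _ (TM M) _ (field_subproof i).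

Lemma coord_fieldE i f x :
  coord_field i x f = beta x * 'D_(delta_mx 0 i) (f \o cinv c) (cmap c x).
Proof. by []. Qed.

End coordinate_fields.

(** * Frames of TM and of E, cut off to global sections *)

Section frames.
Variables (R : realType) (n : nat) (M : manifold R n).

Lemma tangent_frame (x0 : M) : exists V (Y : 'I_n -> cinf M) (P : 'I_n -> gsect (TM M)),
  [/\ open V, V x0,
      forall x i j, V x -> P i x (Y j) = (i == j)%:R
    & forall x (v : tangent x), V x -> v = \sum_i v (Y i) *: P i x].
Proof.
have [c ac cx] := atlas_cover x0.
have oc := @cdom_open _ _ _ c.
have [beta [V [K [[oV Vx VW b1] [cK KW b0]]]]] := bump oc cx.
have sY i := msmooth_cutoff oc cK KW b0 (msmooth_coord i ac).
have YP i : (fun x => beta x * cmap c x 0 i) \in @msmooth_pred _ _ M by exact/msmooth_predP.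
pose Y i := Cinf (YP i).
have YE i y : V y -> Y i y = cmap c y 0 i by move=> /b1 /= ->; rewrite mul1r.
exists V, Y, (coord_field ac cK KW b0); split => // [x i j Vx'|x v Vx'].
  rewrite coord_fieldE b1// mul1r.
  have cx' : cdom c x by exact: VW.
  rewrite (_ : 'D_ _ _ _ = 'D_(delta_mx 0 i) (fun z : 'rV[R]_n => z 0 j) (cmap c x)).
    by rewrite derive_coord mxE eqxx/= eq_sym.
  apply: near_eq_derive; near=> z.
  have Vz : (ccod c `&` cinv c @^-1` V) z.
    near: z; apply: open_nbhs_nbhs; split; first exact: chart_preimage_open.
    by split; [exact: cmap_cod|rewrite /preimage/= cmapK].
  by have [cz Vz'] := Vz; rewrite /= [LHS]YE// cinvK.
apply: tangent_ext => f.
rewrite (tangent_coord v f ac oV Vx' VW YE).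
have E (I : Type) (s : seq I) (F : I -> tangent x) : (\sum_(i <- s) F i) f = \sum_(i <- s) F i f :> R.
  by elim: s => [|a s ih]; rewrite ?big_nil// !big_cons -ih.
rewrite E; apply: eq_bigr => i _.
by rewrite tangent_scaleE coord_fieldE b1// mul1r.
Unshelve. all: by end_near. Qed.

Lemma bundle_frame r (E : vbundle M r) (x0 : M) :
  exists V (eta : cinf M) (eps : 'I_r -> gsect E) (kap : 'I_r -> forall x, E x -> R),
  [/\ [/\ open V, V x0 & forall x, V x -> eta x = 1],
      forall k x (a : R) (u w : E x), kap k x (a *: u + w) = a * kap k x u + kap k x w,
      forall k l x, V x -> kap k x (eps l x) = (k == l)%:R,
      forall (u : forall x, E x) x, \sum_k kap k x (u x) *: eps k x = eta x *: u x
    & forall k W (u : forall x, E x), open W -> vsmooth W u ->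
        msmooth W (fun x => kap k x (u x))].
Proof.
have [j jx] := btriv_cover E x0.
have oJ := @btriv_open _ _ _ _ E j.
have [beta [V [K [[oV Vx VW b1] [cK KW b0]]]]] := bump oJ jx.
have surj x k : exists v, btriv_dom j x -> btriv j x v = delta_mx 0 k.
  have [jx'|] := pselect (btriv_dom j x); last by exists 0.
  by have [g fg gf] := btriv_bij jx'; exists (g (delta_mx 0 k)).
pose e k x := sval (cid (surj x k)).
have eE k x : btriv_dom j x -> btriv j x (e k x) = delta_mx 0 k.
  exact: (svalP (cid (surj x k))).
have se k : vsmooth (btriv_dom j) (e k : forall x, E x).
  move=> i l; have [g [sg gE]] := btriv_change j i (v := E).
  have := sg k l; rewrite [X in msmooth X]setIC; apply: msmooth_eq.
    by apply: openI => //; exact: btriv_open.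
  move=> x [ix jx']; rewrite (gE _ _ jx' ix) eE// -rowE mxE//.
have sE k := vlocal_cutoff (@vlocal_bundle _ _ _ r E) oJ cK KW b0 (se k).
pose kap k x (v : E x) : R := beta x * btriv j x v 0 k.
(* Frame and coordinates are both cut off by beta, so that the expansion of u reproduces beta^2 u on
   all of M. *)
exists V, (beta * beta), (fun k => Gam (sE k)), kap; split.
- by split => // x /b1; rewrite cinf_mulE => ->; rewrite mulr1.
- by move=> k x a u w; rewrite /kap linearP !mxE mulrDr mulrCA.
- move=> k l x Vx' /=; rewrite /kap b1// mul1r scale1r eE; last exact: VW.
  by rewrite mxE eqxx eq_sym.
- move=> u x; have [Kx|/b0 bx] := pselect (K x); last first.
    by rewrite cinf_mulE bx mul0r scale0r big1// => k _; rewrite /kap bx mul0r scale0r.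
  have jx' : btriv_dom j x by exact: KW.
  apply: (bij_inj (btriv_bij jx')).
  rewrite linear_sum linearZ/= [in RHS](row_sum_delta (btriv j x (u x))).
  rewrite scaler_sumr; apply: eq_bigr => k _.
  rewrite !linearZ/= eE// !scalerA /kap; congr (_ *: _).
  by rewrite mulrAC mulrC.
- move=> k W u oW su; apply: msmooth_local => x Wx.
  have [Kx|nKx] := pselect (K x).
    exists (btriv_dom j `&` W), (fun x => kap k x (u x)); split => //.
    + exact: openI.
    + by split => //; exact: KW.
    + apply: msmoothM; [exact: openI|exact: cinf_msmooth|exact: su].
  exists (~` K), (fun=> 0); split => //; first by rewrite openC.
    exact: msmooth_cst.
  by move=> y /b0 by0; rewrite /kap by0 mul0r.
Qed.

End frames.

(** * Gauge operators and jets *)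

Section gauge_theory.
Variables (R : realType) (n r : nat) (M : manifold R n) (E : vbundle M r).
Implicit Types (f g : cinf M) (x : M) (u w : gsect E).

Lemma gsect_sumE (V : vfamily M) (I : Type) (s : seq I) (P : pred I)
    (F : I -> gsect V) x :
  (\sum_(i <- s | P i) F i) x = \sum_(i <- s | P i) F i x.
Proof. by elim/big_rec2: _ => // i a b _ <-. Qed.

Lemma gauge_ext x (d e : gauge E x) : (forall u, gauge_op d u = gauge_op e u) ->
  symbol d = symbol e -> d = e.
Proof.
move=> de se; apply: val_inj; case: d e de se => [[d1 d2] dP] [[e1 e2] eP] /=.
rewrite /gauge_op /symbol /= => de ->; congr pair; exact: funext.
Qed.

Lemma gauge_op_lin x (a : R) (d e : gauge E x) u :
  gauge_op (a *: d + e) u = a *: gauge_op d u + gauge_op e u.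
Proof. by []. Qed.

Lemma symbol_lin x (a : R) (d e : gauge E x) :
  symbol (a *: d + e) = a *: symbol d + symbol e.
Proof. by []. Qed.

Lemma gauge_op0l x u : gauge_op (0 : gauge E x) u = 0. Proof. by []. Qed.
Lemma gauge_opDl x (d e : gauge E x) u : gauge_op (d + e) u = gauge_op d u + gauge_op e u.
Proof. by []. Qed.
Lemma symbolD x (d e : gauge E x) : symbol (d + e) = symbol d + symbol e.
Proof. by []. Qed.
Lemma gauge_opNl x (d : gauge E x) u : gauge_op (- d) u = - gauge_op d u.
Proof. by []. Qed.
Lemma symbolN x (d : gauge E x) : symbol (- d) = - symbol d.
Proof. by []. Qed.
Lemma gauge_opZl x (a : R) (d : gauge E x) u : gauge_op (a *: d) u = a *: gauge_op d u.
Proof. by []. Qed.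

Lemma gauge_op_suml x (I : Type) (s : seq I) (P : pred I) (F : I -> gauge E x) u :
  gauge_op (\sum_(i <- s | P i) F i) u = \sum_(i <- s | P i) gauge_op (F i) u.
Proof. by elim/big_rec2: _ => // i a b _ <-. Qed.

Lemma symbol_sum x (I : Type) (s : seq I) (P : pred I) (F : I -> gauge E x) :
  symbol (\sum_(i <- s | P i) F i) = \sum_(i <- s | P i) symbol (F i).
Proof. by elim/big_rec2: _ => // i a b _ <-. Qed.

Lemma gauge_op0 x (d : gauge E x) : gauge_op d 0 = 0.
Proof.
by have := gauge_opD d 0 0; rewrite addr0 => /eqP; rewrite -subr_eq subrr => /eqP.
Qed.

Lemma gauge_opN x (d : gauge E x) u : gauge_op d (- u) = - gauge_op d u.
Proof. by apply/eqP; rewrite -addr_eq0 -gauge_opD addNr gauge_op0. Qed.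

Lemma gauge_opB x (d : gauge E x) u w : gauge_op d (u - w) = gauge_op d u - gauge_op d w.
Proof. by rewrite gauge_opD gauge_opN. Qed.

Lemma gauge_op_sum x (d : gauge E x) (I : Type) (s : seq I) (P : pred I)
    (F : I -> gsect E) :
  gauge_op d (\sum_(i <- s | P i) F i) = \sum_(i <- s | P i) gauge_op d (F i).
Proof.
elim/big_rec2: _ => [|i a b _ <-]; first exact: gauge_op0.
exact: gauge_opD.
Qed.

Lemma gauge_op_cst x (d : gauge E x) (a : R) u :
  gauge_op d (cinf_cst M a *: u) = a *: gauge_op d u.
Proof. by rewrite gauge_leibniz tangent_cst scale0r addr0. Qed.

Lemma gauge_local x (d : gauge E x) (V : set M) u w : open V -> V x ->
  (forall y, V y -> u y = w y) -> gauge_op d u = gauge_op d w.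
Proof.
move=> oV Vx uw; apply/eqP; rewrite -subr_eq0 -gauge_opB; apply/eqP.
have [beta [U [K [[oU Ux UV b1] [cK KV b0]]]]] := bump oV Vx.
have h0 : beta *: (u - w) = 0.
  apply: gsect_ext => y; rewrite gsect_scaleE gsect_addE gsect_oppE.
  have [/KV/uw ->|/b0 ->] := pselect (K y); last by rewrite scale0r.
  by rewrite subrr scaler0.
have := gauge_leibniz d beta (u - w).
rewrite h0 gauge_op0 (b1 _ Ux) scale1r gsect_addE gsect_oppE (uw _ Vx) subrr scaler0 addr0.
by move=> <-.
Qed.

Lemma jet_ext x (mu nu : jet E x) : (forall d, mu d = nu d) -> mu = nu.
Proof. by move=> mn; apply/val_inj/funext. Qed.

Lemma jet_exists x (mu : jet E x) : exists u, mu = jet_of x u.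
Proof.
have /asboolP[u uE] := jetP mu; exists u; apply: jet_ext => d.
by rewrite uE.
Qed.

Lemma jetD x (mu : jet E x) (d e : gauge E x) : mu (d + e) = mu d + mu e.
Proof. by have [u ->] := jet_exists mu. Qed.

Lemma jetZ x (mu : jet E x) (a : R) (d : gauge E x) : mu (a *: d) = a *: mu d.
Proof. by have [u ->] := jet_exists mu. Qed.

Lemma jet0 x (mu : jet E x) : mu (0 : gauge E x) = 0.
Proof. by have [u ->] := jet_exists mu. Qed.

Lemma jetN x (mu : jet E x) (d : gauge E x) : mu (- d) = - mu d.
Proof. by have [u ->] := jet_exists mu. Qed.

Lemma jet_sum x (mu : jet E x) (I : Type) (s : seq I) (P : pred I) (F : I -> gauge E x) :
  mu (\sum_(i <- s | P i) F i) = \sum_(i <- s | P i) mu (F i).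
Proof. have [u ->] := jet_exists mu; exact: gauge_op_suml. Qed.

Lemma jet_of_jproj x u : jproj (jet_of x u) = u x.
Proof. by []. Qed.

End gauge_theory.

(* An E-frame eps with coordinates kap, and vector fields P dual to the
   functions Y.  They are global objects, but form frames over fd_dom only. *)
Record frame_data (R : realType) (n r : nat) (M : manifold R n) (E : vbundle M r) := FrameData {
  fd_dom : set M;
  fd_Y : 'I_n -> cinf M;
  fd_P : 'I_n -> gsect (TM M);
  fd_eta : cinf M;
  fd_eps : 'I_r -> gsect E;
  fd_kap : 'I_r -> forall x, E x -> R;
  fd_open : open fd_dom;
  fd_dual : forall x i j, fd_dom x -> fd_P i x (fd_Y j) = (i == j)%:R;
  fd_tangent : forall x (v : tangent x), fd_dom x -> v = \sum_i v (fd_Y i) *: fd_P i x;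
  fd_eta1 : forall x, fd_dom x -> fd_eta x = 1;
  fd_kap_lin : forall k x (a : R) (u w : E x),
    fd_kap k (a *: u + w) = a * fd_kap k u + fd_kap k w;
  fd_kap_eps : forall k l x, fd_dom x -> fd_kap k (fd_eps l x) = (k == l)%:R;
  fd_kapE : forall (u : forall x, E x) x,
    \sum_k fd_kap k (u x) *: fd_eps k x = fd_eta x *: u x;
  fd_kap_smooth : forall k W (u : forall x, E x), open W -> vsmooth W u ->
    msmooth W (fun x => fd_kap k (u x))
}.

Lemma frame_data_exists (R : realType) (n r : nat) (M : manifold R n)
  (E : vbundle M r) (x0 : M) : exists D : frame_data E, fd_dom D x0.
Proof.
have [V [Y [P [oV Vx PY vP]]]] := tangent_frame x0.
have [V' [eta [eps [kap [[oV' V'x e1] kl ke kE ks]]]]] := bundle_frame E x0.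
unshelve eexists (@FrameData _ _ _ _ E (V `&` V') Y P eta eps kap _ _ _ _ _ _ _ _) => //.
- exact: openI.
- by move=> x i j [? ?]; exact: PY.
- by move=> x v [? ?]; exact: vP.
- by move=> x [? ?]; exact: e1.
- by move=> k l x [? ?]; exact: ke.
Qed.

(** * A connection, and frames of DE and JE *)

Section connection.
Variables (R : realType) (n r : nat) (M : manifold R n) (E : vbundle M r).
Variable D : frame_data E.
Implicit Types (f g : cinf M) (x : M) (u w : gsect E).

Local Notation dom := (fd_dom D).
Local Notation Y := (fd_Y D).
Local Notation P := (fd_P D).
Local Notation eta := (fd_eta D).
Local Notation eps := (fd_eps D).
Local Notation kap := (fd_kap D).

Lemma kapf_subproof k u : (fun x => kap k (u x)) \in @msmooth_pred _ _ M.
Proof. apply/msmooth_predP; apply: fd_kap_smooth; [exact: openT|exact: gsect_smooth]. Qed.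

Definition kapf k u : cinf M := Cinf (kapf_subproof k u).

Lemma kap_add k x (u w : E x) : kap k (u + w) = kap k u + kap k w.
Proof. by have := fd_kap_lin D k 1 u w; rewrite scale1r mul1r. Qed.
Lemma kap_0 k x : kap k (0 : E x) = 0.
Proof. by have := kap_add k (0 : E x) 0; rewrite addr0 => /eqP; rewrite -subr_eq subrr => /eqP. Qed.
Lemma kap_scale k x (a : R) (u : E x) : kap k (a *: u) = a * kap k u.
Proof. by have := fd_kap_lin D k a u 0; rewrite addr0 kap_0 addr0. Qed.
Lemma kap_sum k x (I : Type) (s : seq I) (Q : pred I) (F : I -> E x) :
  kap k (\sum_(i <- s | Q i) F i) = \sum_(i <- s | Q i) kap k (F i).
Proof. elim/big_rec2: _ => [|i a b _ <-]; [exact: kap_0|exact: kap_add]. Qed.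

Lemma kapf_lin k (a : R) u w :
  kapf k (cinf_cst M a *: u + w) = cinf_cst M a * kapf k u + kapf k w.
Proof. by apply: cinf_ext => x; exact: fd_kap_lin. Qed.

Lemma kapf_scale k f u : kapf k (f *: u) = f * kapf k u.
Proof. by apply: cinf_ext => x; exact: kap_scale. Qed.

Lemma kap_eps_sum x (v : E x) : dom x -> v = \sum_k kap k v *: eps k x.
Proof.
(* [fd_kapE] concerns families over M; v is extended by 0 away from x, with a cast along x = y. *)
pose u y : E y := if pselect (x = y) is left e then ecast y (E y) e v else 0.
have ux : u x = v by rewrite /u; case: pselect => // e; rewrite eq_axiomK.
by move=> dx; rewrite -ux fd_kapE fd_eta1// scale1r.
Qed.

Lemma kap_inj x (v w : E x) : dom x -> (forall k, kap k v = kap k w) -> v = w.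
Proof.
move=> dx vw; rewrite (kap_eps_sum v dx) (kap_eps_sum w dx).
by apply: eq_bigr => k _; rewrite vw.
Qed.

Lemma kapf_eps u : \sum_k kapf k u *: eps k = eta *: u.
Proof. by apply: gsect_ext => x; rewrite gsect_sumE; exact: fd_kapE. Qed.

(** The connection for which the frame eps is parallel over [dom]. Since [fd_kapE] holds on all of
    M, so does the Leibniz rule, at the price of the factor eta in the symbol. *)
Lemma conn_subproof x (v : tangent x) :
  ((fun u => \sum_k v (kapf k u) *: eps k x), eta x *: v) \in @gauge_at _ _ _ _ E x.
Proof.
apply/asboolP; split=> [a u w|f u] /=.
  rewrite scaler_sumr -big_split; apply: eq_bigr => k _ /=.
  by rewrite kapf_lin tangent_lin scalerDl scalerA.
rewrite -[X in _ = _ + X]/((eta x * v f) *: u x) mulrC -scalerA.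
rewrite -[eta x *: u x]fd_kapE !scaler_sumr -big_split; apply: eq_bigr => k _ /=.
by rewrite kapf_scale tangent_leibniz scalerDl !scalerA [kapf k u x * _]mulrC.
Qed.

Definition conn x (v : tangent x) : gauge E x := Gauge (conn_subproof v).

Lemma conn_smooth W (X : forall x, tangent x) : open W -> tsmooth W X ->
  dsmooth W (fun x => conn (X x)).
Proof.
move=> oW sX; split=> [u|].
  apply: (@vlocal_sum _ _ M E W _ _ _ (fun k x => X x (kapf k u)) (fun k => eps k)) => //.
    exact: vlocal_bundle.
  by move=> k _; split; [exact: sX|exact: (vlocal_sect (eps k) W (@vlocal_bundle _ _ _ r E))].
have := tsmooth_lin oW (cinf_msmooth eta W) sX (@tsmooth0 _ _ M W).
by congr tsmooth; apply: functional_extensionality_dep => x; rewrite addr0.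
Qed.

Definition nabla (X : gsect (TM M)) : gsect (DE E) :=
  @Gam _ _ _ (DE E) _ (conn_smooth openT (gsect_smooth X)).

Lemma conn_opE x (v : tangent x) u : gauge_op (conn v) u = \sum_k v (kapf k u) *: eps k x.
Proof. by []. Qed.

Lemma conn_symbol x (v : tangent x) : symbol (conn v) = eta x *: v.
Proof. by []. Qed.

Lemma conn_lin x (a : R) (v w : tangent x) : conn (a *: v + w) = a *: conn v + conn w.
Proof.
apply: gauge_ext => [u|]; last by rewrite /= !(symbol_lin, conn_symbol) scalerDr !scalerA mulrC.
rewrite gauge_op_lin !conn_opE scaler_sumr -big_split; apply: eq_bigr => k _.
by rewrite /= scalerA -scalerDl.
Qed.

Lemma vert_subproof k x (w : E x) :
  ((fun u => kap k (u x) *: w), 0 : tangent x) \in @gauge_at _ _ _ _ E x.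
Proof.
apply/asboolP; split=> [a u v|f u] /=.
  by rewrite fd_kap_lin scalerDl scalerA.
by rewrite -[X in _ = _ + X]/((0 : R) *: u x) scale0r addr0 kap_scale scalerA.
Qed.

(** The endomorphism kap_k tensor w of E_x, an element of the kernel of the anchor. *)
Definition vert k x (w : E x) : gauge E x := Gauge (vert_subproof k w).

Lemma vert_smooth k (w : gsect E) : dsmooth setT (fun x => vert k (w x)).
Proof.
split=> [u|]; last exact: tsmooth0.
exact: (gsect_smooth (kapf k u *: w)).
Qed.

Definition vert_sec k w : gsect (DE E) := @Gam _ _ _ (DE E) _ (vert_smooth k w).

(** Apply d to the expansion of eta u in the frame. As eta is 1 near x, its derivative vanishes at x
    and d (eta u) = d u. *)
Lemma gauge_op_frame x (d : gauge E x) u : dom x -> gauge_op d u =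
  \sum_k (kap k (u x) *: gauge_op d (eps k) + symbol d (kapf k u) *: eps k x).
Proof.
move=> dx; have := gauge_leibniz d eta u.
rewrite fd_eta1// scale1r (tangent_local (symbol d) (g := 1) (fd_open D) dx); last first.
  by move=> y /fd_eta1.
rewrite tangent1 scale0r addr0 => <-; rewrite -kapf_eps gauge_op_sum.
by apply: eq_bigr => k _; rewrite gauge_leibniz.
Qed.

Lemma gauge_decomp x (d : gauge E x) : dom x ->
  d = conn (symbol d) + \sum_k vert k (gauge_op d (eps k)).
Proof.
move=> dx; apply: gauge_ext => [u|].
  rewrite gauge_opDl gauge_op_suml (gauge_op_frame d u dx) big_split /= addrC.
  by [].
rewrite symbolD symbol_sum conn_symbol fd_eta1// scale1r big1 ?addr0// => k _.
Qed.

Lemma jet_vert x (mu : jet E x) k (w : E x) : mu (vert k w) = kap k (jproj mu) *: w.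
Proof. by have [u ->] := jet_exists mu. Qed.

Lemma conn_sum x (I : Type) (s : seq I) (a : I -> R) (F : I -> tangent x) :
  conn (\sum_(i <- s) a i *: F i) = \sum_(i <- s) a i *: conn (F i).
Proof.
elim: s => [|i s ih]; last by rewrite !big_cons conn_lin ih.
rewrite !big_nil; apply: gauge_ext => [u|]; last by rewrite conn_symbol scaler0.
by rewrite conn_opE gauge_op0l big1// => k _; rewrite tangent_0E scale0r.
Qed.

Lemma jet_frame x (mu : jet E x) (d : gauge E x) : dom x -> mu d =
  \sum_i symbol d (Y i) *: mu (conn (P i x)) +
  \sum_k kap k (jproj mu) *: gauge_op d (eps k).
Proof.
move=> dx; rewrite {1}(gauge_decomp d dx) jetD jet_sum; congr (_ + _).
  rewrite {1}(fd_tangent (symbol d) dx) conn_sum jet_sum.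
  by apply: eq_bigr => i _; rewrite jetZ.
by apply: eq_bigr => k _; rewrite jet_vert.
Qed.

Lemma conn_eps x (v : tangent x) k : dom x -> gauge_op (conn v) (eps k) = 0.
Proof.
move=> dx; rewrite conn_opE big1// => l _.
rewrite (tangent_local v (g := cinf_cst M (l == k)%:R) (fd_open D) dx); last first.
  by move=> y dy /=; rewrite fd_kap_eps.
by rewrite tangent_cst scale0r.
Qed.

Lemma bundle_extend x (w : E x) : dom x -> exists u : gsect E, u x = w.
Proof.
move=> dx; exists (\sum_k cinf_cst M (kap k w) *: eps k).
rewrite gsect_sumE [RHS](kap_eps_sum w dx); exact: eq_bigr.
Qed.

End connection.

(** * Extension of gauge elements and existence of the Lie derivative *)

Section extension_and_lie_derivative.
Variables (R : realType) (n r : nat) (M : manifold R n) (E : vbundle M r).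
Implicit Types (f g : cinf M) (x : M) (u w : gsect E).

Lemma vertical_value x (d : gauge E x) u w : symbol d = 0 -> u x = w x ->
  gauge_op d u = gauge_op d w.
Proof.
have [D dx] := frame_data_exists E x.
move=> d0 uw; rewrite !(gauge_op_frame _ _ dx); apply: eq_bigr => k _.
by rewrite uw d0 !tangent_0E.
Qed.

Lemma jet_vertical x (mu : jet E x) (d : gauge E x) u : symbol d = 0 ->
  jproj mu = u x -> mu d = gauge_op d u.
Proof.
have [w ->] := jet_exists mu; rewrite jet_of_jproj => d0 wu.
exact: vertical_value.
Qed.

(* The factor f makes up for X not lifting to DE globally: the connections at
   hand are cut off away from x. *)
Lemma gauge_extend x (X : gsect (TM M)) (d0 : gauge E x) : symbol d0 = X x ->
  exists (d : gsect (DE E)) f, [/\ d x = d0, f x = 1 & anchor d = f *: X].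
Proof.
move=> d0X; have [D dx] := frame_data_exists E x.
have ext k : exists w : gsect E, w x = gauge_op d0 (fd_eps D k) by exact: bundle_extend dx.
pose w k := sval (cid (ext k)).
have wE k : w k x = gauge_op d0 (fd_eps D k) by exact: (svalP (cid (ext k))).
exists (nabla D X + \sum_k vert_sec D k (w k)), (fd_eta D); split.
- rewrite gsect_addE gsect_sumE [RHS](gauge_decomp d0 dx) d0X; congr (_ + _).
  by apply: eq_bigr => k _; rewrite -wE.
- exact: fd_eta1.
- apply: gsect_ext => y /=; rewrite gsect_sumE symbolD symbol_sum.
  by rewrite big1 ?addr0.
Qed.

(** Besides the du, a frame of JE needs only the dY_i tensor eps_l, and these equal d(Y_i eps_l) -
    Y_i d(eps_l): first jets generate JE locally. The three kinds of indices are the d(eps_k) and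
    the two terms of this difference. *)
Lemma jet_sec_span (mu : gsect (JE E)) x : exists V (I : finType) (h : I -> cinf M)
    (u : I -> gsect E), [/\ open V, V x & forall y, V y ->
      forall d : gauge E y, mu y d = \sum_i h i y *: gauge_op d (u i)].
Proof.
have [D dx] := frame_data_exists E x.
pose pmu : gsect E := jpair mu (@Gam _ _ _ (DE E) _ (gauge_id_smooth E)).
pose th i : gsect E := jpair mu (nabla D (fd_P D i)).
exists (fd_dom D), ('I_r + ('I_n * 'I_r + 'I_n * 'I_r))%type,
  (fun a => match a with
   | inl k => kapf D k pmu
   | inr (inl p) => kapf D p.2 (th p.1)
   | inr (inr p) => - (kapf D p.2 (th p.1) * fd_Y D p.1) end),
  (fun a => match a with
   | inl k => fd_eps D k
   | inr (inl p) => fd_Y D p.1 *: fd_eps D p.2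
   | inr (inr p) => fd_eps D p.2 end).
split => //; first exact: fd_open.
move=> y dy d; rewrite big_sumType big_sumType /= (jet_frame (mu y) d dy) addrC.
congr (_ + _).
rewrite -big_split /= -(pair_bigA _ (fun i l => (kapf D l (th i)) y *: gauge_op d (fd_Y D i *: fd_eps D l) +
  (- (kapf D l (th i) * fd_Y D i)) y *: gauge_op d (fd_eps D l))) /=.
apply: eq_bigr => i _.
rewrite (_ : mu y (conn D (fd_P D i y)) = th i y)//.
rewrite [in LHS](kap_eps_sum (th i y) dy) scaler_sumr; apply: eq_bigr => l _.
rewrite gauge_leibniz -[X in _ = _ + X]/((- (kapf D l (th i) y * fd_Y D i y)) *:
  gauge_op d (fd_eps D l)).
rewrite scalerDr !scalerA addrAC scaleNr subrr add0r.
by rewrite mulrC.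
Qed.

Lemma gbrE (d e : gsect (DE E)) x u :
  gauge_op (gbr d e x) u = gauge_op (d x) (dapp e u) - gauge_op (e x) (dapp d u).
Proof. by []. Qed.

Lemma lie_der_at (d : gsect (DE E)) (mu : gsect (JE E)) x :
  exists nu : jet E x, forall e : gsect (DE E),
    nu (e x) = (dapp d (jpair mu e) - jpair mu (gbr d e)) x.
Proof.
have [V [I [h [u [oV Vx muE]]]]] := jet_sec_span mu x.
(* From L_d(h du) = alpha(d)(h) du + h d(d u). The coefficients are frozen at x, since only the jet
   at x is wanted. *)
exists (jet_of x (\sum_i (cinf_cst M (symbol (d x) (h i)) *: u i +
   cinf_cst M (h i x) *: dapp d (u i)))) => e.
rewrite gsect_addE gsect_oppE /= gauge_op_sum muE//.
rewrite (gauge_local (d x) (w := \sum_i h i *: dapp e (u i)) oV Vx); last first.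
  by move=> y Vy; rewrite gsect_sumE /= muE.
rewrite gauge_op_sum -sumrB; apply: eq_bigr => i _.
rewrite gauge_opD !gauge_op_cst gauge_leibniz gbrE scalerBr opprB.
by rewrite [X in _ = X + _]addrC addrACA subrr addr0.
Qed.

(** Smoothness in JE is tested by pairings, so the jets chosen pointwise from [lie_der_at] form a
    section. Hence the set in the definition of [lie_der] is nonempty and [xget] returns one of its
    elements. *)
Lemma lie_derP (d : gsect (DE E)) (mu : gsect (JE E)) (e : gsect (DE E)) :
  jpair (lie_der d mu) e = dapp d (jpair mu e) - jpair mu (gbr d e).
Proof.
pose nu x := sval (cid (lie_der_at d mu x)).
have nuE x (e' : gsect (DE E)) : nu x (e' x) = (dapp d (jpair mu e') - jpair mu (gbr d e')) x.
  exact: (svalP (cid (lie_der_at d mu x))).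
have snu : jsmooth setT nu.
  move=> e'; have := gsect_smooth (dapp d (jpair mu e') - jpair mu (gbr d e')).
  by congr vsmooth; apply: functional_extensionality_dep => x; rewrite nuE.
rewrite /lie_der; case: xgetP => [nu' _ H|/(_ (@Gam _ _ _ (JE E) _ snu)) H].
  exact: H.
exfalso; apply: H => e'; apply: gsect_ext => x; exact: nuE.
Qed.

End extension_and_lie_derivative.

(** * Local frames and subbundles *)

Section smooth_matrices.
Variables (R : realType) (n : nat) (M : manifold R n).
Implicit Types (W U V : set M).

Lemma msmooth_continuous W (f : M -> R) x : open W -> msmooth W f -> W x ->
  {for x, continuous f}.
Proof.
move=> oW sf Wx; have [c ac cx] := atlas_cover x.
have cy : ccod c (cmap c x) by exact: cmap_cod.
have h1 : {for cmap c x, continuous (f \o cinv c)}.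
  by have := sf c ac 0%N; apply; split => //; rewrite /preimage/= cmapK.
have h2 : {for x, continuous (f \o cinv c \o cmap c)}.
  by apply: continuous_comp => //; exact: cmap_continuous.
have e : \forall y \near x, (f \o cinv c \o cmap c) y = f y.
  near=> y; rewrite /= cmapK//; near: y.
  by apply: open_nbhs_nbhs; split => //; exact: cdom_open.
have := cvg_trans (near_eq_cvg e) h2.
rewrite /= cmapK// => h; exact: h.
Unshelve. all: by end_near. Qed.

Lemma open_neq0 W (f : M -> R) : open W -> msmooth W f ->
  open [set x | W x /\ f x != 0].
Proof.
move=> oW sf; rewrite openE => x [Wx fx]; apply: filterI; first exact: open_nbhs_nbhs.
have cf := msmooth_continuous oW sf Wx.
have o0 : open [set y : R | y != 0] by exact: open_neq.
by apply: (cf [set y | y != 0]); exact: open_nbhs_nbhs.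
Qed.

Lemma msmooth_det W k (A : M -> 'M[R]_k) : open W ->
  (forall i j, msmooth W (fun x => A x i j)) -> msmooth W (fun x => \det (A x)).
Proof.
move=> oW sA; apply: msmooth_sum => // s _; apply: msmoothM => //.
  exact: msmooth_cst.
by apply: msmooth_prod => // i _.
Qed.

Lemma msmooth_invmx W k (A : M -> 'M[R]_k) i j : open W ->
  (forall i j, msmooth W (fun x => A x i j)) ->
  (forall x, W x -> \det (A x) != 0) -> msmooth W (fun x => invmx (A x) i j).
Proof.
move=> oW sA dA.
have H : msmooth W (fun x => (\det (A x))^-1 * ((-1) ^+ (j + i) *
    \det (row' j (col' i (A x))))).
  apply: msmoothM => //; first by apply: msmooth_inv => //; exact: msmooth_det.
  apply: msmoothM => //; first exact: msmooth_cst.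
  apply: msmooth_det => // a b.
  by apply: msmooth_eq oW _ (sA (lift j a) (lift i b)) => x _; rewrite !mxE.
apply: msmooth_eq oW _ H => x Wx.
by rewrite /invmx unitmxE unitfE dA// !mxE.
Qed.

Lemma msmooth_mulmx W p q s (A : M -> 'M[R]_(p, q)) (B : M -> 'M[R]_(q, s)) i j :
  open W -> (forall i j, msmooth W (fun x => A x i j)) ->
  (forall i j, msmooth W (fun x => B x i j)) ->
  msmooth W (fun x => (A x *m B x) i j).
Proof.
move=> oW sA sB.
have H : msmooth W (fun x => \sum_l A x i l * B x l j).
  by apply: msmooth_sum => // l _; exact: msmoothM.
by apply: msmooth_eq oW _ H => x _; rewrite mxE.
Qed.

End smooth_matrices.

Section local_frames.
Variables (R : realType) (n : nat) (M : manifold R n).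
Implicit Types (W U : set M).

(** The functionals [lf_c] live on all of M and preserve smoothness over every open set; only
    duality and spanning are confined to [lf_dom]. This fits frames obtained by cutting off. *)
Record lframe (V : vfamily M) (I : finType) := LFrame {
  lf_dom : set M;
  lf_e : I -> gsect V;
  lf_c : I -> forall x, V x -> R;
  lf_open : open lf_dom;
  lf_lin : forall i x (a : R) (v w : V x), lf_c i (a *: v + w) = a * lf_c i v + lf_c i w;
  lf_dual : forall i j x, lf_dom x -> lf_c i (lf_e j x) = (i == j)%:R;
  lf_span : forall x (v : V x), lf_dom x -> v = \sum_i lf_c i v *: lf_e i x;
  lf_smooth : forall i W (s : forall x, V x), open W -> vsmooth W s ->
    msmooth W (fun x => lf_c i (s x))
}.

Lemma functional_sum (V : lmodType R) (c : V -> R) (I : Type) (s : seq I) (a : I -> R) (F : I -> V) :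
  (forall (a : R) v w, c (a *: v + w) = a * c v + c w) ->
  c (\sum_(i <- s) a i *: F i) = \sum_(i <- s) a i * c (F i).
Proof.
move=> cl; elim: s => [|i s ih]; last by rewrite !big_cons cl ih.
rewrite !big_nil; have := cl 1 0 0; rewrite scaler0 addr0 mul1r => /eqP.
by rewrite -subr_eq subrr => /eqP.
Qed.

Definition independent (V : lmodType R) k (e : 'I_k -> V) :=
  forall c : 'I_k -> R, \sum_i c i *: e i = 0 -> forall i, c i = 0.

(* Compose the coordinates with a right inverse of the coordinate matrix of the
   family; such an inverse, chosen at x0, can be corrected to one near x0. *)
Lemma dual_functionals (V : vfamily M) (I : finType) (F : lframe V I) U k
    (e : 'I_k -> forall x, V x) x0 : vlocal V ->
  open U -> U x0 -> lf_dom F x0 -> (forall i, vsmooth U (e i)) ->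
  independent (e^~ x0) ->
  exists U' (C : 'I_k -> forall x, V x -> R),
    [/\ [/\ open U', U' x0 & U' `<=` U],
        forall i x (a : R) (v w : V x), C i x (a *: v + w) = a * C i x v + C i x w,
        forall i j x, U' x -> C i x (e j x) = (i == j)%:R
      & forall i W (s : forall x, V x), open W -> W `<=` U' -> vsmooth W s ->
          msmooth W (fun x => C i x (s x))].
Proof.
move=> lV oU Ux dx se ie.
pose phi x (v : V x) : 'rV[R]_#|I| := \row_j lf_c F (enum_val j) v.
pose G x : 'M[R]_(k, #|I|) := \matrix_(i, j) lf_c F (enum_val j) (e i x).
have rG : row_free (G x0).
  apply: inj_row_free => v v0; apply/rowP => i; rewrite mxE.
  apply: (ie (fun i => v 0 i)).
  rewrite (lf_span (\sum_i _) dx) big1// => j _.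
  rewrite (functional_sum _ _ _ (lf_lin F j (x := x0))).
  move/rowP/(_ (enum_rank j)): v0; rewrite !mxE => v0.
  suff -> : \sum_i v 0 i * lf_c F j (e i x0) = 0 by rewrite scale0r.
  rewrite -[RHS]v0.
  by apply: eq_bigr => l _; rewrite mxE enum_rankK.
pose P := pinvmx (G x0).
have GP : G x0 *m P = 1%:M by exact: mulmxVp.
pose D x := G x *m P.
have oUd : open (U `&` lf_dom F) by apply: openI => //; exact: lf_open.
have sD i j : msmooth (U `&` lf_dom F) (fun x => D x i j).
  apply: (@msmooth_mulmx _ _ M _ k #|I| k G (fun=> P)) => // [a b|a b].
    have := lf_smooth F (enum_val b) oUd (vlocal_sub lV oU (@subIsetl _ _ _) (se a)).
    by apply: msmooth_eq => // x _; rewrite mxE.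
  exact: msmooth_cst.
have oU' := open_neq0 oUd (msmooth_det oUd sD).
set U' := [set x | _] in oU'.
have U'd x : U' x -> D x \in unitmx.
  by move=> [_ d0]; rewrite unitmxE unitfE.
pose C i x (v : V x) := (phi x v *m P *m invmx (D x)) 0 i.
have phil x (a : R) (v w : V x) : phi x (a *: v + w) = a *: phi x v + phi x w.
  by apply/rowP => j; rewrite !mxE lf_lin.
exists U', C; split.
- split => //; last by move=> x [[]].
  by split => //; rewrite /D GP det1 oner_eq0.
- move=> i x a v w; rewrite /C phil !mulmxDl -!scalemxAl !mxE//.
- move=> i j x U'x; rewrite /C.
  have -> : phi x (e j x) = row j (G x) by apply/rowP => l; rewrite !mxE.
  by rewrite -!row_mul mulmxV ?U'd// !mxE eq_sym.
- move=> i W s oW WU' ss.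
  apply: (@msmooth_mulmx _ _ M W 1 k k (fun x => phi x (s x) *m P) (fun x => invmx (D x))) => // a b.
    apply: (@msmooth_mulmx _ _ M W 1 #|I| k (fun x => phi x (s x)) (fun=> P)) => // c d.
      have := lf_smooth F (enum_val d) oW ss.
      by apply: msmooth_eq => // x _; rewrite mxE.
    exact: msmooth_cst.
  apply: msmooth_invmx => // [c d|x /WU' [_]]//.
  by apply: msmooth_sub (sD c d) => x /WU' [].
Qed.

(** The coordinates [sf_c] are defined on the whole fibre and not only on S, so that they can be
    applied to arbitrary smooth sections of V. For the completed frames they provide projections of
    V along a complement of S. *)
Record sub_frame (V : vfamily M) (S : forall x, set (V x)) (k : nat) := SubFrame {
  sf_dom : set M;
  sf_e : 'I_k -> gsect V;
  sf_c : 'I_k -> forall x, V x -> R;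
  sf_open : open sf_dom;
  sf_in : forall i, gsect_in S (sf_e i);
  sf_basis : forall x, sf_dom x -> is_basis (S x) (fun i => sf_e i x);
  sf_lin : forall i x (a : R) (v w : V x), sf_c i (a *: v + w) = a * sf_c i v + sf_c i w;
  sf_dual : forall i j x, sf_dom x -> sf_c i (sf_e j x) = (i == j)%:R;
  sf_smooth : forall i W (s : forall x, V x), open W -> W `<=` sf_dom ->
    vsmooth W s -> msmooth W (fun x => sf_c i (s x))
}.

Section subbundle.
Variables (V : vfamily M) (I : finType) (lV : vlocal V).
Hypothesis frames : forall x, exists F : lframe V I, lf_dom F x.
Variable S : forall x, set (V x).

Lemma basis_lin (W : lmodType R) k (T : set W) (e : 'I_k -> W) (a : R) v w :
  is_basis T e -> T v -> T w -> T (a *: v + w).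
Proof.
move=> [Te _] /Te[c ->] /Te[d ->]; apply/Te.
exists (fun i => a * c i + d i); rewrite scaler_sumr -big_split.
by apply: eq_bigr => i _; rewrite scalerDl scalerA.
Qed.

Lemma basis0 (W : lmodType R) k (T : set W) (e : 'I_k -> W) :
  is_basis T e -> T 0.
Proof.
move=> [Te _]; apply/Te; exists (fun=> 0); rewrite big1// => i _; exact: scale0r.
Qed.

Lemma subbundle_lin x (a : R) v w : is_subbundle S -> S v -> S w -> S (a *: v + w : V x).
Proof.
by move=> [k /(_ x)[U [e [_ Ux _ /(_ _ Ux) b]]]]; exact: basis_lin b.
Qed.

Lemma subbundle0 x : is_subbundle S -> S (0 : V x).
Proof. by move=> [k /(_ x)[U [e [_ Ux _ /(_ _ Ux) b]]]]; exact: basis0 b. Qed.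

Lemma subbundleD x v w : is_subbundle S -> S v -> S w -> S (v + w : V x).
Proof. by move=> bS Sv Sw; rewrite -[v]scale1r; exact: subbundle_lin. Qed.

Lemma subbundleZ x (a : R) v : is_subbundle S -> S v -> S (a *: v : V x).
Proof.
by move=> bS Sv; rewrite -[_ *: _]addr0; apply: subbundle_lin => //; exact: subbundle0.
Qed.

Lemma sub_frame_exists : is_subbundle S -> exists k, forall x0,
  exists F : sub_frame S k, sf_dom F x0.
Proof.
move=> bS; have [k kP] := bS; exists k => x0.
have [U [e [oU Ux se be]]] := kP x0.
have [F Fx] := frames x0.
have [U' [C [[oU' U'x U'U] Cl Cd Cs]]] :=
  dual_functionals lV oU Ux Fx se (be _ Ux).2.
have [beta [U2 [K [[oU2 U2x U2U b1] [cK KU b0]]]]] := bump oU' U'x.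
have KU0 : K `<=` U by exact: subset_trans U'U.
(* The cut-off makes the local frame global, and the result stays in S because S is closed under
   scaling and contains 0. *)
pose a i := Gam (vlocal_cutoff lV oU cK KU0 b0 (se i)).
have aE i x : U2 x -> a i x = e i x by move=> /b1 /= ->; rewrite scale1r.
unshelve eexists (@SubFrame V S k U2 a C oU2 _ _ Cl _ _); last by [].
- move=> i x /=; have [Kx|/b0 ->] := pselect (K x); last first.
    by rewrite scale0r; exact: subbundle0.
  apply: subbundleZ => //; have [be1 be2] := be _ (KU0 _ Kx); apply/be1.
  exists (fun j => (i == j)%:R); rewrite (bigD1 i)//= eqxx scale1r big1 ?addr0// => j.
  by rewrite eq_sym => /negPf ->; rewrite scale0r.
- move=> x U2x'; have := be _ (U'U _ (U2U _ U2x')).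
  by congr is_basis; apply/funext => i; rewrite aE.
- by move=> i j x U2x'; rewrite aE// Cd//; exact: U2U.
- move=> i W s oW WU2; apply: Cs => //; exact: subset_trans U2U.
Qed.

Lemma sf_expand k (F : sub_frame S k) x (v : V x) : sf_dom F x -> S v ->
  v = \sum_i sf_c F i v *: sf_e F i x.
Proof.
move=> dx /(sf_basis dx).1[c vE]; rewrite {1}vE; apply: eq_bigr => i _; congr (_ *: _).
rewrite vE (functional_sum _ _ _ (sf_lin F i (x := x))) (bigD1 i)//= sf_dual// eqxx mulr1.
by rewrite big1 ?addr0// => j; rewrite sf_dual// eq_sym => /negPf ->; rewrite mulr0.
Qed.

Lemma gsect_in_lin f (s t : gsect V) : is_subbundle S ->
  gsect_in S s -> gsect_in S t -> gsect_in S (f *: s + t).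
Proof. by move=> bS Ss St x; exact: subbundle_lin. Qed.

Lemma gsect_in0 : is_subbundle S -> gsect_in S (0 : gsect V).
Proof. by move=> bS x; exact: subbundle0. Qed.

Lemma gsect_inD (s t : gsect V) : is_subbundle S ->
  gsect_in S s -> gsect_in S t -> gsect_in S (s + t).
Proof. by move=> bS Ss St x; exact: subbundleD. Qed.

Lemma gsect_inZ f (s : gsect V) : is_subbundle S ->
  gsect_in S s -> gsect_in S (f *: s).
Proof. by move=> bS Ss x; exact: subbundleZ. Qed.

Lemma gsect_in_sum (J : Type) (r : seq J) (f : J -> cinf M) (s : J -> gsect V) :
  is_subbundle S -> (forall j, gsect_in S (s j)) ->
  gsect_in S (\sum_(j <- r) f j *: s j).
Proof.
move=> bS Ss; elim: r => [|j r ih]; rewrite ?big_nil ?big_cons; first exact: gsect_in0.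
exact: gsect_in_lin.
Qed.

Lemma subbundle_extend x (v : V x) : is_subbundle S -> S v ->
  exists2 s : gsect V, gsect_in S s & s x = v.
Proof.
move=> bS Sv; have [k /(_ x)[F dx]] := sub_frame_exists bS.
exists (\sum_i cinf_cst M (sf_c F i v) *: sf_e F i).
  by apply: gsect_in_sum => // i; exact: sf_in.
rewrite gsect_sumE [RHS](sf_expand dx Sv); exact: eq_bigr.
Qed.

(** Brackets accept global sections only. Multiplied by psi, a section has a global expansion in the
    frame, with an unchanged germ at x0. *)
Lemma sf_cutoff k (F : sub_frame S k) x0 : sf_dom F x0 ->
  exists (psi : cinf M) U, [/\ open U, U x0, U `<=` sf_dom F, forall x, U x -> psi x = 1
    & forall s, gsect_in S s ->
        exists2 f : 'I_k -> cinf M, psi *: s = \sum_i f i *: sf_e F i &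
          forall i x, f i x = psi x * sf_c F i (s x)].
Proof.
move=> dx; have [psi [U [K [[oU Ux Ud p1] [cK Kd p0]]]]] := bump (sf_open F) dx.
exists psi, U; split => // s Ss.
have sf i := msmooth_cutoff (sf_open F) cK Kd p0
  (sf_smooth i (sf_open F) (@subset_refl _ _) (vlocal_sect s _ lV)).
have fP i : (fun x => psi x * sf_c F i (s x)) \in @msmooth_pred _ _ M.
  by apply/msmooth_predP; exact: sf.
exists (fun i => Cinf (fP i)) => //.
apply: gsect_ext => x; rewrite gsect_sumE gsect_scaleE.
have [/Kd Kx|/p0 px] := pselect (K x); last first.
  rewrite px scale0r big1// => i _; rewrite gsect_scaleE /= px mul0r scale0r//.
rewrite {1}(sf_expand Kx (Ss x)) scaler_sumr; apply: eq_bigr => i _.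
by rewrite scalerA gsect_scaleE.
Qed.

(** If B holds the coordinates of b in the old frame and X the values of the dual functionals of b
    on that frame, then B X = 1. The matrices are square, so X B = 1, which says that b spans S. *)
Lemma sub_frame_of k (F : sub_frame S k) x0 (b : 'I_k -> gsect V) : sf_dom F x0 ->
  (forall i, gsect_in S (b i)) -> independent (fun i => b i x0) ->
  exists2 G : sub_frame S k, sf_dom G x0 & sf_e G = b.
Proof.
move=> dx Sb ib; have [F0 F0x] := frames x0.
have [U [C [[oU Ux _] Cl Cd Cs]]] :=
  dual_functionals (e := fun i => b i) lV openT Logic.I F0x (fun i => gsect_smooth (b i)) ib.
have oUd : open (U `&` sf_dom F) by apply: openI => //; exact: sf_open.
unshelve eexists (@SubFrame V S k (U `&` sf_dom F) b C oUd Sb _ Cl _ _) => //.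
- move=> x [U'x dx'].
  pose B : 'M[R]_k := \matrix_(i, j) sf_c F j (b i x).
  pose X : 'M[R]_k := \matrix_(i, j) C j x (sf_e F i x).
  have BX : B *m X = 1%:M.
    apply/matrixP => i j; rewrite !mxE eq_sym -(Cd _ _ _ U'x).
    rewrite (sf_expand dx' (Sb i x)) (functional_sum _ _ _ (Cl j x)).
    by apply: eq_bigr => l _; rewrite !mxE.
  have XB := mulmx1C BX.
  have aE i : sf_e F i x = \sum_j X i j *: b j x.
    under eq_bigr do rewrite (sf_expand dx' (Sb _ x)) scaler_sumr.
    rewrite exchange_big /= (bigD1 i)//= [X in _ + X]big1 ?addr0 => [|l li].
      under eq_bigr do rewrite scalerA.
      rewrite -scaler_suml; have := congr1 (fun A : 'M_k => A i i) XB.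
      rewrite !mxE eqxx => E; rewrite -[LHS]scale1r -[X in X *: _]E.
      by congr (_ *: _); apply: eq_bigr => j _; rewrite [X in _ * X = _]mxE.
    under eq_bigr do rewrite scalerA.
    rewrite -scaler_suml; have := congr1 (fun A : 'M_k => A i l) XB.
    rewrite !mxE eq_sym (negPf li) => E; rewrite -[RHS](scale0r (sf_e F l x)) -[X in _ = X *: _]E.
    by congr (_ *: _); apply: eq_bigr => j _; rewrite [X in _ = _ * X]mxE.
  split=> [v|c c0 i].
    split=> [Sv|[c ->]]; last first.
      suff H s : S (\sum_(i <- s) c i *: b i x) by exact: H.
      elim: s => [|i s ih]; rewrite ?big_nil ?big_cons.
        exact: basis0 (sf_basis dx').
      by apply: basis_lin (sf_basis dx') _ ih; exact: Sb.
    exists (fun j => \sum_i sf_c F i v * X i j).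
    rewrite {1}(sf_expand dx' Sv).
    under eq_bigr do rewrite aE scaler_sumr.
    rewrite exchange_big /=; apply: eq_bigr => j _; rewrite scaler_suml.
    by apply: eq_bigr => i _; rewrite scalerA.
  have := functional_sum (index_enum 'I_k) c (fun j => b j x) (Cl i x).
  rewrite c0; have := Cl i x 1 0 0; rewrite scaler0 addr0 mul1r => /eqP.
  rewrite -subr_eq subrr => /eqP <-.
  rewrite (bigD1 i)//= Cd// eqxx mulr1 big1 ?addr0// => j.
  by rewrite Cd// eq_sym => /negPf ->; rewrite mulr0.
- by move=> i j x [U'x _]; exact: Cd.
- by move=> i W s oW WU; apply: Cs => // y /WU[].
Qed.

End subbundle.

Lemma subbundle_intro (V : vfamily M) (S : forall x, set (V x)) (J : finType) :
  (forall x0, exists U (e : J -> forall x, V x),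
    [/\ open U, U x0, forall j, vsmooth U (e j) & forall x, U x ->
      (forall v, S x v <-> exists c : J -> R, v = \sum_j c j *: e j x) /\
      (forall c : J -> R, \sum_j c j *: e j x = 0 -> forall j, c j = 0)]) ->
  is_subbundle S.
Proof.
move=> H; exists #|J| => x0; have [U [e [oU Ux se be]]] := H x0.
exists U, (fun i => e (enum_val i)); split => // x /be[b1 b2].
have E (V' : nmodType) (F : J -> V') : \sum_(i < #|J|) F (enum_val i) = \sum_j F j.
  rewrite [RHS](reindex (fun i : 'I_#|J| => enum_val i))//.
  by exists enum_rank => i _; [exact: enum_valK|exact: enum_rankK].
split=> [v|c c0 i].
  rewrite b1; split=> -[c ->].
    by exists (fun i => c (enum_val i)); rewrite (E _ (fun j => c j *: e j x)).
  exists (fun j => c (enum_rank j)).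
  by rewrite -E; apply: eq_bigr => i _; rewrite enum_valK.
have := b2 (fun j => c (enum_rank j)); rewrite -E.
under eq_bigr do rewrite enum_valK.
by move=> /(_ c0)/(_ (enum_val i)); rewrite enum_valK.
Qed.

End local_frames.

(* These hold by computation, but chaining them is much faster than computing with
   the module structure of the omni-Lie algebroid in one go. *)
Section linearity.
Variables (R : realType) (n r : nat) (M : manifold R n) (E : vbundle M r).
Variables (x : M) (a : R).

Lemma omni_fst (X X' : omni E x) : (a *: X + X').1 = a *: X.1 + X'.1 :> DE E x.
Proof. reflexivity. Qed.

Lemma omni_snd (X X' : omni E x) : (a *: X + X').2 = a *: X.2 + X'.2 :> JE E x.
Proof. reflexivity. Qed.

Lemma jet_linE (mu nu : JE E x) d :
  ((a *: mu + nu : JE E x) : jet E x) d = a *: (mu : jet E x) d + (nu : jet E x) d.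
Proof. reflexivity. Qed.

Lemma gauge_linE (d e : DE E x) u :
  gauge_op (a *: d + e : DE E x) u = a *: gauge_op d u + gauge_op e u.
Proof. reflexivity. Qed.

Lemma symbol_linE (d e : DE E x) :
  symbol (a *: d + e : DE E x) = a *: symbol d + symbol e.
Proof. reflexivity. Qed.

Lemma bmap_lin (X X' : omni E x) : bmap (a *: X + X') = a *: bmap X + bmap X'.
Proof. by rewrite /bmap omni_fst omni_snd symbol_linE /jproj jet_linE. Qed.

End linearity.

(** * Frames of T and of the omni-Lie algebroid *)

Section frames_of_omni.
Variables (R : realType) (n r : nat) (M : manifold R n) (E : vbundle M r).
Implicit Types (f g : cinf M) (x : M).

Section with_data.
Variable D : frame_data E.

Definition tco (q : 'I_n + 'I_r) x (z : Tfam E x) : R :=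
  match q with inl i => (z.1 : tangent x) (fd_Y D i) | inr k => fd_kap D k z.2 end.

Definition tframe (q : 'I_n + 'I_r) : gsect (Tfam E) :=
  match q with inl i => gpair (fd_P D i) 0 | inr k => gpair 0 (fd_eps D k) end.

Lemma tco_lin q x (a : R) (v w : Tfam E x) : tco q (a *: v + w) = a * tco q v + tco q w.
Proof.
by case: q => [i|k] /=; [|exact: fd_kap_lin].
Qed.

Lemma tco_dual q q' x : fd_dom D x -> tco q (tframe q' x) = (q == q')%:R.
Proof.
move=> dx; case: q q' => [i|k] [j|l] /=.
- by rewrite fd_dual// (inj_eq (@inl_inj _ _)) eq_sym.
- by [].
- exact: kap_0.
- by rewrite fd_kap_eps// (inj_eq (@inr_inj _ _)).
Qed.

Lemma tco_inj x (v w : Tfam E x) : fd_dom D x -> (forall q, tco q v = tco q w) -> v = w.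
Proof.
case: v w => [v1 v2] [w1 w2] dx vw; congr pair.
  rewrite (fd_tangent v1 dx) (fd_tangent w1 dx); apply: eq_bigr => i _; congr (_ *: _).
  exact: (vw (inl i)).
by apply: kap_inj dx _ => k; exact: (vw (inr k)).
Qed.

Lemma dual_span (V : lmodType R) (I : finType) (c : I -> V -> R) (e : I -> V) v :
  (forall i (a : R) v w, c i (a *: v + w) = a * c i v + c i w) ->
  (forall i j, c i (e j) = (i == j)%:R) ->
  (forall v w, (forall i, c i v = c i w) -> v = w) -> v = \sum_i c i v *: e i.
Proof.
move=> cl cd ci; apply: ci => i; rewrite (functional_sum _ _ _ (cl i)) (bigD1 i)//=.
rewrite cd eqxx mulr1 big1 ?addr0// => j.
by rewrite cd eq_sym => /negPf ->; rewrite mulr0.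
Qed.

Lemma tco_smooth q W (s : forall x, Tfam E x) : open W -> vsmooth W s ->
  msmooth W (fun x => tco q (s x)).
Proof. by move=> oW [s1 s2]; case: q => [i|k]; [exact: s1|exact: fd_kap_smooth]. Qed.

Definition tlframe : lframe (Tfam E) ('I_n + 'I_r)%type.
Proof.
apply: (@LFrame _ _ _ (Tfam E) _ (fd_dom D) tframe tco (fd_open D) tco_lin tco_dual).
- move=> x v dx; apply: (@dual_span _ _ (fun q => @tco q x) (fun q => tframe q x)).
  + by move=> *; exact: tco_lin.
  + by move=> i j; exact: tco_dual.
  + by move=> v' w'; exact: tco_inj.
- exact: tco_smooth.
Defined.

(* Together with b(X), these values determine X. *)
Definition hco (q : 'I_n + 'I_r) x (X : omni E x) : E x :=
  match q with
  | inl i => (X.2 : jet E x) (conn D (fd_P D i x))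
  | inr k => gauge_op X.1 (fd_eps D k)
  end.

Lemma hco_lin q x (a : R) (X X' : omni E x) : hco q (a *: X + X') = a *: hco q X + hco q X'.
Proof.
case: q => [i|k]; rewrite /hco; first by rewrite omni_snd jet_linE.
by rewrite omni_fst gauge_linE.
Qed.

Lemma pairing_frame x (X X' : omni E x) : fd_dom D x ->
  (X'.2 : jet E x) X.1 + (X.2 : jet E x) X'.1 =
  \sum_q (tco q (bmap X) *: hco q X' + tco q (bmap X') *: hco q X).
Proof.
move=> dx; rewrite !(jet_frame _ _ dx) big_sumType /= !big_split /=.
by rewrite addrACA [X in _ + X]addrC addrACA.
Qed.

Definition oco (j : ('I_n + 'I_r) + ('I_n + 'I_r) * 'I_r) x (X : omni E x) : R :=
  match j with
  | inl q => tco q (bmap X)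
  | inr p => fd_kap D p.2 (hco p.1 X)
  end.

(** Over [fd_dom], the sections with index [inl] lift the frame of T, and those with index [inr]
    form a basis of the kernel Hom(T, E) of b: the dY_i tensor eps_l, written as differences of
    jets, and the kap_k tensor eps_l. *)
Definition oframe (j : ('I_n + 'I_r) + ('I_n + 'I_r) * 'I_r) : gsect (omni E) :=
  match j with
  | inl (inl i) => gpair (nabla D (fd_P D i)) 0
  | inl (inr k) => gpair 0 (jet_sec (fd_eps D k))
  | inr (inl i, l) => gpair 0 (jet_sec (fd_Y D i *: fd_eps D l) - fd_Y D i *: jet_sec (fd_eps D l))
  | inr (inr k, l) => gpair (vert_sec D k (fd_eps D l)) 0
  end.

Lemma oco_lin j x (a : R) (v w : omni E x) : oco j (a *: v + w) = a * oco j v + oco j w.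
Proof.
by case: j => [q|[q l]]; rewrite /oco ?bmap_lin ?tco_lin// hco_lin fd_kap_lin.
Qed.

Lemma oframe_bmap j x : fd_dom D x -> bmap (oframe j x) =
  match j with inl q => tframe q x | inr _ => 0 end.
Proof.
move=> dx; case: j => [[i|k]|[[i|k] l]]; rewrite /bmap /=.
- by rewrite conn_symbol fd_eta1// scale1r.
- by [].
- congr pair; rewrite /jproj.
  rewrite -[LHS]/((fd_Y D i x *: fd_eps D l x) - fd_Y D i x *: fd_eps D l x).
  exact: subrr.
- by [].
Qed.

Lemma oframe_hco j q x : fd_dom D x -> hco q (oframe j x) =
  match j with inl _ => 0 | inr p => (q == p.1)%:R *: fd_eps D p.2 x end.
Proof.
move=> dx; case: j q => [[i|k]|[[i|k] l]] [i'|k'] //=.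
- by rewrite conn_eps.
- by rewrite conn_eps.
- rewrite -[LHS]/(gauge_op (conn D (fd_P D i' x)) (fd_Y D i *: fd_eps D l) -
    fd_Y D i x *: gauge_op (conn D (fd_P D i' x)) (fd_eps D l)).
  rewrite gauge_leibniz conn_eps// scaler0 add0r subr0 conn_symbol fd_eta1// scale1r.
  by rewrite fd_dual// (inj_eq (@inl_inj _ _)).
- by rewrite scale0r.
- by rewrite scale0r.
- rewrite -[LHS]/(fd_kap D k (fd_eps D k' x) *: fd_eps D l x).
  by rewrite fd_kap_eps// (inj_eq (@inr_inj _ _)) eq_sym.
Qed.

Lemma oco_dual i j x : fd_dom D x -> oco i (oframe j x) = (i == j)%:R.
Proof.
move=> dx; case: i => [q|[q l]]; rewrite /oco.
  rewrite oframe_bmap//; case: j => [q'|p].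
    by rewrite tco_dual// (inj_eq (@inl_inj _ _)).
  have := tco_lin q 1 (0 : Tfam E x) 0; rewrite scaler0 addr0 mul1r => /eqP.
  by rewrite -subr_eq subrr => /eqP <-.
rewrite oframe_hco//; case: j => [q'|[q' l']]; first exact: kap_0.
rewrite kap_scale fd_kap_eps// (inj_eq (@inr_inj _ _)) xpair_eqE /=.
by case: (q == q'); case: (l == l'); rewrite ?mulr0 ?mul0r ?mulr1.
Qed.

Lemma hco_inj x (v w : omni E x) : fd_dom D x -> bmap v = bmap w ->
  (forall q, hco q v = hco q w) -> v = w.
Proof.
case: v w => [d mu] [e nu] dx [sde pmn] vw; congr pair.
  apply: gauge_ext => // u; rewrite !(gauge_op_frame _ u dx); apply: eq_bigr => k _.
  by have /= -> := vw (inr k); rewrite sde.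
apply: jet_ext => d'; rewrite !(jet_frame _ _ dx) pmn; congr (_ + _).
by apply: eq_bigr => i _; have /= -> := vw (inl i).
Qed.

Lemma oco_inj x (v w : omni E x) : fd_dom D x -> (forall j, oco j v = oco j w) -> v = w.
Proof.
move=> dx vw; apply: hco_inj => // [|q].
  by apply: tco_inj => // q; exact: (vw (inl q)).
by apply: kap_inj dx _ => l; exact: (vw (inr (q, l))).
Qed.

Lemma bmap_smooth W (s : forall x, omni E x) : vsmooth W s ->
  @vsmooth _ _ _ (Tfam E) W (fun x => bmap (s x)).
Proof.
move=> [[_ s1] s2]; split; first exact: s1.
exact: (s2 (@Gam _ _ _ (DE E) _ (gauge_id_smooth E))).
Qed.

Lemma hco_smooth q W (s : forall x, omni E x) : vsmooth W s ->
  vsmooth W (fun x => hco q (s x)).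
Proof.
move=> [[s0 s1] s2]; case: q => [i|k]; last exact: s0.
exact: (s2 (nabla D (fd_P D i))).
Qed.

Lemma oco_smooth j W (s : forall x, omni E x) : open W -> vsmooth W s ->
  msmooth W (fun x => oco j (s x)).
Proof.
move=> oW ss; case: j => [q|[q l]] /=.
  by apply: tco_smooth => //; exact: bmap_smooth.
by apply: fd_kap_smooth => //; exact: hco_smooth.
Qed.

Definition olframe : lframe (omni E) (('I_n + 'I_r) + ('I_n + 'I_r) * 'I_r)%type.
Proof.
apply: (@LFrame _ _ _ (omni E) _ (fd_dom D) oframe oco (fd_open D) oco_lin oco_dual).
- move=> x v dx; apply: (@dual_span _ _ (fun q => @oco q x) (fun q => oframe q x)).
  + by move=> *; exact: oco_lin.
  + by move=> i j; exact: oco_dual.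
  + by move=> v' w'; exact: oco_inj.
- exact: oco_smooth.
Defined.

End with_data.

Lemma Tfam_frames x : exists F : lframe (Tfam E) ('I_n + 'I_r)%type, lf_dom F x.
Proof. by have [D dx] := frame_data_exists E x; exists (tlframe D). Qed.

Lemma omni_frames x :
  exists F : lframe (omni E) (('I_n + 'I_r) + ('I_n + 'I_r) * 'I_r)%type, lf_dom F x.
Proof. by have [D dx] := frame_data_exists E x; exists (olframe D). Qed.

End frames_of_omni.

(** * The image of the omni-Lie bracket under b *)

Section bracket.
Variables (R : realType) (n r : nat) (M : manifold R n) (E : vbundle M r).
Implicit Types (f g : cinf M) (x : M) (X Y Z : gsect (omni E)).

Lemma gsect_pair_ext (V V' : vfamily M) (s t : gsect (vsum V V')) :
  gfst s = gfst t -> gsnd s = gsnd t -> s = t.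
Proof.
move=> st1 st2; apply: gsect_ext => x.
have := congr1 (fun s : gsect V => s x) st1; have := congr1 (fun s : gsect V' => s x) st2.
by rewrite /=; case: (s x) (t x) => [? ?] [? ?] /= -> ->.
Qed.

Lemma bsec_lin f X Y : bsec (f *: X + Y) = f *: bsec X + bsec Y.
Proof. by apply: gsect_ext => x; exact: bmap_lin. Qed.

Lemma bsec0 : bsec (0 : gsect (omni E)) = 0.
Proof.
have := bsec_lin 1 (0 : gsect (omni E)) 0; rewrite scaler0 addr0 scale1r => /eqP.
by rewrite -subr_eq subrr => /eqP <-.
Qed.

Lemma bsecD X Y : bsec (X + Y) = bsec X + bsec Y.
Proof. by have := bsec_lin 1 X Y; rewrite !scale1r. Qed.

Lemma bsecZ f X : bsec (f *: X) = f *: bsec X.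
Proof. by have := bsec_lin f X 0; rewrite bsec0 !addr0. Qed.

Lemma bsecN X : bsec (- X) = - bsec X.
Proof. by rewrite -scaleN1r bsecZ scaleN1r. Qed.

Lemma bsec_sum (I : Type) (s : seq I) (f : I -> cinf M) (F : I -> gsect (omni E)) :
  bsec (\sum_(i <- s) f i *: F i) = \sum_(i <- s) f i *: bsec (F i).
Proof.
elim: s => [|i s ih]; last by rewrite !big_cons bsec_lin ih.
by rewrite !big_nil bsec0.
Qed.

Lemma vbrE (P Q : gsect (TM M)) x f :
  vbr P Q x f = P x (vapp Q f) - Q x (vapp P f) :> R.
Proof. by []. Qed.

(** The identity of E commutes with every gauge operator, so that the bracket term of the Lie
    derivative disappears when paired with it. *)
Lemma jproj_lie_der (d : gsect (DE E)) (nu : gsect (JE E)) x :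
  jproj (lie_der d nu x) = gauge_op (d x) (jpair nu (@Gam _ _ _ (DE E) _ (gauge_id_smooth E))).
Proof.
set i := @Gam _ _ _ (DE E) _ _.
have := congr1 (fun u : gsect E => u x) (lie_derP d nu i).
rewrite gsect_addE gsect_oppE /= => H; rewrite /jproj H.
rewrite (_ : gbr_at d i x = 0) ?jet0 ?subr0//.
apply: gauge_ext => [u|].
  have := gbrE d i x u; rewrite /= => ->.
  rewrite gauge_op0l; apply/eqP; rewrite subr_eq0; apply/eqP.
  by congr (gauge_op _ _); exact: gsect_ext.
apply: tangent_ext => f; rewrite [LHS]vbrE.
rewrite (_ : vapp (anchor i) f = 0) ?tangent0; last exact: cinf_ext.
by rewrite sub0r -[LHS]/(- (0 : R)) oppr0.
Qed.

Lemma gfst_bsec X : gfst (bsec X) = anchor (gfst X).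
Proof. apply: gsect_ext => x. reflexivity. Qed.

Lemma bbr_fst X Y : gfst (bsec (omni_br X Y)) = vbr (gfst (bsec X)) (gfst (bsec Y)).
Proof. by rewrite !gfst_bsec; exact: gsect_ext. Qed.

Lemma bbr_snd X Y : gsnd (bsec (omni_br X Y)) =
  dapp (gfst X) (gsnd (bsec Y)) - dapp (gfst Y) (gsnd (bsec X)) + jpair (gsnd X) (gfst Y).
Proof.
apply: gsect_ext => x; rewrite gsect_addE gsect_addE gsect_oppE.
rewrite -[LHS]/(jproj (lie_der (gfst X) (gsnd Y) x) - jproj (lie_der (gfst Y) (gsnd X) x)
  + jpair (gsnd X) (gfst Y) x).
rewrite !jproj_lie_der /=; congr (gauge_op _ _ - gauge_op _ _ + _); exact: gsect_ext.
Qed.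

Lemma omni_form0 x (X Y : omni E x) : omni_form X Y = 0 <->
  (Y.2 : jet E x) X.1 + (X.2 : jet E x) Y.1 = 0.
Proof.
rewrite /omni_form; split=> [/eqP|->]; last exact: scaler0.
by rewrite scaler_eq0 invr_eq0 pnatr_eq0 /= => /eqP.
Qed.

End bracket.

(** * From Dirac structures to projective Lie algebroids *)

Section vector_fields.
Variables (R : realType) (n : nat) (M : manifold R n).
Implicit Types (P Q S : gsect (TM M)) (f g : cinf M).

Lemma vapp_vbr P Q f : vapp (vbr P Q) f = vapp P (vapp Q f) - vapp Q (vapp P f).
Proof. exact: cinf_ext. Qed.

Lemma gsect_tangent_addE P Q x f : (P + Q) x f = P x f + Q x f :> R.
Proof. by []. Qed.

Lemma gsect_tangent_scaleE g P x f : (g *: P) x f = g x * P x f :> R.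
Proof. by []. Qed.

Lemma gsect_tangent_oppE P x f : (- P) x f = - P x f :> R.
Proof. by []. Qed.

Lemma vapp_lin g P Q f : vapp (g *: P + Q) f = g * vapp P f + vapp Q f.
Proof. exact: cinf_ext. Qed.

Lemma vbr_skew P Q : vbr P Q = - vbr Q P.
Proof.
apply: gsect_ext => x; apply: tangent_ext => f.
by rewrite gsect_tangent_oppE !vbrE opprB.
Qed.

Lemma vbr_leibniz P Q f : vbr P (f *: Q) = f *: vbr P Q + vapp P f *: Q.
Proof.
apply: gsect_ext => x; apply: tangent_ext => g.
rewrite gsect_tangent_addE !gsect_tangent_scaleE !vbrE.
have -> : vapp (f *: Q) g = f * vapp Q g.
  by have := vapp_lin f Q 0 g; rewrite addr0 => ->; apply: cinf_ext => y; exact: addr0.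
rewrite gsect_tangent_scaleE tangent_leibniz.
have -> : P x f = vapp P f x by [].
have -> : vapp Q g x = Q x g by [].
ring.
Qed.

Lemma vbrDr P Q S : vbr P (Q + S) = vbr P Q + vbr P S.
Proof.
apply: gsect_ext => x; apply: tangent_ext => g.
rewrite gsect_tangent_addE !vbrE.
have -> : vapp (Q + S) g = vapp Q g + vapp S g by exact: cinf_ext.
rewrite tangentD gsect_tangent_addE; ring.
Qed.

Lemma vbr_jacobi P Q S : vbr P (vbr Q S) + vbr Q (vbr S P) + vbr S (vbr P Q) = 0.
Proof.
apply: gsect_ext => x; apply: tangent_ext => f.
rewrite !gsect_tangent_addE !vbrE !vapp_vbr !tangentB -[RHS]/(0 : R); ring.
Qed.

End vector_fields.

(** * Skewness and locality of the bracket of a projective Lie algebroid *)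

Section proj_lie_algebroid_theory.
Variables (R : realType) (n r : nat) (M : manifold R n) (E : vbundle M r).
Variables (A : forall x, set (Tfam E x)) (br : gsect (Tfam E) -> gsect (Tfam E) -> gsect (Tfam E)).
Hypothesis pA : proj_lie_algebroid A br.
Implicit Types (a b c : gsect (Tfam E)) (f : cinf M).

Let bA : is_subbundle A. Proof. exact: pla_subbundle pA. Qed.

Lemma cinf_cst1 : cinf_cst M 1 = 1.
Proof. exact: cinf_ext. Qed.

Lemma pla_addl a a' b : gsect_in A a -> gsect_in A a' -> gsect_in A b ->
  br (a + a') b = br a b + br a' b.
Proof.
by move=> Aa Aa' Ab; have := pla_linl pA 1 Aa Aa' Ab; rewrite cinf_cst1 !scale1r.
Qed.

Lemma pla_addr a b b' : gsect_in A a -> gsect_in A b -> gsect_in A b' ->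
  br a (b + b') = br a b + br a b'.
Proof.
by move=> Aa Ab Ab'; have := pla_linr pA 1 Aa Ab Ab'; rewrite cinf_cst1 !scale1r.
Qed.

Lemma pla_skew a b : gsect_in A a -> gsect_in A b -> br a b = - br b a.
Proof.
move=> Aa Ab; have Aab := gsect_inD bA Aa Ab.
have := pla_alt pA Aab; rewrite pla_addl// !pla_addr//.
by rewrite !(pla_alt pA)// add0r addr0 => /eqP; rewrite addr_eq0 => /eqP.
Qed.

Lemma pla_leibnizl a b f : gsect_in A a -> gsect_in A b ->
  br (f *: a) b = f *: br a b - vapp (gfst b) f *: a.
Proof.
move=> Aa Ab; rewrite pla_skew//; last exact: gsect_inZ.
by rewrite (pla_leibniz pA)// opprD (pla_skew Ab Aa) scalerN opprK.
Qed.

Lemma pla0r a : gsect_in A a -> br a 0 = 0.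
Proof.
move=> Aa; have A0 := gsect_in0 bA.
have := pla_addr Aa A0 A0; rewrite addr0 => /eqP.
by rewrite -subr_eq subrr => /eqP <-.
Qed.

Lemma pla_sumr (I : Type) (s : seq I) a (f : I -> cinf M) (b : I -> gsect (Tfam E)) :
  gsect_in A a -> (forall i, gsect_in A (b i)) ->
  br a (\sum_(i <- s) f i *: b i) =
  \sum_(i <- s) (f i *: br a (b i) + vapp (gfst a) (f i) *: b i).
Proof.
move=> Aa Ab; elim: s => [|i s ih]; rewrite ?big_nil ?big_cons; first exact: pla0r.
rewrite pla_addr ?ih ?(pla_leibniz pA)//; first exact: gsect_inZ.
exact: gsect_in_sum.
Qed.

(** The Leibniz terms vanish at x, because a tangent vector at x kills functions that are constant
    near x. *)
Lemma pla_cutoff a b f (g : cinf M) V x : gsect_in A a -> gsect_in A b ->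
  open V -> V x -> (forall y, V y -> f y = 1) -> (forall y, V y -> g y = 1) ->
  br (f *: a) (g *: b) x = br a b x.
Proof.
move=> Aa Ab oV Vx f1 g1; have Afa := gsect_inZ f bA Aa.
have z (v : tangent x) (h : cinf M) : (forall y, V y -> h y = 1) -> v h = 0 :> R.
  by move=> h1; rewrite (tangent_local v (g := 1) oV Vx) ?tangent1.
rewrite (pla_leibniz pA)// pla_leibnizl// !(gsect_addE, gsect_oppE, gsect_scaleE).
rewrite f1// g1// !scale1r.
have -> : vapp (gfst b) f x = 0 by exact: z.
have -> : vapp (gfst (f *: a)) g x = 0 by exact: z.
by rewrite !scale0r subr0 addr0.
Qed.

End proj_lie_algebroid_theory.

(** * The bracket induced on b(L) *)

Section from_dirac.
Variables (R : realType) (n r : nat) (M : manifold R n) (E : vbundle M r).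
Implicit Types (f g : cinf M) (x : M).

(** Turns an identity in the fibre into a scalar one, within reach of [ring] and [lra]; the
    coordinates of a local frame are enough functionals. *)
Lemma fibre_eqP x (v w : E x) :
  (forall phi : E x -> R, (forall u u', phi (u + u') = phi u + phi u') ->
     (forall u, phi (- u) = - phi u) -> (forall a u, phi (a *: u) = a * phi u) ->
     phi v = phi w) -> v = w.
Proof.
move=> H; have [D dx] := frame_data_exists E x; apply: kap_inj dx _ => k.
apply: H; [exact: kap_add| |exact: kap_scale].
by move=> u; rewrite -scaleN1r kap_scale mulN1r.
Qed.

Definition bbr (X Y : gsect (omni E)) : gsect (Tfam E) := bsec (omni_br X Y).

Lemma bbr_sndE X Y x : gsnd (bbr X Y) x =
  gauge_op (gfst X x) (gsnd (bsec Y)) - gauge_op (gfst Y x) (gsnd (bsec X))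
    + jpair (gsnd X) (gfst Y) x.
Proof. by rewrite /bbr bbr_snd. Qed.

Lemma bbr_leibniz X Y f : bbr X (f *: Y) = f *: bbr X Y + vapp (gfst (bsec X)) f *: bsec Y.
Proof.
apply: gsect_pair_ext.
  have -> : gfst (f *: bbr X Y + vapp (gfst (bsec X)) f *: bsec Y) =
    f *: gfst (bbr X Y) + vapp (gfst (bsec X)) f *: gfst (bsec Y) by exact: gsect_ext.
  rewrite /bbr !bbr_fst bsecZ -vbr_leibniz; congr vbr; exact: gsect_ext.
apply: gsect_ext => x.
rewrite -[RHS]/(f x *: gsnd (bbr X Y) x + vapp (gfst (bsec X)) f x *: gsnd (bsec Y) x).
rewrite !bbr_sndE bsecZ.
have -> : gsnd (f *: bsec Y) = f *: gsnd (bsec Y) by exact: gsect_ext.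
have -> : gfst (f *: Y) = f *: gfst Y by exact: gsect_ext.
rewrite gauge_leibniz gsect_scaleE gauge_opZl.
have -> : jpair (gsnd X) (f *: gfst Y) x = f x *: jpair (gsnd X) (gfst Y) x.
  exact: jetZ.
have -> : symbol (gfst X x) f = vapp (gfst (bsec X)) f x by [].
apply: fibre_eqP => phi pD pN pZ; rewrite !(pD, pN, pZ); ring.
Qed.

Lemma bbrDr X Y Z : bbr X (Y + Z) = bbr X Y + bbr X Z.
Proof.
apply: gsect_pair_ext.
  have -> : gfst (bbr X Y + bbr X Z) = gfst (bbr X Y) + gfst (bbr X Z) by exact: gsect_ext.
  rewrite /bbr !bbr_fst bsecD -vbrDr; congr vbr; exact: gsect_ext.
apply: gsect_ext => x.
rewrite -[RHS]/(gsnd (bbr X Y) x + gsnd (bbr X Z) x) !bbr_sndE bsecD.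
have -> : gsnd (bsec Y + bsec Z) = gsnd (bsec Y) + gsnd (bsec Z) by exact: gsect_ext.
have -> : gfst (Y + Z) = gfst Y + gfst Z by exact: gsect_ext.
rewrite gauge_opD gsect_addE gauge_opDl.
have -> : jpair (gsnd X) (gfst Y + gfst Z) x =
    jpair (gsnd X) (gfst Y) x + jpair (gsnd X) (gfst Z) x.
  exact: jetD.
apply: fibre_eqP => phi pD pN pZ; rewrite !(pD, pN, pZ); ring.
Qed.

Variable L : forall x, set (omni E x).
Hypothesis dL : dirac L.

Let bL : is_subbundle L. Proof. by have [] := dL. Qed.

Lemma dirac_isotropic x (X Y : omni E x) : L X -> L Y ->
  (Y.2 : jet E x) X.1 + (X.2 : jet E x) Y.1 = 0.
Proof.
move=> LX LY; have [_ Lo _] := dL; apply/omni_form0.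
by move: LX; rewrite Lo => /(_ _ LY).
Qed.

Lemma dirac_closed X Y : gsect_in L X -> gsect_in L Y -> gsect_in L (omni_br X Y).
Proof. by have [_ _] := dL; apply. Qed.

Lemma dirac_pair X Y : gsect_in L X -> gsect_in L Y ->
  jpair (gsnd Y) (gfst X) = - jpair (gsnd X) (gfst Y).
Proof.
move=> LX LY; apply: gsect_ext => x; apply/eqP; rewrite gsect_oppE -addr_eq0; apply/eqP.
exact: dirac_isotropic (LX x) (LY x).
Qed.

Lemma bbr_skew X Y : gsect_in L X -> gsect_in L Y -> bbr X Y = - bbr Y X.
Proof.
move=> LX LY; apply: gsect_pair_ext.
  have -> : gfst (- bbr Y X) = - gfst (bbr Y X) by exact: gsect_ext.
  by rewrite /bbr !bbr_fst -vbr_skew.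
apply: gsect_ext => x; rewrite -[RHS]/(- gsnd (bbr Y X) x) !bbr_sndE (dirac_pair LX LY).
rewrite gsect_oppE; apply: fibre_eqP => phi pD pN pZ; rewrite !(pD, pN, pZ); ring.
Qed.

Lemma bbr_eq0 X Y V x : gsect_in L X -> gsect_in L Y -> open V -> V x ->
  (forall y, V y -> bsec X y = 0) -> bbr X Y x = 0.
Proof.
move=> LX LY oV Vx X0.
have s0 y : V y -> symbol (gfst X y) = 0.
  by move=> /X0 h; have := congr1 fst h.
have u0 y : V y -> gsnd (bsec X) y = 0.
  by move=> /X0 h; have := congr1 snd h.
rewrite [bbr X Y x]surjective_pairing; congr pair.
  rewrite -[LHS]/(gfst (bbr X Y) x) /bbr bbr_fst; apply: tangent_ext => f; rewrite vbrE.
  have -> : gfst (bsec X) x = 0 by exact: s0.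
  rewrite (tangent_local (gfst (bsec Y) x) (g := 0) oV Vx) ?tangent0 ?subr0// => y Vy.
  by rewrite -[LHS]/(symbol (gfst X y) f) s0.
rewrite -[LHS]/(gsnd (bbr X Y) x) bbr_sndE.
rewrite (gauge_local (gfst Y x) (w := 0) oV Vx); last exact: u0.
(* As d is vertical, d v depends only on v(x) = p(nu)(x) and equals <nu, d>; isotropy cancels it
   against <mu, e>. *)
rewrite gauge_op0 subr0 -(@jet_vertical _ _ _ _ _ x (gsnd Y x))//; last exact: s0.
exact: dirac_isotropic (LX x) (LY x).
Qed.

Lemma bbr_germ X X' Y Y' V x : gsect_in L X -> gsect_in L X' ->
  gsect_in L Y -> gsect_in L Y' -> open V -> V x ->
  (forall y, V y -> bsec X y = bsec X' y) -> (forall y, V y -> bsec Y y = bsec Y' y) ->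
  bbr X Y x = bbr X' Y' x.
Proof.
move=> LX LX' LY LY' oV Vx XX' YY'.
have sub Z Z' : gsect_in L Z -> gsect_in L Z' -> gsect_in L (Z - Z').
  move=> LZ LZ'; apply: gsect_inD => //; rewrite -scaleN1r; exact: gsect_inZ.
have z (Z Z' : gsect (omni E)) : (forall y, V y -> bsec Z y = bsec Z' y) -> forall y, V y -> bsec (Z - Z') y = 0.
  by move=> ZZ' y Vy; rewrite bsecD bsecN gsect_addE gsect_oppE ZZ'// subrr.
have YX : bbr Y X = bbr Y X' + bbr Y (X - X') by rewrite -bbrDr addrC subrK.
have XY : bbr X' Y = bbr X' Y' + bbr X' (Y - Y') by rewrite -bbrDr addrC subrK.
rewrite bbr_skew// YX opprD -!bbr_skew//; [|exact: sub..].
rewrite gsect_addE XY gsect_addE (bbr_skew LX' (sub _ _ LY LY')).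
rewrite gsect_oppE.
rewrite (bbr_eq0 (sub _ _ LX LX') LY oV Vx (z _ _ XX')).
by rewrite (bbr_eq0 (sub _ _ LY LY') LX' oV Vx (z _ _ YY')) oppr0 !addr0.
Qed.

Lemma bbr_jacobi X Y Z : gsect_in L X -> gsect_in L Y -> gsect_in L Z ->
  bbr X (omni_br Y Z) + bbr Y (omni_br Z X) + bbr Z (omni_br X Y) = 0.
Proof.
move=> LX LY LZ; apply: gsect_pair_ext.
  have -> : gfst (bbr X (omni_br Y Z) + bbr Y (omni_br Z X) + bbr Z (omni_br X Y)) =
    gfst (bbr X (omni_br Y Z)) + gfst (bbr Y (omni_br Z X)) + gfst (bbr Z (omni_br X Y)).
    exact: gsect_ext.
  by rewrite /bbr !bbr_fst vbr_jacobi; exact: gsect_ext.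
apply: gsect_ext => x.
rewrite -[LHS]/(gsnd (bbr X (omni_br Y Z)) x + gsnd (bbr Y (omni_br Z X)) x +
  gsnd (bbr Z (omni_br X Y)) x) -[RHS]/(0 : E x) !bbr_sndE !bbr_snd.
have gE U W : gfst (omni_br U W) = gbr (gfst U) (gfst W) by exact: gsect_ext.
rewrite !gE !gauge_opD !gauge_opN !gbrE.
(* Once the second-order terms have cancelled, the E-component of the Jacobi identity is this very
   relation, up to the skewness of the pairing of X with Z. *)
have := dirac_isotropic (dirac_closed LX LY x) (LZ x).
set d := gfst X; set e := gfst Y; set s := gfst Z.
set mu := gsnd X; set nu := gsnd Y; set ka := gsnd Z.
have -> : ((omni_br X Y x).2 : jet E x) (Z x).1 =
    (jpair (lie_der d nu) s - jpair (lie_der e mu) s + jpair (jet_sec (jpair mu e)) s) x.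
  by [].
rewrite !lie_derP.
have -> : jpair (jet_sec (jpair mu e)) s = dapp s (jpair mu e) by exact: gsect_ext.
rewrite (_ : jpair mu s = - jpair ka d); last by rewrite (dirac_pair LX LZ) opprK.
rewrite !(gsect_addE, gsect_oppE).
have -> : gbr s d = - gbr d s.
  apply: gsect_ext => y; apply: gauge_ext => [u|]; rewrite gsect_oppE.
    by rewrite gauge_opNl !gbrE opprB.
  by have := congr1 (fun P : gsect (TM M) => P y) (vbr_skew (anchor s) (anchor d)).
have -> : jpair nu (- gbr d s) x = - jpair nu (gbr d s) x by exact: jetN.
have dE (a : gsect (DE E)) u : dapp a u x = gauge_op (a x) u by [].
rewrite !dE gauge_opN -[(Z x).2 : jet E x]/(ka x).
have -> : ((Z x).2 : jet E x) (omni_br X Y x).1 = jpair ka (gbr d e) x by [].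
move=> H; apply: fibre_eqP => phi pD pN pZ; move/(congr1 phi): H; rewrite !(pD, pN).
have -> : phi 0 = 0 by have := pZ 0 0; rewrite scale0r mul0r.
lra.
Qed.

Hypothesis rL : reducible L.

(* Near x there is a frame of b(L) made of images of sections of L. *)
Lemma dirac_lift a x : gsect_in (bimage L) a -> exists X (psi : cinf M) V,
  [/\ gsect_in L X, open V, V x, forall y, V y -> psi y = 1 & bsec X = psi *: a].
Proof.
move=> Aa.
have lT := @vlocal_Tfam _ _ M _ E; have fT := @Tfam_frames _ _ _ M E.
have [k /(_ x)[F Fx]] := sub_frame_exists lT fT rL.
have pre i : exists Z : gsect (omni E), gsect_in L Z /\ bsec Z x = sf_e F i x.
  have [v Lv vE] := sf_in F i x.
  have [Z LZ Zx] := subbundle_extend (@vlocal_omni _ _ M _ E) (@omni_frames _ _ _ M E) bL Lv.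
  by exists Z; split => //; rewrite -vE -Zx.
pose Z i := sval (cid (pre i)).
have LZ i : gsect_in L (Z i) by have [] := svalP (cid (pre i)).
have Zx i : bsec (Z i) x = sf_e F i x by have [] := svalP (cid (pre i)).
have [||G Gx GE] := @sub_frame_of _ _ _ _ _ lT fT _ _ F x (fun i => bsec (Z i)) Fx.
- by move=> i y; exists (Z i y) => //; exact: LZ.
- move=> c c0; apply: (sf_basis Fx).2; rewrite -[RHS]c0; apply: eq_bigr => i _.
  by rewrite Zx.
have [psi [V [oV Vx _ p1 sE]]] := sf_cutoff lT Gx.
have [f fE _] := sE _ Aa.
exists (\sum_i f i *: Z i), psi, V; split => //.
  exact: gsect_in_sum.
by rewrite bsec_sum fE GE.
Qed.

Lemma dirac_lift_germ a x : gsect_in (bimage L) a -> exists2 X, gsect_in L X &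
  exists2 V, open V /\ V x & forall y, V y -> bsec X y = a y.
Proof.
move=> /(@dirac_lift _ x)[X [psi [V [LX oV Vx p1 XE]]]]; exists X => //; exists V => // y Vy.
by rewrite XE gsect_scaleE p1// scale1r.
Qed.

(** Quantifying over all local lifts builds the independence of their choice into the notion, so
    that any convenient lifts may be taken later. *)
Definition represents (c a b : gsect (Tfam E)) := forall x X Y V,
  gsect_in L X -> gsect_in L Y -> open V -> V x ->
  (forall y, V y -> bsec X y = a y) -> (forall y, V y -> bsec Y y = b y) ->
  c x = bbr X Y x.

Lemma bracket_exists a b : exists c, gsect_in (bimage L) a -> gsect_in (bimage L) b ->
  represents c a b.
Proof.
have [[Aa Ab]|nab] := pselect (gsect_in (bimage L) a /\ gsect_in (bimage L) b); last first.
  by exists 0 => Aa Ab; case: nab.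
have la x := dirac_lift_germ x Aa; have lb x := dirac_lift_germ x Ab.
pose X x := s2val (cid2 (la x)); pose Y x := s2val (cid2 (lb x)).
have LX x : gsect_in L (X x) by exact: s2valP.
have LY x : gsect_in L (Y x) by exact: s2valP.
have XE x := s2valP' (cid2 (la x)); have YE x := s2valP' (cid2 (lb x)).
rewrite -/(X _) in XE; rewrite -/(Y _) in YE.
pose c x := bbr (X x) (Y x) x.
have cE : forall x X Y V, gsect_in L X -> gsect_in L Y -> open V -> V x ->
    (forall y, V y -> bsec X y = a y) -> (forall y, V y -> bsec Y y = b y) -> c x = bbr X Y x.
  move=> x X' Y' V LX' LY' oV Vx XE' YE'.
  have [V1 [oV1 V1x] XE1] := XE x; have [V2 [oV2 V2x] YE2] := YE x.
  apply: (@bbr_germ _ _ _ _ (V `&` (V1 `&` V2))) => //.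
  - by do 2 apply: openI => //.
  - by move=> y [Vy [V1y V2y]]; rewrite XE1// XE'.
  - by move=> y [Vy [V1y V2y]]; rewrite YE2// YE'.
have sc : vsmooth (v := Tfam E) setT c.
  apply: (@vlocal_Tfam _ _ M _ E) => x _.
  have [V1 [oV1 V1x] XE1] := XE x; have [V2 [oV2 V2x] YE2] := YE x.
  exists (V1 `&` V2), (bbr (X x) (Y x)); split => //.
  - exact: openI.
  - by apply: vlocal_sect; exact: vlocal_Tfam.
  - move=> y [V1y V2y]; apply/esym; apply: (cE y _ _ (V1 `&` V2)) => //.
    + exact: openI.
    + by move=> z [V1z _]; exact: XE1.
    + by move=> z [_ V2z]; exact: YE2.
by exists (Gam sc) => _ _.
Qed.

Lemma dirac_to_algebroid :
  exists br : gsect (Tfam E) -> gsect (Tfam E) -> gsect (Tfam E),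
    [/\ proj_lie_algebroid (bimage L) br, b_preserves L br
      & forall br' : gsect (Tfam E) -> gsect (Tfam E) -> gsect (Tfam E),
          proj_lie_algebroid (bimage L) br' -> b_preserves L br' ->
          forall a b, gsect_in (bimage L) a -> gsect_in (bimage L) b -> br' a b = br a b].
Proof.
pose br a b := sval (cid (bracket_exists a b)).
have brP a b : gsect_in (bimage L) a -> gsect_in (bimage L) b -> represents (br a b) a b.
  exact: (svalP (cid (bracket_exists a b))).
have LA X : gsect_in L X -> gsect_in (bimage L) (bsec X) by move=> LX y; exists (X y).
have pres : b_preserves L br.
  move=> X Y LX LY; apply: gsect_ext => x; apply/esym.
  by apply: (brP _ _ (LA _ LX) (LA _ LY) x X Y setT) => //; exact: openT.
have closed a b : gsect_in (bimage L) a -> gsect_in (bimage L) b -> gsect_in (bimage L) (br a b).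
  move=> Aa Ab x; have [X LX [V [oV Vx] XE]] := dirac_lift_germ x Aa.
  have [Y LY [V' [oV' V'x] YE]] := dirac_lift_germ x Ab.
  rewrite (brP _ _ Aa Ab x X Y (V `&` V')) => //.
  - by exists (omni_br X Y x) => //; exact: dirac_closed.
  - exact: openI.
  - by move=> y [/XE].
  - by move=> y [_ /YE].
(* Linearity is the case of constant f, the Leibniz rule that of b' = 0. *)
have lin_r a b b' f : gsect_in (bimage L) a -> gsect_in (bimage L) b -> gsect_in (bimage L) b' ->
    br a (f *: b + b') = f *: br a b + vapp (gfst a) f *: b + br a b'.
  move=> Aa Ab Ab'; have Abb' := gsect_in_lin f rL Ab Ab'.
  apply: gsect_ext => x.
  have [X LX [V [oV Vx] XE]] := dirac_lift_germ x Aa.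
  have [Y LY [V1 [oV1 V1x] YE]] := dirac_lift_germ x Ab.
  have [Y' LY' [V2 [oV2 V2x] YE']] := dirac_lift_germ x Ab'.
  have oW : open (V `&` (V1 `&` V2)) by do 2 apply: openI => //.
  have XE1 y : (V `&` (V1 `&` V2)) y -> bsec X y = a y by move=> [/XE].
  have YE1 y : (V `&` (V1 `&` V2)) y -> bsec Y y = b y by move=> [_ [/YE]].
  have YE1' y : (V `&` (V1 `&` V2)) y -> bsec Y' y = b' y by move=> [_ [_ /YE']].
  have Wx : (V `&` (V1 `&` V2)) x by [].
  rewrite (brP _ _ Aa Abb' x X (f *: Y + Y') _ LX (gsect_in_lin f bL LY LY') oW)//; last first.
    by move=> y Wy; rewrite bsec_lin !gsect_addE !gsect_scaleE YE1// YE1'.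
  rewrite !gsect_addE !gsect_scaleE (brP _ _ Aa Ab x X Y _ LX LY oW)//.
  rewrite (brP _ _ Aa Ab' x X Y' _ LX LY' oW)// bbrDr bbr_leibniz.
  rewrite !gsect_addE !gsect_scaleE YE1//.
  by rewrite -[vapp (gfst (bsec X)) f x]/((bsec X x).1 f) XE1.
have skew a b : gsect_in (bimage L) a -> gsect_in (bimage L) b -> br a b = - br b a.
  move=> Aa Ab; apply: gsect_ext => x.
  have [X LX [V [oV Vx] XE]] := dirac_lift_germ x Aa.
  have [Y LY [V1 [oV1 V1x] YE]] := dirac_lift_germ x Ab.
  have oW : open (V `&` V1) by apply: openI.
  have XE1 y : (V `&` V1) y -> bsec X y = a y by move=> [/XE].
  have YE1 y : (V `&` V1) y -> bsec Y y = b y by move=> [_ /YE].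
  have Wx : (V `&` V1) x by [].
  rewrite gsect_oppE (brP _ _ Aa Ab x X Y _ LX LY oW)// (brP _ _ Ab Aa x Y X _ LY LX oW)//.
  by rewrite bbr_skew.
have vcst (a : gsect (Tfam E)) k : vapp (gfst a) (cinf_cst M k) = 0.
  by apply: cinf_ext => x; exact: tangent_cst.
have pla : proj_lie_algebroid (bimage L) br.
  split => //.
  - move=> k a a' b Aa Aa' Ab; have Aaa' := gsect_in_lin (cinf_cst M k) rL Aa Aa'.
    rewrite skew// lin_r// vcst scale0r addr0 opprD -scalerN -!skew//.
  - by move=> k a b b' Aa Ab Ab'; rewrite lin_r// vcst scale0r addr0.
  - move=> a Aa; apply: gsect_ext => x.
    have [X LX [V [oV Vx] XE]] := dirac_lift_germ x Aa.
    rewrite (brP _ _ Aa Aa x X X V)//.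
    have := congr1 (fun s : gsect (Tfam E) => s x) (bbr_skew LX LX).
    move=> /eqP; rewrite gsect_oppE -addr_eq0 -mulr2n -scaler_nat scaler_eq0.
    by rewrite pnatr_eq0 /= => /eqP.
  - move=> a b c Aa Ab Ac; apply: gsect_ext => x.
    have [X LX [V [oV Vx] XE]] := dirac_lift_germ x Aa.
    have [Y LY [V1 [oV1 V1x] YE]] := dirac_lift_germ x Ab.
    have [Z LZ [V2 [oV2 V2x] ZE]] := dirac_lift_germ x Ac.
    set W := V `&` (V1 `&` V2).
    have oW : open W by do 2 apply: openI => //.
    have XE1 y : W y -> bsec X y = a y by move=> [/XE].
    have YE1 y : W y -> bsec Y y = b y by move=> [_ [/YE]].
    have ZE1 y : W y -> bsec Z y = c y by move=> [_ [_ /ZE]].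
    have Wx : W x by [].
    have XY y : W y -> bsec (omni_br X Y) y = br a b y.
      by move=> Wy; rewrite (brP _ _ Aa Ab y X Y W).
    have YZ y : W y -> bsec (omni_br Y Z) y = br b c y.
      by move=> Wy; rewrite (brP _ _ Ab Ac y Y Z W).
    have ZX y : W y -> bsec (omni_br Z X) y = br c a y.
      by move=> Wy; rewrite (brP _ _ Ac Aa y Z X W).
    rewrite !gsect_addE (brP a (br b c) Aa (closed _ _ Ab Ac) x X (omni_br Y Z) W)//; last exact: dirac_closed.
    rewrite (brP b (br c a) Ab (closed _ _ Ac Aa) x Y (omni_br Z X) W)//; last exact: dirac_closed.
    rewrite (brP c (br a b) Ac (closed _ _ Aa Ab) x Z (omni_br X Y) W)//; last exact: dirac_closed.
    by rewrite -!gsect_addE bbr_jacobi.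
  - move=> a b Aa Ab; apply: gsect_ext => x.
    have [X LX [V [oV Vx] XE]] := dirac_lift_germ x Aa.
    have [Y LY [V1 [oV1 V1x] YE]] := dirac_lift_germ x Ab.
    have oW : open (V `&` V1) by apply: openI.
    have XE1 y : (V `&` V1) y -> bsec X y = a y by move=> [/XE].
    have YE1 y : (V `&` V1) y -> bsec Y y = b y by move=> [_ /YE].
    have Wx : (V `&` V1) x by [].
    rewrite -[LHS]/((br a b x).1) (brP _ _ Aa Ab x X Y _ LX LY oW)//.
    rewrite -[LHS]/(gfst (bbr X Y) x) /bbr bbr_fst; apply: tangent_ext => f.
    rewrite !vbrE; congr (_ - _).
      rewrite -[gfst (bsec X) x]/((bsec X x).1) XE1//.
      apply: (tangent_local _ oW Wx) => y Wy.
      by rewrite -[LHS]/((bsec Y y).1 f) YE1.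
    rewrite -[gfst (bsec Y) x]/((bsec Y x).1) YE1//.
    apply: (tangent_local _ oW Wx) => y Wy.
    by rewrite -[LHS]/((bsec X y).1 f) XE1.
  - move=> a b f Aa Ab; have A0 := gsect_in0 rL.
    have := lin_r a b 0 f Aa Ab A0; rewrite addr0 => ->.
    have := lin_r a 0 0 0 Aa A0 A0; rewrite scaler0 addr0 scale0r scaler0 !add0r.
    move=> <-; rewrite -[X in _ = X]addr0; congr (_ + _).
    have := lin_r a 0 0 1 Aa A0 A0; rewrite scaler0 addr0 scale1r scaler0 addr0 => /eqP.
    by rewrite -subr_eq subrr => /eqP <-.
exists br; split => // br' pla' pres' a b Aa Ab; apply: gsect_ext => x.
have [X [psi [V [LX oV Vx p1 XE]]]] := dirac_lift x Aa.
have [Y [phi [V' [LY oV' V'x p1' YE]]]] := dirac_lift x Ab.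
have oW : open (V `&` V') by apply: openI.
have Wx : (V `&` V') x by [].
have h1 y : (V `&` V') y -> psi y = 1 by move=> [/p1].
have h2 y : (V `&` V') y -> phi y = 1 by move=> [_ /p1'].
(* Both brackets are local, so a and b may be replaced by psi a and phi b, which lift to global
   sections of L; there both are determined by L. *)
rewrite -(pla_cutoff pla' Aa Ab oW Wx h1 h2) -(pla_cutoff pla Aa Ab oW Wx h1 h2).
by rewrite -XE -YE -pres// -pres'.
Qed.

End from_dirac.

(** * From projective Lie algebroids to Dirac structures *)

Section completion.
Variables (R : realType) (n : nat) (M : manifold R n).

Lemma row_free_complement (F : fieldType) k N (G : 'M[F]_(k, N)) : row_free G ->
  exists B : 'M[F]_(N - k, N), row_free (col_mx G B).
Proof.
move=> rG; have /eqP kG := rG.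
have e : \rank (G^C)%MS = (N - k)%N by rewrite mxrank_compl kG.
exists (castmx (e, erefl) (row_base (G^C)%MS)).
have kN : (k <= N)%N by rewrite -kG rank_leq_col.
have H : (col_mx G (castmx (e, erefl N) (row_base (G^C)%MS)) :=: G + G^C)%MS.
  apply: eqmx_trans (eqmx_sym (addsmxE _ _)) _.
  apply: adds_eqmx => //; apply: eqmx_trans (eqmx_cast _ _) (eq_row_base _).
have /eqP f := addsmx_compl_full G.
by rewrite /row_free H f subnKC.
Qed.

Lemma full_sub_frame (V : vfamily M) (I : finType) (F : lframe V I) (K : nat) :
  K = #|I| -> exists G : sub_frame (fun x => [set: V x]) K, sf_dom G = lf_dom F.
Proof.
move=> ->.
have bF x : lf_dom F x -> is_basis [set: V x] (fun i : 'I_#|I| => lf_e F (enum_val i) x).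
  move=> dx; split=> [v|c c0 i].
    split=> // _; exists (fun i => lf_c F (enum_val i) v).
    rewrite {1}(lf_span v dx) (reindex (fun i : 'I_#|I| => enum_val i))//.
    by exists enum_rank => i _; [exact: enum_valK|exact: enum_rankK].
  have := functional_sum (index_enum 'I_#|I|) c (fun i => lf_e F (enum_val i) x)
    (lf_lin F (enum_val i) (x := x)).
  rewrite c0 (bigD1 i)//= lf_dual// eqxx mulr1 big1 ?addr0 => [|j ji].
    move=> <-; have := lf_lin F (enum_val i) 1 (0 : V x) 0.
    by rewrite scaler0 addr0 mul1r => /eqP; rewrite -subr_eq subrr => /eqP <-.
  rewrite lf_dual// (inj_eq enum_val_inj) eq_sym (negPf ji) mulr0//.
unshelve eexists (@SubFrame _ _ M V _ #|I| (lf_dom F) (fun i => lf_e F (enum_val i))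
  (fun i => lf_c F (enum_val i)) (lf_open F) _ _ _ _ _) => //.
- by move=> i x a v w; exact: lf_lin.
- by move=> i j x dx /=; rewrite lf_dual// (inj_eq enum_val_inj).
- by move=> i W s oW _; exact: lf_smooth.
Qed.

(** Linear algebra completes the frame at x0 by combinations with constant coefficients of a frame
    of V; by [sub_frame_of] the result remains a frame near x0. *)
Lemma complete_frame (V : vfamily M) (I : finType) (S : forall x, set (V x)) k
    (F : sub_frame S k) x0 : vlocal V ->
  (forall x, exists F : lframe V I, lf_dom F x) -> sf_dom F x0 ->
  exists2 G : sub_frame (fun x => [set: V x]) (k + (#|I| - k)), sf_dom G x0 &
    forall i, sf_e G (lshift _ i) = sf_e F i.
Proof.
move=> lV frames dx; have [H Hx] := frames x0.
pose G0 : 'M[R]_(k, #|I|) := \matrix_(i, q) lf_c H (enum_val q) (sf_e F i x0).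
have tco0 q : lf_c H q (0 : V x0) = 0.
  have := lf_lin H q 1 (0 : V x0) 0.
  by rewrite scaler0 addr0 mul1r => /eqP; rewrite -subr_eq subrr => /eqP <-.
have rG : row_free G0.
  apply: inj_row_free => v v0; apply/rowP => i; rewrite mxE.
  apply: ((sf_basis dx).2 (fun i => v 0 i)).
  rewrite (lf_span (\sum_i _) Hx) big1// => q _.
  rewrite (functional_sum _ _ _ (lf_lin H q (x := x0))).
  suff -> : \sum_i v 0 i * lf_c H q (sf_e F i x0) = 0 by rewrite scale0r.
  move/rowP/(_ (enum_rank q)): v0; rewrite !mxE => v0; rewrite -[RHS]v0.
  by apply: eq_bigr => l _; rewrite mxE enum_rankK.
have [B rGB] := row_free_complement rG.
have kN : (k <= #|I|)%N by have /eqP <- := rG; exact: rank_leq_col.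
have [G1 G1d] := full_sub_frame H (subnKC kN).
pose w j : gsect V := \sum_q cinf_cst M (B j q) *: lf_e H (enum_val q).
pose b (i : 'I_(k + (#|I| - k))) : gsect V :=
  match fintype.split i with inl i => sf_e F i | inr j => w j end.
have bE i q : lf_c H (enum_val q) (b i x0) = col_mx G0 B i q.
  rewrite /b mxE; case: fintype.split => j; first by rewrite mxE.
  rewrite /w gsect_sumE (functional_sum _ _ _ (lf_lin H (enum_val q) (x := x0))).
  rewrite (bigD1 q)//= lf_dual// eqxx mulr1 big1 ?addr0// => q' q'q.
  by rewrite lf_dual// (inj_eq enum_val_inj) eq_sym (negPf q'q) mulr0.
have ib : independent (fun i => b i x0).
  move=> c c0 i.
  have cM : (\row_i c i) *m col_mx G0 B = 0.
    apply/rowP => q; rewrite !mxE.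
    have := functional_sum (index_enum _) c (fun i => b i x0) (lf_lin H (enum_val q) (x := x0)).
    rewrite c0 tco0 => h; rewrite [RHS]h; apply: eq_bigr => j _; rewrite bE mxE//.
  have : (\row_i c i) = 0 by apply: (row_free_inj rGB); rewrite cM mul0mx.
  by move=> /rowP/(_ i); rewrite !mxE.
have G1x : sf_dom G1 x0 by rewrite G1d.
have [//|G Gx GE] := sub_frame_of lV frames G1x _ ib.
exists G => // i; rewrite GE /b.
by have -> : fintype.split (lshift (#|I| - k) i) = inl i := unsplitK (inl i).
Qed.

End completion.

(** * The Dirac structure attached to a projective Lie algebroid *)

Section to_dirac.
Variables (R : realType) (n r : nat) (M : manifold R n) (E : vbundle M r).
Variables (A : forall x, set (Tfam E x)) (br : gsect (Tfam E) -> gsect (Tfam E) -> gsect (Tfam E)).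
Hypothesis pA : proj_lie_algebroid A br.
Implicit Types (f : cinf M) (x : M) (a b c : gsect (Tfam E)).

Let bA : is_subbundle A. Proof. exact: pla_subbundle pA. Qed.
Let lT : vlocal (Tfam E). Proof. exact: vlocal_Tfam. Qed.
Let fT : forall x, exists F : lframe (Tfam E) ('I_n + 'I_r)%type, lf_dom F x.
Proof. exact: Tfam_frames. Qed.

Lemma gsndD a b : gsnd (a + b) = gsnd a + gsnd b. Proof. exact: gsect_ext. Qed.
Lemma gsndN a : gsnd (- a) = - gsnd a. Proof. exact: gsect_ext. Qed.
Lemma gsndZ f a : gsnd (f *: a) = f *: gsnd a. Proof. exact: gsect_ext. Qed.
Lemma gfstD a b : gfst (a + b) = gfst a + gfst b. Proof. exact: gsect_ext. Qed.
Lemma gfstZ f a : gfst (f *: a) = f *: gfst a. Proof. exact: gsect_ext. Qed.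

Lemma gsnd0 : gsnd (0 : gsect (Tfam E)) = 0. Proof. exact: gsect_ext. Qed.

Lemma gsnd_sum (I : Type) (s : seq I) (F : I -> gsect (Tfam E)) :
  gsnd (\sum_(i <- s) F i) = \sum_(i <- s) gsnd (F i).
Proof. by elim: s => [|i s ih]; rewrite ?big_nil ?gsnd0// !big_cons gsndD ih. Qed.

(** Near x, c is a sum of f_i e_i with f_i(x) = 0, and at x both sides reduce to the sum of the
    a(f_i) times the E-component of e_i. The tensoriality of [compatible] rests on this. *)
Lemma bracket_vanish a c x (d : gauge E x) : gsect_in A a -> gsect_in A c -> c x = 0 ->
  symbol d = gfst a x -> gsnd (br a c) x = gauge_op d (gsnd c).
Proof.
move=> Aa Ac c0 da.
have [k /(_ x)[F Fx]] := sub_frame_exists lT fT bA.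
have [psi [U [oU Ux _ p1 sE]]] := sf_cutoff lT Fx.
have [f fE fx] := sE _ Ac.
have f0 i : f i x = 0.
  rewrite fx c0; have := sf_lin F i 1 (0 : Tfam E x) 0.
  by rewrite scaler0 addr0 mul1r => /eqP; rewrite -subr_eq subrr => /eqP <-; rewrite mulr0.
have -> : gsnd (br a c) x = gsnd (br a (psi *: c)) x.
  have h1 (y : M) : U y -> (1 : cinf M) y = 1 by [].
  have := pla_cutoff pA Aa Ac oU Ux h1 p1; rewrite scale1r => h.
  by rewrite -[LHS]/((br a c x).2) -h.
have -> : gauge_op d (gsnd c) = gauge_op d (gsnd (psi *: c)).
  apply: (gauge_local d oU Ux) => y Uy.
  by rewrite gsndZ gsect_scaleE p1// scale1r.
rewrite fE (pla_sumr pA)//; last by move=> i; exact: sf_in.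
rewrite !gsnd_sum gsect_sumE gauge_op_sum; apply: eq_bigr => i _.
rewrite gsndD !gsndZ gsect_addE !gsect_scaleE gauge_leibniz f0 !scale0r !add0r.
by rewrite da.
Qed.

Definition compatible x a (X : omni E x) (b : gsect (Tfam E)) (e : gauge E x) :=
  gsnd (br a b) x = gauge_op X.1 (gsnd b) + (X.2 : jet E x) e - gauge_op e (gsnd a).

(** The difference e - e' is vertical, and on vertical elements a jet acts through its value, here
    that of the E-component of a. So [compatible] depends on e through its symbol only. *)
Lemma vertical_cancel x a (X : omni E x) (e e' : gauge E x) : bmap X = a x ->
  symbol e = symbol e' -> (X.2 : jet E x) e - gauge_op e (gsnd a) =
  (X.2 : jet E x) e' - gauge_op e' (gsnd a).
Proof.
move=> Xa ee'.
have : (X.2 : jet E x) (e - e') = gauge_op (e - e') (gsnd a).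
  apply: jet_vertical; first by rewrite symbolD symbolN ee' subrr.
  by have := congr1 snd Xa.
rewrite jetD jetN gauge_opDl gauge_opNl => h.
by apply: fibre_eqP => phi pD pN pZ; move/(congr1 phi): h; rewrite !(pD, pN); lra.
Qed.

(** Passing from b to b' changes both sides by the same term, by [bracket_vanish]; passing from e to
    e' changes nothing, by [vertical_cancel]. *)
Lemma compatible_tensor x a (X : omni E x) b b' (e e' : gauge E x) :
  gsect_in A a -> gsect_in A b -> gsect_in A b' -> bmap X = a x ->
  b x = b' x -> symbol e = gfst b x -> symbol e' = gfst b' x ->
  compatible a X b e -> compatible a X b' e'.
Proof.
move=> Aa Ab Ab' Xa bb' eb eb' C.
have Ac : gsect_in A (b' - b).
  by apply: gsect_inD => //; rewrite -scaleN1r; exact: gsect_inZ.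
have c0 : (b' - b) x = 0 by rewrite gsect_addE gsect_oppE bb' subrr.
have sa : symbol X.1 = gfst a x by have := congr1 fst Xa.
have -> : b' = b + (b' - b) by rewrite addrC subrK.
rewrite /compatible (pla_addr pA)// gsndD gsect_addE C gsndD gauge_opD.
rewrite (bracket_vanish Aa Ac c0 sa).
have ee' : symbol e = symbol e' by rewrite eb eb' -[LHS]/((b x).1) bb'.
have h := vertical_cancel Xa ee'.
by apply: fibre_eqP => phi pD pN pZ; move/(congr1 phi): h; rewrite !(pD, pN); lra.
Qed.

Lemma compatible_indep x a a' (X : omni E x) b (e : gauge E x) :
  gsect_in A a -> gsect_in A a' -> gsect_in A b -> a x = a' x ->
  symbol e = gfst b x -> compatible a X b e -> compatible a' X b e.
Proof.
move=> Aa Aa' Ab aa' eb C.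
have Ac : gsect_in A (a' - a).
  by apply: gsect_inD => //; rewrite -scaleN1r; exact: gsect_inZ.
have c0 : (a' - a) x = 0 by rewrite gsect_addE gsect_oppE aa' subrr.
have -> : a' = a + (a' - a) by rewrite addrC subrK.
rewrite /compatible (pla_addl pA)// gsndD gsect_addE C gsndD gauge_opD.
rewrite [br (a' - a) b](pla_skew pA)// gsndN gsect_oppE (bracket_vanish Ab Ac c0 eb).
by rewrite opprD addrA.
Qed.

(** One extension a of b(X) is asked for; by [compatible_indep] every other one will do as well. *)
Definition dirac_of x : set (omni E x) := [set X | exists a, [/\ gsect_in A a, a x = bmap X
  & forall b (e : gauge E x), gsect_in A b -> symbol e = gfst b x -> compatible a X b e]].

Lemma dirac_of_compatible x (X : omni E x) a b (e : gauge E x) : dirac_of X ->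
  gsect_in A a -> bmap X = a x -> gsect_in A b -> symbol e = gfst b x -> compatible a X b e.
Proof.
move=> [a' [Aa' a'X C]] Aa Xa Ab eb.
by apply: (compatible_indep Aa' Aa Ab _ eb (C _ _ Ab eb)); rewrite a'X.
Qed.

Lemma dirac_of_bmap x (X : omni E x) : dirac_of X -> A (bmap X).
Proof. by move=> [a [Aa <- _]]; exact: Aa. Qed.

Lemma dirac_of_lin x (k : R) (X X' : omni E x) : dirac_of X -> dirac_of X' ->
  dirac_of (k *: X + X').
Proof.
move=> [a [Aa aX C]] [a' [Aa' a'X C']].
exists (cinf_cst M k *: a + a'); split; first exact: gsect_in_lin.
  by rewrite gsect_addE gsect_scaleE aX a'X bmap_lin.
move=> b e Ab eb; have := C _ _ Ab eb; have := C' _ _ Ab eb; rewrite /compatible => h' h.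
rewrite (pla_linl pA)// gsndD gsndZ gsect_addE gsect_scaleE h h'.
rewrite omni_fst omni_snd gauge_linE jet_linE gsndD gsndZ gauge_opD gauge_op_cst.
by apply: fibre_eqP => phi pD pN pZ; rewrite !(pD, pN, pZ) cinf_cstE; ring.
Qed.

Lemma dirac_of0 x : dirac_of (0 : omni E x).
Proof.
exists 0; split; first exact: gsect_in0.
  by have := congr1 (fun s : gsect (Tfam E) => s x) (@bsec0 _ _ _ _ E).
move=> b e Ab eb; rewrite /compatible (pla_skew pA)//; last exact: gsect_in0.
by rewrite (pla0r pA)// oppr0 gsnd0 gauge_op0 subr0 -[RHS]/((0 : E x) + 0) addr0.
Qed.

Lemma dirac_of_sum x (I : Type) (s : seq I) (k : I -> R) (X : I -> omni E x) :
  (forall i, dirac_of (X i)) -> dirac_of (\sum_(i <- s) k i *: X i).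
Proof.
move=> LX; elim: s => [|i s ih]; rewrite ?big_nil ?big_cons; first exact: dirac_of0.
exact: dirac_of_lin.
Qed.

Lemma dirac_ofB x (X X' : omni E x) : dirac_of X -> dirac_of X' -> dirac_of (X - X').
Proof. by move=> LX LX'; rewrite addrC -scaleN1r; exact: dirac_of_lin. Qed.

Lemma dirac_of_isotropic x (X Y : omni E x) : dirac_of X -> dirac_of Y -> omni_form X Y = 0.
Proof.
move=> LX LY; have [a [Aa aX C]] := LX; have [b [Ab bY C']] := LY.
have Xa : symbol X.1 = gfst a x by have := congr1 fst aX.
have Yb : symbol Y.1 = gfst b x by have := congr1 fst bY.
(* X is tested against the gauge part of Y and conversely: in the sum of the two conditions the
   brackets cancel and the pairing of X and Y remains. *)
have h := C b Y.1 Ab Yb; have h' := C' a X.1 Aa Xa.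
apply/omni_form0; move: h h'; rewrite /compatible (pla_skew pA)// gsndN gsect_oppE => h h'.
rewrite h' in h; apply: fibre_eqP => phi pD pN pZ; move/(congr1 phi): h.
rewrite !(pD, pN); have -> : phi 0 = 0 by have := pZ 0 0; rewrite scale0r mul0r.
lra.
Qed.

Section local.
Variables (D : frame_data E) (k : nat) (F : sub_frame A k).
Local Notation m := (#|{: 'I_n + 'I_r}| - k)%N.
Variable G : sub_frame (fun x => [set: Tfam E x]) (k + m).
Hypothesis GF : forall i, sf_e G (lshift m i) = sf_e F i.

Definition jdom : set M := fd_dom D `&` (sf_dom F `&` sf_dom G).

Lemma jdom_open : open jdom.
Proof. by do 2 (apply: openI; [try exact: fd_open; exact: sf_open|]); exact: sf_open. Qed.

(* Through the connection the omni-Lie algebroid becomes the sum of T and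
   Hom(T, E): [theta X] is the Hom-component of X, the other one being b(X). *)
Definition theta x (X : omni E x) (z : Tfam E x) : E x := \sum_q tco D q z *: hco D q X.

Lemma theta_linl x (u : R) (X X' : omni E x) z :
  theta (u *: X + X') z = u *: theta X z + theta X' z.
Proof.
rewrite /theta scaler_sumr -big_split; apply: eq_bigr => q _ /=.
by rewrite hco_lin scalerDr !scalerA mulrC.
Qed.

Lemma thetaB x (X X' : omni E x) z : theta (X - X') z = theta X z - theta X' z.
Proof. by have := theta_linl (-1) X' X z; rewrite !scaleN1r addrC => ->; rewrite addrC. Qed.

Lemma theta_sumr x (X : omni E x) (I : Type) (s : seq I) (u : I -> R) (z : I -> Tfam E x) :
  theta X (\sum_(i <- s) u i *: z i) = \sum_(i <- s) u i *: theta X (z i).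
Proof.
have tl (v : R) (z1 z2 : Tfam E x) : theta X (v *: z1 + z2) = v *: theta X z1 + theta X z2.
  rewrite /theta scaler_sumr -big_split; apply: eq_bigr => q _ /=.
  by rewrite tco_lin scalerDl scalerA.
elim: s => [|i s ih]; last by rewrite !big_cons tl ih.
rewrite !big_nil; have := tl 1 0 0; rewrite scaler0 addr0 scale1r => /eqP.
by rewrite -subr_eq subrr => /eqP <-.
Qed.

Lemma theta_frame x (X : omni E x) q : fd_dom D x -> theta X (tframe D q x) = hco D q X.
Proof.
move=> dx; rewrite /theta (bigD1 q)//= tco_dual// eqxx scale1r big1 ?addr0// => q' q'q.
by rewrite tco_dual// (negPf q'q) scale0r.
Qed.

Lemma pairing_theta x (X X' : omni E x) : fd_dom D x ->
  (X'.2 : jet E x) X.1 + (X.2 : jet E x) X'.1 =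
  theta X' (bmap X) + theta X (bmap X').
Proof. by move=> dx; rewrite (pairing_frame _ _ dx) big_split. Qed.

(* The torsion of the connection; the Dirac structure of A is
   {X | b(X) = a in A, theta X = torsion a on A}. *)
Definition torsion a b : gsect E := gsnd (br a b) - dapp (nabla D (gfst a)) (gsnd b)
  + dapp (nabla D (gfst b)) (gsnd a).

Lemma torsionE a b x : torsion a b x = gsnd (br a b) x -
  gauge_op (conn D (gfst a x)) (gsnd b) + gauge_op (conn D (gfst b x)) (gsnd a).
Proof. by []. Qed.

Lemma compatible_theta x a b (X : omni E x) : fd_dom D x -> bmap X = a x ->
  compatible a X b (conn D (gfst b x)) <-> theta X (b x) = torsion a b x.
Proof.
move=> dx Xa; have sa : symbol X.1 = gfst a x by have := congr1 fst Xa.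
have H : theta X (b x) = gauge_op X.1 (gsnd b) + (X.2 : jet E x) (conn D (gfst b x))
    - gauge_op (conn D (gfst a x)) (gsnd b).
  rewrite (jet_frame X.2 _ dx) conn_symbol fd_eta1// scale1r.
  rewrite (gauge_op_frame X.1 (gsnd b) dx) big_split /theta big_sumType /=.
  rewrite [X in _ = _ + (_ + X) - _]big1 ?addr0; last by move=> i _; rewrite conn_eps// scaler0.
  by rewrite sa conn_opE [_ + _ - _]addrAC addrK addrC.
rewrite H /compatible torsionE.
by split=> h; apply: fibre_eqP => phi pD pN pZ; move/(congr1 phi): h; rewrite !(pD, pN); lra.
Qed.

Lemma dirac_of_theta x a (X : omni E x) : jdom x -> gsect_in A a -> bmap X = a x ->
  dirac_of X <-> forall i, theta X (sf_e F i x) = torsion a (sf_e F i) x.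
Proof.
move=> [dx [Fx _]] Aa Xa; split=> [LX i|H].
  apply/compatible_theta => //; apply: (dirac_of_compatible LX) => //.
    exact: sf_in.
  by rewrite conn_symbol fd_eta1// scale1r.
have C i : compatible a X (sf_e F i) (conn D (gfst (sf_e F i) x)) by exact/compatible_theta.
exists a; split=> // b e Ab eb.
(* A combination with constant coefficients that has the value of b at x; the condition on it
   follows from those on the frame, and tensoriality carries it over to b. *)
pose b' := \sum_i cinf_cst M (sf_c F i (b x)) *: sf_e F i.
have Ab' : gsect_in A b' by apply: gsect_in_sum => // i; exact: sf_in.
have b'b : b' x = b x by rewrite gsect_sumE [RHS](sf_expand Fx (Ab x)); exact: eq_bigr.
have se : symbol (conn D (gfst b' x)) = gfst b' x by rewrite conn_symbol fd_eta1// scale1r.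
apply: (compatible_tensor Aa Ab' Ab Xa b'b se eb).
apply/compatible_theta => //.
rewrite b'b {1}(sf_expand Fx (Ab x)) theta_sumr.
rewrite torsionE /b'.
have fs (I : Type) (s : seq I) (u : I -> R) (c : I -> gsect (Tfam E)) :
    gfst (\sum_(i <- s) cinf_cst M (u i) *: c i) x = \sum_(i <- s) u i *: gfst (c i) x.
  elim: s => [|i s ih]; first by rewrite !big_nil; exact: tangent_ext.
  by rewrite !big_cons gfstD gsect_addE gfstZ gsect_scaleE ih.
rewrite (pla_sumr pA)//; last by move=> i; exact: sf_in.
rewrite !gsnd_sum gsect_sumE fs conn_sum gauge_op_suml gauge_op_sum.
rewrite -sumrB -big_split; apply: eq_bigr => i _; cbv beta.
rewrite gsndD !gsndZ gsect_addE !gsect_scaleE gauge_opZl gauge_op_cst H torsionE.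
have -> : vapp (gfst a) (cinf_cst M (sf_c F i (b x))) x = 0 by exact: tangent_cst.
by rewrite scale0r addr0 scalerDr scalerBr.
Qed.

(** Over [fd_dom], the inverse of the map sending X to b(X) and theta X, the latter given by its
    values t on the frame of T. *)
Definition of_theta x (z : Tfam E x) (t : 'I_n + 'I_r -> E x) : omni E x :=
  \sum_q tco D q z *: oframe D (inl q) x + \sum_p fd_kap D p.2 (t p.1) *: oframe D (inr p) x.

Lemma bmap_sum x (I : Type) (s : seq I) (u : I -> R) (X : I -> omni E x) :
  bmap (\sum_(i <- s) u i *: X i) = \sum_(i <- s) u i *: bmap (X i).
Proof.
have := congr1 (fun s : gsect (Tfam E) => s x) (@bsec0 _ _ _ _ E) => b0.
by elim: s => [|i s ih]; rewrite ?big_nil// !big_cons bmap_lin ih.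
Qed.

Lemma hco_sum x q (I : Type) (s : seq I) (u : I -> R) (X : I -> omni E x) :
  hco D q (\sum_(i <- s) u i *: X i) = \sum_(i <- s) u i *: hco D q (X i).
Proof.
elim: s => [|i s ih]; last by rewrite !big_cons hco_lin ih.
rewrite !big_nil; have := hco_lin D q 1 (0 : omni E x) 0; rewrite scaler0 addr0 scale1r => /eqP.
by rewrite -subr_eq subrr => /eqP <-.
Qed.

Lemma bmapD x (X X' : omni E x) : bmap (X + X') = bmap X + bmap X'.
Proof. by have := bmap_lin 1 X X'; rewrite !scale1r. Qed.

Lemma hcoD x q (X X' : omni E x) : hco D q (X + X') = hco D q X + hco D q X'.
Proof. by have := hco_lin D q 1 X X'; rewrite !scale1r. Qed.

Lemma of_theta_bmap x z t : fd_dom D x -> bmap (of_theta (x := x) z t) = z.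
Proof.
move=> dx; rewrite /of_theta bmapD !bmap_sum.
rewrite [X in _ + X]big1 ?addr0; last by move=> p _; rewrite oframe_bmap// scaler0.
rewrite [RHS](lf_span (l := tlframe D) z dx); apply: eq_bigr => q _.
by rewrite oframe_bmap.
Qed.

Lemma of_theta_hco x z t q : fd_dom D x -> hco D q (of_theta (x := x) z t) = t q.
Proof.
move=> dx; rewrite /of_theta hcoD !hco_sum big1 ?add0r; last first.
  by move=> q' _; rewrite oframe_hco// scaler0.
transitivity (\sum_p fd_kap D p.2 (t p.1) *: ((q == p.1)%:R *: fd_eps D p.2 x)).
  by apply: eq_bigr => p _; rewrite oframe_hco.
rewrite -(pair_bigA _ (fun q' l => fd_kap D l (t q') *: ((q == q')%:R *: fd_eps D l x))) /=.
rewrite (bigD1 q)//= [X in _ + X]big1 ?addr0 => [|q' q'q].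
  rewrite [RHS](kap_eps_sum (t q) dx); apply: eq_bigr => l _.
  by rewrite eqxx scale1r.
by rewrite big1// => l _; rewrite eq_sym (negPf q'q) scale0r scaler0.
Qed.

Lemma of_theta_smooth W (z : forall x, Tfam E x) (t : 'I_n + 'I_r -> forall x, E x) :
  open W -> vsmooth W z -> (forall q, vsmooth W (t q)) ->
  vsmooth W (fun x => of_theta (z x) (t^~ x)).
Proof.
move=> oW sz st; have lO := @vlocal_omni _ _ M _ E.
have s1 : vsmooth W (fun x => \sum_q tco D q (z x) *: oframe D (inl q) x).
  apply: (@vlocal_sum _ _ M (omni E) W _ (index_enum _) predT (fun q x => tco D q (z x))
    (fun q => oframe D (inl q)) lO oW) => q _.
  by split; [exact: tco_smooth|exact: vlocal_sect].
have s2 : vsmooth W (fun x => \sum_p fd_kap D p.2 (t p.1 x) *: oframe D (inr p) x).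
  apply: (@vlocal_sum _ _ M (omni E) W _ (index_enum _) predT (fun p x => fd_kap D p.2 (t p.1 x))
    (fun p => oframe D (inr p)) lO oW) => p _.
  by split; [exact: fd_kap_smooth|exact: vlocal_sect].
apply: vlocal_eq lO oW _ (vsmooth_lin oW (@msmooth_cst _ _ M W 1) s1 s2) => x _.
by rewrite scale1r.
Qed.

(** Its Hom-component is the torsion of a composed with the projection of T onto A along the
    complement spanned by the last m sections of G. *)
Definition lift_at a x : omni E x :=
  of_theta (a x) (fun q => \sum_i sf_c G (lshift m i) (tframe D q x) *: torsion a (sf_e F i) x).

(** A coordinate on that complement, extended by 0 on A, tensor eps_l; these elements span Hom(T/A,
    E). *)
Definition kernel_at (j : 'I_m) (l : 'I_r) x : omni E x :=
  of_theta 0 (fun q => sf_c G (rshift k j) (tframe D q x) *: fd_eps D l x).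

Lemma sf_c_tco (p : 'I_(k + m)) x (z : Tfam E x) : fd_dom D x ->
  \sum_q tco D q z * sf_c G p (tframe D q x) = sf_c G p z.
Proof.
move=> dx; rewrite [in RHS](lf_span (l := tlframe D) z dx).
by rewrite (functional_sum _ _ _ (sf_lin G p (x := x))).
Qed.

Lemma theta_lift a x z : fd_dom D x -> theta (lift_at a x) z =
  \sum_i sf_c G (lshift m i) z *: torsion a (sf_e F i) x.
Proof.
move=> dx; rewrite /theta /lift_at.
under eq_bigr do rewrite of_theta_hco// scaler_sumr.
rewrite exchange_big; apply: eq_bigr => i _ /=.
by under eq_bigr do rewrite scalerA; rewrite -scaler_suml sf_c_tco.
Qed.

Lemma theta_kernel j l x z : fd_dom D x ->
  theta (kernel_at j l x) z = sf_c G (rshift k j) z *: fd_eps D l x.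
Proof.
move=> dx; rewrite /theta /kernel_at.
under eq_bigr do rewrite of_theta_hco// scalerA.
by rewrite -scaler_suml sf_c_tco.
Qed.

Lemma torsion0 b x : gsect_in A b -> torsion 0 b x = 0.
Proof.
move=> Ab; rewrite torsionE (pla_skew pA)//; last exact: gsect_in0.
rewrite (pla0r pA)// oppr0 gsnd0 gsect_0E add0r gauge_op0 addr0.
have -> : gfst (0 : gsect (Tfam E)) x = 0 by exact: tangent_ext.
rewrite conn_opE big1 ?oppr0// => i _.
by rewrite -[X in X *: _]/(0 : R) scale0r.
Qed.

Lemma lift_in a x : jdom x -> gsect_in A a -> dirac_of (lift_at a x).
Proof.
move=> jx Aa; have [dx [Fx Gx]] := jx.
apply/(dirac_of_theta jx Aa); first exact: of_theta_bmap.
move=> i; rewrite theta_lift// (bigD1 i)//= -GF sf_dual// eqxx scale1r.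
rewrite big1 ?addr0// => i' i'i.
by rewrite sf_dual// (inj_eq (@lshift_inj _ _)) (negPf i'i) scale0r.
Qed.

Lemma kernel_in j l x : jdom x -> dirac_of (kernel_at j l x).
Proof.
move=> jx; have [dx [Fx Gx]] := jx; have A0 := gsect_in0 bA.
apply/(dirac_of_theta jx A0); first exact: of_theta_bmap.
move=> i; rewrite theta_kernel// torsion0; last exact: sf_in.
rewrite -GF sf_dual//.
have -> : (rshift k j == lshift m i) = false by apply/eqP => /eqP; rewrite eq_rlshift.
by rewrite scale0r.
Qed.

Lemma kernel_span x (X : omni E x) : jdom x -> bmap X = 0 ->
  (forall i, theta X (sf_e F i x) = 0) ->
  X = \sum_p fd_kap D p.2 (theta X (sf_e G (rshift k p.1) x)) *: kernel_at p.1 p.2 x.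
Proof.
move=> [dx [Fx Gx]] X0 tX; apply: (hco_inj dx).
  by rewrite bmap_sum big1// => p _; rewrite of_theta_bmap// scaler0.
move=> q; rewrite hco_sum -(theta_frame X q dx).
rewrite (sf_expand (F := G) (v := tframe D q x) Gx Logic.I) theta_sumr big_split_ord /=.
rewrite big1 ?add0r => [|i _]; last by rewrite GF tX scaler0.
rewrite -(pair_bigA _ (fun j l => fd_kap D l (theta X (sf_e G (rshift k j) x)) *:
  hco D q (kernel_at j l x))) /=.
apply: eq_bigr => j _; rewrite {1}(kap_eps_sum (theta X _) dx) scaler_sumr.
apply: eq_bigr => l _; rewrite of_theta_hco// !scalerA mulrC//.
Qed.

Lemma dirac_of_frame x : jdom x ->
  let e (j : 'I_k + 'I_m * 'I_r) : omni E x := match j with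
    | inl i => lift_at (sf_e F i) x | inr p => kernel_at p.1 p.2 x end in
  (forall v, dirac_of v <-> exists c : 'I_k + 'I_m * 'I_r -> R, v = \sum_j c j *: e j) /\
  (forall c : 'I_k + 'I_m * 'I_r -> R, \sum_j c j *: e j = 0 -> forall j, c j = 0).
Proof.
move=> jx e; have [dx [Fx Gx]] := jx.
have Le j : dirac_of (e j).
  by case: j => [i|p]; [apply: lift_in => //; exact: sf_in|exact: kernel_in].
split=> [X|c].
  split=> [LX|[c ->]]; last exact: dirac_of_sum.
  have AX := dirac_of_bmap LX.
  (* Subtracting a lift of b(X) leaves an element of Hom(T, E) that vanishes on A, to which
     [kernel_span] applies. *)
  pose X1 := \sum_i sf_c F i (bmap X) *: lift_at (sf_e F i) x.
  have LX1 : dirac_of X1.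
    by apply: dirac_of_sum => i; apply: lift_in => //; exact: sf_in.
  have bX1 : bmap X1 = bmap X.
    rewrite bmap_sum [RHS](sf_expand Fx AX); apply: eq_bigr => i _.
    by rewrite of_theta_bmap.
  have LX2 := dirac_ofB LX LX1.
  have b0 : bmap (X - X1) = 0.
    by rewrite addrC -scaleN1r bmap_lin bX1 scaleN1r addNr.
  have A0 := gsect_in0 bA.
  have t0 i : theta (X - X1) (sf_e F i x) = 0.
    by rewrite ((dirac_of_theta jx A0 b0).1 LX2) torsion0//; exact: sf_in.
  exists (fun j => match j with inl i => sf_c F i (bmap X)
    | inr p => fd_kap D p.2 (theta (X - X1) (sf_e G (rshift k p.1) x)) end).
  by rewrite big_sumType /= -/X1 -(kernel_span jx b0 t0) addrC subrK.
rewrite big_sumType /= => c0.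
have cl i : c (inl i) = 0.
  apply: ((sf_basis Fx).2 (fun i => c (inl i))).
  have := congr1 (@bmap _ _ _ _ _ x) c0; rewrite bmapD !bmap_sum.
  have -> : bmap (0 : omni E x) = 0.
    by have := congr1 (fun s : gsect (Tfam E) => s x) (@bsec0 _ _ _ _ E).
  rewrite [X in _ + X]big1 ?addr0 => [h|p _]; last by rewrite of_theta_bmap// scaler0.
  by rewrite -[RHS]h; apply: eq_bigr => i' _; rewrite of_theta_bmap.
case=> [//|[j l]].
move: c0; rewrite big1 ?add0r => [c0|i _]; last by rewrite cl scale0r.
have := congr1 (fun X => fd_kap D l (theta X (sf_e G (rshift k j) x))) c0.
have th0 z : theta (0 : omni E x) z = 0.
  have := theta_linl 1 (0 : omni E x) 0 z; rewrite scaler0 addr0 scale1r => /eqP.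
  by rewrite -subr_eq subrr => /eqP <-.
have ths (I : Type) (s : seq I) (u : I -> R) (X : I -> omni E x) z :
    theta (\sum_(i <- s) u i *: X i) z = \sum_(i <- s) u i *: theta (X i) z.
  by elim: s => [|i s ih]; rewrite ?big_nil// !big_cons theta_linl ih.
rewrite /= th0 kap_0 ths kap_sum (bigD1 (j, l))//= theta_kernel// sf_dual// eqxx scale1r.
rewrite kap_scale fd_kap_eps// eqxx mulr1 big1 ?addr0// => -[j' l'] ne /=.
rewrite theta_kernel// sf_dual// (inj_eq (@rshift_inj _ _)) !kap_scale fd_kap_eps//.
move: ne; rewrite xpair_eqE negb_and eq_sym [l' == l]eq_sym => /orP[]/negPf -> .
  by rewrite eq_sym; case: eqP => [|_]; rewrite ?mul0r ?mulr0.
by rewrite !mulr0.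
Qed.

Lemma lift_smooth a : vsmooth jdom (lift_at a).
Proof.
have oJ := jdom_open.
apply: of_theta_smooth => //; first exact: vlocal_sect.
move=> q; apply: (@vlocal_sum _ _ M E jdom _ (index_enum _) predT
  (fun i x => sf_c G (lshift m i) (tframe D q x)) (fun i => torsion a (sf_e F i))
  (@vlocal_bundle _ _ M _ E) oJ) => i _.
split; last exact: (vlocal_sect _ _ (@vlocal_bundle _ _ M _ E)).
apply: sf_smooth => //; first by move=> x [_ []].
exact: vlocal_sect.
Qed.

Lemma kernel_smooth j l : vsmooth jdom (kernel_at j l).
Proof.
have oJ := jdom_open.
apply: of_theta_smooth => //; first exact: vsmooth0.
move=> q; have := vsmooth_lin oJ _ (vlocal_sect (fd_eps D l) jdom (@vlocal_bundle _ _ M _ E))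
  (vsmooth0 E jdom) => /(_ (fun x => sf_c G (rshift k j) (tframe D q x))).
rewrite (_ : (fun x => _ *: _ + 0) = fun x => sf_c G (rshift k j) (tframe D q x) *: fd_eps D l x).
  apply; apply: sf_smooth => //; first by move=> x [_ []].
  exact: vlocal_sect.
by apply: functional_extensionality_dep => x; rewrite addr0.
Qed.

(** Pairing X with Hom(T/A, E) shows that the components of b(X) outside A vanish; this takes a
    nonzero vector of E. Pairing X and a lift Z of b(X) with lifts of the frame of A then gives
    theta X = theta Z on A, so that X - Z lies in Hom(T/A, E). *)
Lemma orth_dirac_of x (X : omni E x) : (0 < r)%N -> jdom x -> orth dirac_of X -> dirac_of X.
Proof.
move=> r0 jx oX; have [dx [Fx Gx]] := jx.
have pair0 Y : dirac_of Y -> theta Y (bmap X) + theta X (bmap Y) = 0.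
  by move=> /oX/omni_form0; rewrite pairing_theta.
have th0r (Y : omni E x) : theta Y 0 = 0.
  by have := theta_sumr Y [::] (fun _ : nat => 0) (fun=> 0); rewrite !big_nil.
have lam0 j : sf_c G (rshift k j) (bmap X) = 0.
  pose l := Ordinal r0.
  have := pair0 _ (kernel_in j l jx); rewrite of_theta_bmap// th0r addr0 theta_kernel//.
  move=> /(congr1 (fun v => fd_kap D l v)).
  by rewrite kap_0 kap_scale fd_kap_eps// eqxx mulr1.
have AX : A (bmap X).
  rewrite (sf_expand (F := G) (v := bmap X) Gx Logic.I) big_split_ord /=.
  rewrite [X in _ + X]big1 ?addr0 => [|j _]; last by rewrite lam0 scale0r.
  suff H s : A (\sum_(i <- s) sf_c G (lshift m i) (bmap X) *: sf_e G (lshift m i) x) by exact: H.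
  elim: s => [|i s ih]; rewrite ?big_nil ?big_cons; first exact: subbundle0.
  by apply: subbundle_lin => //; rewrite GF; exact: sf_in.
have [a Aa aX] := subbundle_extend lT fT bA AX.
have LZ := lift_in jx Aa; set Z := lift_at a x in LZ.
have bZ : bmap Z = a x by exact: of_theta_bmap.
have b0 : bmap (X - Z) = 0 by rewrite addrC -scaleN1r bmap_lin bZ aX scaleN1r addNr.
suff LXZ : dirac_of (X - Z) by have := dirac_of_lin 1 LXZ LZ; rewrite scale1r subrK.
apply/(dirac_of_theta jx (gsect_in0 bA) b0) => i.
rewrite torsion0; last exact: sf_in.
have Ai : gsect_in A (sf_e F i) by exact: sf_in.
have LY := lift_in jx Ai.
have bY : bmap (lift_at (sf_e F i) x) = sf_e F i x by exact: of_theta_bmap.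
have := pair0 _ LY; rewrite bY => h1.
have := dirac_of_isotropic LZ LY => /omni_form0; rewrite pairing_theta// bY bZ aX => h2.
rewrite thetaB; move: h1 h2.
set u1 := theta _ (bmap X); set u2 := theta X _; set u3 := theta Z _ => h1 h2.
by move: h2; rewrite -h1 => /addrI ->; rewrite subrr.
Qed.

End local.
End to_dirac.

(** * Dirac property and uniqueness *)

Section correspondence.
Variables (R : realType) (n r : nat) (M : manifold R n) (E : vbundle M r).
Variables (A : forall x, set (Tfam E x)) (br : gsect (Tfam E) -> gsect (Tfam E) -> gsect (Tfam E)).
Hypothesis pA : proj_lie_algebroid A br.
Hypothesis r_gt0 : (0 < r)%N.
Implicit Types (f : cinf M) (x : M) (a b c : gsect (Tfam E)).

Let bA : is_subbundle A. Proof. exact: pla_subbundle pA. Qed.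
Let lT : vlocal (Tfam E). Proof. exact: vlocal_Tfam. Qed.
Let fT : forall x, exists F : lframe (Tfam E) ('I_n + 'I_r)%type, lf_dom F x.
Proof. exact: Tfam_frames. Qed.

Local Notation L := (dirac_of A br).

Lemma adapted_frames : exists k, forall x0, exists (D : frame_data E) (F : sub_frame A k)
    (G : sub_frame (fun x => [set: Tfam E x]) (k + (#|{: 'I_n + 'I_r}| - k))),
  (forall i, sf_e G (lshift _ i) = sf_e F i) /\ jdom D F G x0.
Proof.
have [k kP] := sub_frame_exists lT fT bA; exists k => x0.
have [D Dx] := frame_data_exists E x0; have [F Fx] := kP x0.
have [G Gx GF] := complete_frame lT fT Fx.
by exists D, F, G.
Qed.

Lemma dirac_of_subbundle : is_subbundle L.
Proof.
have [k kP] := adapted_frames.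
apply: (@subbundle_intro _ _ M (omni E) L
  ('I_k + 'I_(#|{: 'I_n + 'I_r}| - k) * 'I_r)%type) => x0.
have [D [F [G [GF jx]]]] := kP x0.
exists (jdom D F G), (fun j x => match j with
    | inl i => lift_at br D F G (sf_e F i) x
    | inr p => kernel_at D G p.1 p.2 x end); split=> //.
- exact: jdom_open.
- by case=> [i|p]; [exact: lift_smooth|exact: kernel_smooth].
- by move=> x jx'; exact: (dirac_of_frame pA GF jx').
Qed.

Lemma dirac_of_image : bimage L = A.
Proof.
apply: functional_extensionality_dep => x; apply/seteqP; split=> z.
  by move=> [X LX <-]; exact: dirac_of_bmap LX.
move=> Az; have [k /(_ x)[D [F [G [GF jx]]]]] := adapted_frames.
have [a Aa ax] := subbundle_extend lT fT bA Az.
exists (lift_at br D F G a x); first exact: (lift_in pA GF jx Aa).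
by rewrite of_theta_bmap// ; case: jx.
Qed.

Lemma dirac_of_orth : L = orth L.
Proof.
apply: functional_extensionality_dep => x; apply/seteqP; split=> X.
  by move=> LX Y LY; exact: (dirac_of_isotropic pA LX LY).
have [k /(_ x)[D [F [G [GF jx]]]]] := adapted_frames.
exact: (orth_dirac_of pA GF r_gt0 jx).
Qed.

Lemma dirac_of_sect X : gsect_in L X -> gsect_in A (bsec X).
Proof. by move=> LX x; exact: dirac_of_bmap (LX x). Qed.

Lemma dirac_of_pair X b (e : gsect (DE E)) : gsect_in L X -> gsect_in A b ->
  anchor e = gfst b ->
  jpair (gsnd X) e = gsnd (br (bsec X) b) - dapp (gfst X) (gsnd b) + dapp e (gsnd (bsec X)).
Proof.
move=> LX Ab eb; apply: gsect_ext => x.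
have exb : symbol (e x) = gfst b x by rewrite -eb.
have := dirac_of_compatible pA (LX x) (dirac_of_sect LX) (erefl _) Ab exb.
rewrite /compatible => h; rewrite !(gsect_addE, gsect_oppE) h.
by apply: fibre_eqP => phi pD pN pZ; rewrite !(pD, pN) /=; ring.
Qed.

Lemma dirac_of_preserves : b_preserves L br.
Proof.
move=> X Y LX LY; have AX := dirac_of_sect LX; have AY := dirac_of_sect LY.
apply: gsect_pair_ext; first by rewrite bbr_fst (pla_anchor pA).
rewrite bbr_snd (dirac_of_pair LX AY); last by rewrite gfst_bsec.
by rewrite addrC -!addrA (addrCA (dapp (gfst Y) _)) subrr addr0 addNr addr0.
Qed.

Lemma dirac_of_closed X Y : gsect_in L X -> gsect_in L Y -> gsect_in L (omni_br X Y).
Proof.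
move=> LX LY x; have AX := dirac_of_sect LX; have AY := dirac_of_sect LY.
have Aab := pla_closed pA AX AY.
exists (br (bsec X) (bsec Y)); split=> //.
  by rewrite -(dirac_of_preserves LX LY).
move=> c e0 Ac e0c.
(* The computation differentiates, hence needs a section s of DE and not only e0. Since only values
   at x matter, c is replaced by f c, of which s has the symbol everywhere. *)
have [s [f [sx fx sa]]] := gauge_extend e0c.
have Afc := gsect_inZ f bA Ac.
have sa' : anchor s = gfst (f *: c) by rewrite sa; exact: gsect_ext.
apply: (compatible_tensor pA Aab Afc Ac _ _ _ e0c (e := s x)).
- by rewrite -(dirac_of_preserves LX LY).
- by rewrite gsect_scaleE fx scale1r.
- by rewrite -sa'.
move: (f *: c) Afc sa' => {Ac e0c sx fx sa e0 f} {}c Ac sc.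
set a := bsec X in AX Aab *; set b := bsec Y in AY Aab *.
have Aac := pla_closed pA AX Ac; have Abc := pla_closed pA AY Ac.
(* These relations, [e1] to [e5], express all pairings that occur through brackets of A and gauge
   operators; what is left is the Jacobi identity of A and commutators of operators. *)
have e1 := dirac_of_pair LX Ac sc; have e2 := dirac_of_pair LY Ac sc.
have e3 := dirac_of_pair LX AY (esym (gfst_bsec Y)).
have ga (Z : gsect (omni E)) d : gsect_in A (bsec Z) -> gsect_in A d -> anchor s = gfst d ->
    anchor (gbr (gfst Z) s) = gfst (br (bsec Z) d).
  move=> AZ Ad sd; rewrite (pla_anchor pA)// gfst_bsec -sd; exact: gsect_ext.
have e4 := dirac_of_pair LY Aac (ga X c AX Ac sc).
have e5 := dirac_of_pair LX Abc (ga Y c AY Ac sc).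
have jac : br (br a b) c = br a (br b c) - br b (br a c).
  have := pla_jacobi pA AX AY Ac; rewrite -/a -/b.
  rewrite (pla_skew pA Ac AX) (pla_skew pA Ac Aab).
  have -> : br b (- br a c) = - br b (br a c).
    have := pla_linr pA (-1) AY Aac (gsect_in0 bA); rewrite addr0 (pla0r pA AY) addr0.
    have c1 : cinf_cst M (-1) = -1 by exact: cinf_ext.
    by rewrite c1 !scaleN1r.
  by move=> /eqP; rewrite subr_eq0 => /eqP <-.
rewrite /compatible jac.
have -> : ((omni_br X Y x).2 : jet E x) (s x) =
    (jpair (lie_der (gfst X) (gsnd Y)) s - jpair (lie_der (gfst Y) (gsnd X)) s +
     jpair (jet_sec (jpair (gsnd X) (gfst Y))) s) x by [].
rewrite !lie_derP.
have -> : jpair (jet_sec (jpair (gsnd X) (gfst Y))) s = dapp s (jpair (gsnd X) (gfst Y)).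
  exact: gsect_ext.
rewrite e1 e2 e3 e4 e5 -/a -/b gsndD gsndN.
have dE (d : gsect (DE E)) u : dapp d u x = gauge_op (d x) u by [].
have -> : (omni_br X Y x).1 = gbr (gfst X) (gfst Y) x by [].
rewrite !(gsect_addE, gsect_oppE, dE, gauge_opD, gauge_opN, gbrE).
by apply: fibre_eqP => phi pD pN pZ; rewrite !(pD, pN); ring.
Qed.

(** Preservation of brackets puts every element of L' into L, by extending elements to sections of
    L'. Since L is isotropic, L is then contained in the orthogonal of L', which is L' itself. *)
Lemma dirac_of_unique (L' : forall x, set (omni E x)) :
  dirac L' -> bimage L' = A -> b_preserves L' br -> L = L'.
Proof.
move=> dL' iL' pL'; have [bL' oL' _] := dL'.
have LA X : gsect_in L' X -> gsect_in A (bsec X).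
  by move=> LX x; rewrite -iL'; exists (X x).
have ext x (X : omni E x) : L' x X -> exists2 Z : gsect (omni E), gsect_in L' Z & Z x = X.
  exact: (subbundle_extend (@vlocal_omni _ _ M _ E) (@omni_frames _ _ _ M E) bL').
have sub x (X : omni E x) : L' x X -> L X.
  move=> LX; have [Z LZ Zx] := ext _ _ LX.
  exists (bsec Z); split; [exact: LA|by rewrite -Zx|].
  move=> b e Ab eb; have := Ab x; rewrite -iL' => -[Y0 LY0 Y0b].
  have [Y LY Yx] := ext _ _ LY0.
  apply: (compatible_tensor pA (LA _ LZ) (LA _ LY) Ab _ _ _ eb (e := gfst Y x)).
  - by rewrite -Zx.
  - by rewrite -Y0b -Yx.
  - by [].
  have := congr1 (fun s => gsnd s x) (pL' _ _ LZ LY); rewrite bbr_snd => h.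
  rewrite /compatible -h -Zx !(gsect_addE, gsect_oppE).
  by rewrite -addrA [- _ + _]addrC addrA.
apply: functional_extensionality_dep => x; apply/seteqP; split=> X; last exact: sub.
move=> LX; rewrite oL' => Y /sub LY.
exact: (dirac_of_isotropic pA LX LY).
Qed.

Lemma algebroid_to_dirac : exists! L : (forall x : M, set (omni E x)),
  [/\ dirac L, reducible L, bimage L = A & b_preserves L br].
Proof.
exists L; split=> [|L' [dL' _ iL' pL']]; last exact: dirac_of_unique.
split.
- by split; [exact: dirac_of_subbundle|exact: dirac_of_orth|exact: dirac_of_closed].
- by rewrite /reducible dirac_of_image.
- exact: dirac_of_image.
- exact: dirac_of_preserves.
Qed.

End correspondence.

Theorem theorem3p7 (R : realType) (n r : nat) (M : manifold R n)
    (E : vbundle M r) (r_gt0 : (0 < r)%N) :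
  (forall L : (forall x : M, set (omni E x)), dirac L -> reducible L ->
     exists br : gsect (Tfam E) -> gsect (Tfam E) -> gsect (Tfam E),
       [/\ proj_lie_algebroid (bimage L) br,
           b_preserves L br
         & forall br' : gsect (Tfam E) -> gsect (Tfam E) -> gsect (Tfam E),
             proj_lie_algebroid (bimage L) br' -> b_preserves L br' ->
             forall a b : gsect (Tfam E),
               gsect_in (bimage L) a -> gsect_in (bimage L) b ->
               br' a b = br a b]) /\
  (forall (A : forall x : M, set (Tfam E x))
     (br : gsect (Tfam E) -> gsect (Tfam E) -> gsect (Tfam E)),
     proj_lie_algebroid A br ->
     exists! L : (forall x : M, set (omni E x)),
       [/\ dirac L, reducible L, bimage L = A & b_preserves L br]).
Proof.
split=> [L dL rL|A br pA]; first exact: dirac_to_algebroid.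
exact: algebroid_to_dirac.
Qed.
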